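(* Let $\mathcal K,\mathcal J$ be ideals in a right tensor $C^*$-precategory $\mathcal T$ with $\mathcal J\subset J(\mathcal K)$, and identify $\mathcal O_{\mathcal T}(\mathcal K,\mathcal J)=\mathcal{DR}(\mathcal K_{\mathcal J})$. There are one-to-one correspondences between the following objects: i) kernels of right tensor representations $\widetilde\pi$ of $\mathcal K_{\mathcal J}$ coisometric on $\mathcal K_{\mathcal J}$; ii) invariant and $\mathcal K_{\mathcal J}$-saturated ideals $\mathcal N_{\mathcal J}$ in $\mathcal K_{\mathcal J}$, that is, ideals satisfying $\mathcal N_{\mathcal J}\otimes_{\mathcal J}1\subset\mathcal N_{\mathcal J}$ and $(\otimes_{\mathcal J}1)^{-1}(\mathcal N_{\mathcal J})\subset\mathcal N_{\mathcal J}$; iii) gauge invariant ideals $P$ in $\mathcal O_{\mathcal T}(\mathcal K,\mathcal J)=\mathcal{DR}(\mathcal K_{\mathcal J})$. These correspondences preserve inclusions and are given by $$\mathcal N_{\mathcal J}=\ker\widetilde\pi,\qquad \ker\Psi_{\widetilde\pi}=\mathcal O(\mathcal N_{\mathcal J})=P,\qquad \mathcal N_{\mathcal J}(n,m)=\iota_{n,m}^{-1}(P),\quad n,m\in\mathbb N,$$ where $\iota=\{\iota_{n,m}\}_{n,m\in\mathbb N}$ is the universal right tensor representation of $\mathcal K_{\mathcal J}$ in $\mathcal{DR}(\mathcal K_{\mathcal J})$, $\Psi_{\widetilde\pi}$ is the representation of $\mathcal{DR}(\mathcal K_{\mathcal J})$ integrating $\widetilde\pi$ (that is, $\Psi_{\widetilde\pi}(\iota_{n,m}(a))=\widetilde\pi_{n,m}(a)$),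 and $\mathcal O(\mathcal N_{\mathcal J})$ is the closed linear span of the image of $\mathcal N_{\mathcal J}$ in $\mathcal{DR}(\mathcal K_{\mathcal J})$. In particular $$P\cong\mathcal{DR}(\mathcal N_{\mathcal J}),\qquad P=\overline{\mathrm{span}}\{\iota_{n,m}(a):a\in\mathcal N_{\mathcal J}(n,m)\}\subset\mathcal{DR}(\mathcal K_{\mathcal J}),$$ and the lattice of invariant $\mathcal K_{\mathcal J}$-saturated ideals in $\mathcal K_{\mathcal J}$ is isomorphic to the lattice of gauge invariant ideals in $\mathcal O_{\mathcal T}(\mathcal K,\mathcal J)$.
   Context: $\mathbb N=\{0,1,2,\dots\}$. A $C^*$-precategory $\mathcal T$ with object set $\mathbb N$ consists of complex Banach spaces $\mathcal T(n,m)$, bilinear associative compositions $\mathcal T(n,m)\times\mathcal T(m,l)\to\mathcal T(n,l)$ with $\|ab\|\le\|a\|\|b\|$, and antilinear involutive maps $*:\mathcal T(n,m)\to\mathcal T(m,n)$ with $(ab)^*=b^*a^*$ and $\|a^*a\|=\|a\|^2$. An ideal $\mathcal K$ in $\mathcal T$ is a family of closed subspaces $\mathcal K(n,m)\subset\mathcal T(n,m)$ stable under left and right composition with morphisms of $\mathcal T$; inclusions are entrywise; $q_{\mathcal J}:\mathcal T\to\mathcal T/\mathcal J$ is the entrywise quotient map. A right tensor $C^*$-precategory is such a $\mathcal T$ with linear maps $\otimes1:\mathcal T(n,m)\to\mathcal T(n+1,m+1)$ preserving composition and involution; $\otimes1^k$ is the $k$-th iterate. $J(\mathcal K)(n,m)=\{a\in\mathcal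 K(n,m):a\otimes1\in\mathcal K(n+1,m+1)\}$. A right tensor representation of an ideal $\mathcal K$ in a $C^*$-algebra $B$ is a family of linear maps $\pi_{n,m}:\mathcal K(n,m)\to B$ with $\pi_{n,m}(a)^*=\pi_{m,n}(a^* )$ and $\pi_{n,m}(a)\pi_{m+k,l}(b)=\pi_{n+k,l}((a\otimes1^k)b)$ for $a\in\mathcal K(n,m)$, $b\in\mathcal K(m+k,l)$; its kernel is $\{\ker\pi_{n,m}\}_{n,m}$; it is coisometric on $\mathcal J\subset J(\mathcal K)$ if $\pi_{n,m}(a)=\pi_{n+1,m+1}(a\otimes1)$ for $a\in\mathcal J(n,m)$. $\mathcal O_{\mathcal T}(\mathcal K,\mathcal J)$ is the universal $C^*$-algebra generated by the image of a universal right tensor representation of $\mathcal K$ coisometric on $\mathcal J$; the gauge action of $z\in S^1$ multiplies the image of $\mathcal K(n,m)$ by $z^{n-m}$, and an ideal is gauge invariant if it is globally invariant under this action. $\mathcal{DR}(\mathcal T)$: for $k\in\mathbb Z$ let $\mathcal{DR}^{(k)}(\mathcal T)=\varinjlim_r\mathcal T(r+k,r)$ (Banach inductive limit along $\otimes1$); $\mathcal{DR}(\mathcal T)$ is the completion of the $\mathbb Z$-graded $*$-algebra $\bigoplus_k\mathcal{DR}^{(k)}(\mathcal T)$ in the unique $C^*$-norm for which the circle action given by the grading is isometric. The canonical maps $\iota_{n,m}:\mathcal T(n,m)\to\mathcal{DR}(\mathcal T)$ form a right tensor representation coisometric on $\mathcal T$, universal for such representations. $\mathcal K_{\mathcal J}$: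 let $\mathcal M_{\mathcal T}(\mathcal K)$ be the $*$-algebra of matrices $\{a_{n,m}\}$, $a_{n,m}\in\mathcal K(n,m)$, finitely many nonzero, with entrywise linear structure, $(a^* )_{n,m}=(a_{m,n})^*$ and bilinear product where, with $\iota^{\mathcal M}_{n,m}(a)$ the matrix with single entry $a$ at $(n,m)$, $\iota^{\mathcal M}_{n,m}(a)\star\iota^{\mathcal M}_{p,l}(b)$ is $\iota^{\mathcal M}_{n+p-m,l}((a\otimes1^{p-m})b)$ if $m\le p$ and $\iota^{\mathcal M}_{n,l+m-p}(a(b\otimes1^{m-p}))$ if $p<m$. $\mathcal M(r+k,r)$ is the set of matrices with $a_{n,m}\neq0\Rightarrow n-m=k,\ m\le r$, with seminorm $\|a\|^{\mathcal J}_{r+k,r}=\max\{\max_{s<r}\|q_{\mathcal J}(x_s)\|,\|x_r\|\}$, $x_s=\sum_{0\le i\le s,\,i+k\ge0}a_{i+k,i}\otimes1^{s-i}$, and $\mathcal K_{\mathcal J}(n,m)=\mathcal M(n,m)/\|\cdot\|^{\mathcal J}_{n,m}$ (quotient by zero-seminorm elements). It is a right tensor $C^*$-precategory with right tensoring $\otimes_{\mathcal J}1$ induced by the inclusions $\mathcal M(n,m)\subset\mathcal M(n+1,m+1)$, and $a\mapsto\iota^{\mathcal M}_{n,m}(a)$ induces the isomorphism $\mathcal O_{\mathcal T}(\mathcal K,\mathcal J)\cong\mathcal{DR}(\mathcal K_{\mathcal J})$ used as identification. An invariant ideal $\mathcal N_{\mathcal J}$ is itself a right tensor $C^*$-precategory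 under $\otimes_{\mathcal J}1$.
   Formalization: The equality ker Ψ_π̃ = O(ker π̃) fails for general π̃ (evaluation at 1 on C(S^1)); proved instead: O(ker π̃) ⊂ ker Ψ_π̃ always, equality when ker Ψ_π̃ is gauge invariant, and each kernel N equals ker π̃ for some π̃ with ker Ψ_π̃ = O(N). *)

(* Defs.v *)
From HB Require Import structures.
From mathcomp Require Import all_boot all_order all_algebra.
From mathcomp Require Import complex.
From mathcomp Require Import all_classical all_reals all_analysis.

Set Implicit Arguments.
Unset Strict Implicit.
Unset Printing Implicit Defensive.

Import Order.TTheory GRing.Theory Num.Theory.
Import numFieldNormedType.Exports.

Local Open Scope classical_set_scope.
Local Open Scope complex_scope.
Local Open Scope ring_scope.

(* The norm of a [normedModType R[i]] takes its (real) values in [R[i]];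
   [rnorm] reads it in [R], where infima and limits of norms are taken. *)
Definition rnorm (R : realType) (V : normedModType R[i]) (x : V) : R :=
  complex.Re `|x|.

Definition lin_subspace (R : realType) (V : normedModType R[i]) (S : set V) : Prop :=
  S 0 /\ forall (c : R[i]) (x y : V), S x -> S y -> S (c *: x + y).

Definition closed_span (R : realType) (V : normedModType R[i]) (A : set V) : set V :=
  closure (smallest (@lin_subspace R V) A).

(* Norm of the class of [x] in the quotient of [V] by [S]. *)
Definition quotient_norm (R : realType) (V : normedModType R[i]) (S : set V)
    (x : V) : R :=
  inf [set rnorm (x - y) | y in S].

(* Not necessarily unital, possibly zero. *)

Record cstar_algebra (R : realType) := CstarAlgebra {
  ca_sort :> completeNormedModType R[i];
  ca_mul : ca_sort -> ca_sort -> ca_sort;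
  ca_star : ca_sort -> ca_sort;
  ca_mulDZl : forall (c : R[i]) (a b d : ca_sort),
    ca_mul (c *: a + b) d = c *: ca_mul a d + ca_mul b d;
  ca_mulDZr : forall (c : R[i]) (a b d : ca_sort),
    ca_mul a (c *: b + d) = c *: ca_mul a b + ca_mul a d;
  ca_mulA : forall a b d : ca_sort,
    ca_mul a (ca_mul b d) = ca_mul (ca_mul a b) d;
  ca_starDZ : forall (c : R[i]) (a b : ca_sort),
    ca_star (c *: a + b) = conjc c *: ca_star a + ca_star b;
  ca_starK : forall a : ca_sort, ca_star (ca_star a) = a;
  ca_starM : forall a b : ca_sort,
    ca_star (ca_mul a b) = ca_mul (ca_star b) (ca_star a);
  ca_normM : forall a b : ca_sort, `|ca_mul a b| <= `|a| * `|b|;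
  ca_normC : forall a : ca_sort, `|ca_mul (ca_star a) a| = `|a| ^+ 2 }.

Record star_hom (R : realType) (A B : cstar_algebra R) (f : A -> B) : Prop :=
  StarHom {
    star_homDZ : forall (c : R[i]) (a b : A), f (c *: a + b) = c *: f a + f b;
    star_homM : forall a b : A, f (ca_mul a b) = ca_mul (f a) (f b);
    star_homS : forall a : A, f (ca_star a) = ca_star (f a) }.

Definition alg_ker (R : realType) (A B : cstar_algebra R) (f : A -> B) : set A :=
  [set a | f a = 0].

Record is_alg_ideal (R : realType) (A : cstar_algebra R) (P : set A) : Prop :=
  IsAlgIdeal {
    alg_ideal_subspace : lin_subspace P;
    alg_ideal_closed : closed P;
    alg_ideal_mull : forall a b : A, P b -> P (ca_mul a b);
    alg_ideal_mulr : forall a b : A, P a -> P (ca_mul a b) }.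

Record is_cstar_subalgebra (R : realType) (A : cstar_algebra R) (S : set A) :
    Prop := IsCstarSubalgebra {
  cstar_sub_subspace : lin_subspace S;
  cstar_sub_closed : closed S;
  cstar_sub_mul : forall a b : A, S a -> S b -> S (ca_mul a b);
  cstar_sub_star : forall a : A, S a -> S (ca_star a) }.

(* [cp_comp a b] is [ab], for [a] in T(n,m) and [b] in T(m,l). *)
Record cstar_precategory (R : realType) := CstarPrecategory {
  cp_hom :> nat -> nat -> completeNormedModType R[i];
  cp_comp : forall n m l, cp_hom n m -> cp_hom m l -> cp_hom n l;
  cp_star : forall n m, cp_hom n m -> cp_hom m n;
  cp_compDZl : forall n m l (c : R[i]) (a b : cp_hom n m) (d : cp_hom m l),
    cp_comp (c *: a + b) d = c *: cp_comp a d + cp_comp b d;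
  cp_compDZr : forall n m l (c : R[i]) (a : cp_hom n m) (b d : cp_hom m l),
    cp_comp a (c *: b + d) = c *: cp_comp a b + cp_comp a d;
  cp_compA : forall n m l k (a : cp_hom n m) (b : cp_hom m l) (d : cp_hom l k),
    cp_comp a (cp_comp b d) = cp_comp (cp_comp a b) d;
  cp_starDZ : forall n m (c : R[i]) (a b : cp_hom n m),
    cp_star (c *: a + b) = conjc c *: cp_star a + cp_star b;
  cp_starK : forall n m (a : cp_hom n m), cp_star (cp_star a) = a;
  cp_starM : forall n m l (a : cp_hom n m) (b : cp_hom m l),
    cp_star (cp_comp a b) = cp_comp (cp_star b) (cp_star a);
  cp_normM : forall n m l (a : cp_hom n m) (b : cp_hom m l),
    `|cp_comp a b| <= `|a| * `|b|;
  cp_normC : forall n m (a : cp_hom n m), `|cp_comp (cp_star a) a| = `|a| ^+ 2 }.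

Record rt_precategory (R : realType) := RtPrecategory {
  rt_cat :> cstar_precategory R;
  tens1 : forall n m, rt_cat n m -> rt_cat n.+1 m.+1;
  tens1DZ : forall n m (c : R[i]) (a b : rt_cat n m),
    tens1 (c *: a + b) = c *: tens1 a + tens1 b;
  tens1M : forall n m l (a : rt_cat n m) (b : rt_cat m l),
    tens1 (cp_comp a b) = cp_comp (tens1 a) (tens1 b);
  tens1S : forall n m (a : rt_cat n m),
    tens1 (cp_star a) = cp_star (tens1 a) }.

(* The index is written [k + n] so that [k.+1 + n] reduces to [(k + n).+1]. *)
Fixpoint tens (R : realType) (T : rt_precategory R) (k n m : nat) (a : T n m) :
    T (k + n)%N (k + m)%N :=
  match k with
  | 0 => a
  | k'.+1 => tens1 (tens k' a)
  end.

Definition hom_family (R : realType) (T : cstar_precategory R) :=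
  forall n m, set (T n m).

Definition fam_full (R : realType) (T : cstar_precategory R) : hom_family T :=
  fun _ _ => setT.

Arguments fam_full {R} T.

Definition fam_sub (R : realType) (T : cstar_precategory R) (S1 S2 : hom_family T) :
    Prop :=
  forall n m, S1 n m `<=` S2 n m.

Record is_ideal (R : realType) (T : cstar_precategory R) (K : hom_family T) : Prop :=
  IsIdeal {
    ideal_subspace : forall n m, lin_subspace (K n m);
    ideal_closed : forall n m, closed (K n m);
    ideal_compl : forall n m l (a : T n m) (b : T m l),
      K m l b -> K n l (cp_comp a b);
    ideal_compr : forall n m l (a : T n m) (b : T m l),
      K n m a -> K n l (cp_comp a b) }.

Definition J_ideal (R : realType) (T : rt_precategory R) (K : hom_family T) :
    hom_family T :=
  fun n m => [set a | K n m a /\ K n.+1 m.+1 (tens1 a)].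

Definition tens_invariant (R : realType) (T : rt_precategory R)
    (N : hom_family T) : Prop :=
  forall n m (a : T n m), N n m a -> N n.+1 m.+1 (tens1 a).

(* Saturation with respect to the whole precategory. *)
Definition tens_saturated (R : realType) (T : rt_precategory R)
    (N : hom_family T) : Prop :=
  forall n m (a : T n m), N n.+1 m.+1 (tens1 a) -> N n m a.

(* Linear maps K(n,m) -> B are given by functions on all of T(n,m), of which only
   the restriction to K(n,m) is ever used. *)

Record is_rtrep (R : realType) (T : rt_precategory R) (K : hom_family T)
    (B : cstar_algebra R) (pi : forall n m, T n m -> B) : Prop := IsRtrep {
  rtrepDZ : forall n m (c : R[i]) (a b : T n m), K n m a -> K n m b ->
    pi n m (c *: a + b) = c *: pi n m a + pi n m b;
  rtrepS : forall n m (a : T n m), K n m a ->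
    ca_star (pi n m a) = pi m n (cp_star a);
  rtrepM : forall n m k l (a : T n m) (b : T (k + m)%N l),
    K n m a -> K (k + m)%N l b ->
    ca_mul (pi n m a) (pi (k + m)%N l b) =
      pi (k + n)%N l (cp_comp (tens k a) b) }.

Definition coisometric_on (R : realType) (T : rt_precategory R) (J : hom_family T)
    (B : cstar_algebra R) (pi : forall n m, T n m -> B) : Prop :=
  forall n m (a : T n m), J n m a -> pi n m a = pi n.+1 m.+1 (tens1 a).

Definition rep_ker (R : realType) (T : rt_precategory R) (K : hom_family T)
    (B : cstar_algebra R) (pi : forall n m, T n m -> B) : hom_family T :=
  fun n m => [set a | K n m a /\ pi n m a = 0].

Definition rep_image (R : realType) (T : rt_precategory R) (K : hom_family T)
    (B : cstar_algebra R) (pi : forall n m, T n m -> B) : set B :=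
  [set x | exists n m (a : T n m), K n m a /\ x = pi n m a].

(* [f] extends the representation [pi] of [K] along [iota]. *)
Definition integrates (R : realType) (T : rt_precategory R) (K : hom_family T)
    (A B : cstar_algebra R) (iota : forall n m, T n m -> A)
    (pi : forall n m, T n m -> B) (f : A -> B) : Prop :=
  star_hom f /\ forall n m (a : T n m), K n m a -> f (iota n m a) = pi n m a.

(* [is_universal_algebra K J i]: the C*-algebra [O] together with [i] is
   O_T(K,J); this determines [(O, i)] up to isomorphism. *)

Record is_universal_algebra (R : realType) (T : rt_precategory R)
    (K J : hom_family T) (O : cstar_algebra R) (i : forall n m, T n m -> O) : Prop :=
  IsUniversalAlgebra {
    ua_rep : is_rtrep K i;
    ua_coisometric : coisometric_on J i;
    ua_generated : smallest (@is_cstar_subalgebra R O) (rep_image K i) = setT;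
    ua_universal : forall (B : cstar_algebra R) (pi : forall n m, T n m -> B),
      is_rtrep K pi -> coisometric_on J pi ->
      exists f : O -> B, integrates K i pi f }.

Definition circle (R : realType) : set R[i] := [set z | `|z| = 1].

Record is_gauge_action (R : realType) (T : rt_precategory R) (K : hom_family T)
    (O : cstar_algebra R) (i : forall n m, T n m -> O)
    (gamma : R[i] -> O -> O) : Prop := IsGaugeAction {
  gauge_hom : forall z, @circle R z -> star_hom (gamma z);
  gauge_gen : forall z, @circle R z -> forall n m (a : T n m), K n m a ->
    gamma z (i n m a) = z ^ (n%:Z - m%:Z) *: i n m a }.

Definition gauge_invariant (R : realType) (O : cstar_algebra R)
    (gamma : R[i] -> O -> O) (P : set O) : Prop :=
  forall z, @circle R z -> gamma z @` P = P.

(* [is_DR N iota]: the C*-algebra [D] with the maps [iota] is DR(N), where [N]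
   is either the whole of [T] ([fam_full T]) or an invariant ideal of [T],
   seen as a right tensor C*-precategory.  The degree-k component DR^(k)(N) is
   the closure in [D] of the union over r of iota(N(r+k,r)):
   - [DR_norm] says that its norm is that of the Banach inductive limit along
     [tens1], i.e. the limit of the norms of [tens s a];
   - [DR_rep] and [DR_coisometric] say that product, involution and inclusion
     maps are those of the graded *-algebra;
   - [DR_dense] and [DR_circle] say that [D] is the completion of the sum of the
     components in a C*-norm for which the circle action given by the grading
     is isometric.  Averaging over roots of unity, this forces the sum of the
     components to be direct. *)

Record is_DR (R : realType) (T : rt_precategory R) (N : hom_family T)
    (D : cstar_algebra R) (iota : forall n m, T n m -> D) : Prop := IsDR {
  DR_rep : is_rtrep N iota;
  DR_coisometric : coisometric_on N iota;
  DR_norm : forall n m (a : T n m), N n m a ->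
    (fun s => rnorm (tens s a)) @ \oo --> rnorm (iota n m a);
  DR_dense : closed_span (rep_image N iota) = setT;
  DR_circle : forall z, @circle R z ->
    forall (k : nat) (a : forall n m, T n m), (forall n m, N n m (a n m)) ->
    `|\sum_(n < k) \sum_(m < k) z ^ (n%:Z - m%:Z) *: iota n m (a n m)| =
      `|\sum_(n < k) \sum_(m < k) iota n m (a n m)| }.

(* O(N): the closed linear span of the image of [N]. *)
Definition O_of (R : realType) (T : rt_precategory R) (D : cstar_algebra R)
    (iota : forall n m, T n m -> D) (N : hom_family T) : set D :=
  closed_span (rep_image N iota).

Definition iota_inv (R : realType) (T : rt_precategory R) (D : cstar_algebra R)
    (iota : forall n m, T n m -> D) (P : set D) : hom_family T :=
  fun n m => iota n m @^-1` P.

Definition mat (R : realType) (T : cstar_precategory R) := forall n m, T n m.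

(* The matrix with single entry [a] at [(n, m)].  Its value at an entry that is
   only propositionally equal to [(n, m)] also serves below as the transport
   of [a] along the equality of indices. *)
Definition single (R : realType) (T : cstar_precategory R) (n m : nat)
    (a : T n m) : mat T :=
  fun i j =>
    match @eqP _ n i, @eqP _ m j with
    | ReflectT e, ReflectT f =>
        match e in _ = i', f in _ = j' return T i' j' with
        | erefl, erefl => a
        end
    | _, _ => 0
    end.

Definition mat_lin (R : realType) (T : cstar_precategory R) (c : R[i])
    (a b : mat T) : mat T :=
  fun n m => c *: a n m + b n m.

Definition mat_star (R : realType) (T : cstar_precategory R) (a : mat T) : mat T :=
  fun n m => cp_star (a m n).

Definition single_mul (R : realType) (T : rt_precategory R) (n m p l : nat)
    (a : T n m) (b : T p l) : mat T :=
  if (m <= p)%N then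
    single (cp_comp (single (tens (p - m) a) (p - m + n)%N p) b)
  else
    single (cp_comp a (single (tens (m - p) b) m (m - p + l)%N)).

(* Bilinear extension of [single_mul]; the sum is finite for matrices with
   finitely many nonzero entries, the only ones on which it is used. *)
Definition mat_mul (R : realType) (T : rt_precategory R) (a b : mat T) : mat T :=
  fun i j => \sum_(q \in [set: (nat * nat) * (nat * nat)])
    single_mul (a q.1.1 q.1.2) (b q.2.1 q.2.2) i j.

(* M_T(K) *)
Definition mats (R : realType) (T : cstar_precategory R) (K : hom_family T) :
    set (mat T) :=
  [set a | (forall i j, K i j (a i j)) /\
           finite_set [set q : nat * nat | a q.1 q.2 != 0]].

(* M(n,m), for [n = r + k] and [m = r] with k an integer *)
Definition Mspace (R : realType) (T : cstar_precategory R) (K : hom_family T)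
    (n m : nat) : set (mat T) :=
  [set a | mats K a /\
    forall i j, a i j != 0 -> (i%:Z - j%:Z = n%:Z - m%:Z)%R /\ (j <= m)%N].

(* x_s for a matrix in M(n,m), with k = n - m.  The guard is i + k >= 0, and
   under it the truncated [i + n - m] is i + k.  When s + k < 0 the sum is empty
   and the value is 0. *)
Definition xsum (R : realType) (T : rt_precategory R) (n m : nat) (a : mat T)
    (s : nat) : T (s + n - m)%N s :=
  \sum_(i < s.+1 | (m <= i + n)%N)
    single (tens (s - i) (a (i + n - m)%N i)) (s + n - m)%N s.

Definition seminormJ (R : realType) (T : rt_precategory R) (J : hom_family T)
    (n m : nat) (a : mat T) : R :=
  Num.max
    (\big[Num.max/0]_(s < m) quotient_norm (J _ _) (xsum n m a s))
    (rnorm (xsum n m a m)).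

(* [is_KJ K J phi]: the right tensor C*-precategory [L] is K_J, [phi n m] being
   the quotient map M(n,m) -> K_J(n,m).  By [KJ_norm] the kernel of [phi n m]
   on M(n,m) consists of the elements of zero seminorm. *)
Record is_KJ (R : realType) (T : rt_precategory R) (K J : hom_family T)
    (L : rt_precategory R) (phi : forall n m, mat T -> L n m) : Prop := IsKJ {
  KJ_lin : forall n m (c : R[i]) (a b : mat T),
    Mspace K n m a -> Mspace K n m b ->
    phi n m (mat_lin c a b) = c *: phi n m a + phi n m b;
  KJ_surj : forall n m (x : L n m), exists2 a, Mspace K n m a & phi n m a = x;
  KJ_norm : forall n m (a : mat T), Mspace K n m a ->
    rnorm (phi n m a) = seminormJ J n m a;
  KJ_comp : forall n m l (a b : mat T), Mspace K n m a -> Mspace K m l b ->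
    cp_comp (phi n m a) (phi m l b) = phi n l (mat_mul a b);
  KJ_star : forall n m (a : mat T), Mspace K n m a ->
    cp_star (phi n m a) = phi m n (mat_star a);
  KJ_tens : forall n m (a : mat T), Mspace K n m a ->
    tens1 (phi n m a) = phi n.+1 m.+1 a }.

Definition is_glb (X : Type) (A : set X) (le : X -> X -> Prop) (x y m : X) : Prop :=
  [/\ A m, le m x, le m y & forall w, A w -> le w x -> le w y -> le w m].

Definition is_lub (X : Type) (A : set X) (le : X -> X -> Prop) (x y j : X) : Prop :=
  [/\ A j, le x j, le y j & forall w, A w -> le x w -> le y w -> le j w].

Definition is_lattice (X : Type) (A : set X) (le : X -> X -> Prop) : Prop :=
  forall x y, A x -> A y ->
    (exists m, is_glb A le x y m) /\ (exists j, is_lub A le x y j).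

Record lattice_iso (X Y : Type) (A : set X) (leA : X -> X -> Prop)
    (B : set Y) (leB : Y -> Y -> Prop) (f : X -> Y) : Prop := LatticeIso {
  lattice_iso_dom : is_lattice A leA;
  lattice_iso_cod : is_lattice B leB;
  lattice_iso_bij : set_bij A B f;
  lattice_iso_glb : forall x y m, A x -> A y ->
    is_glb A leA x y m -> is_glb B leB (f x) (f y) (f m);
  lattice_iso_lub : forall x y j, A x -> A y ->
    is_lub A leA x y j -> is_lub B leB (f x) (f y) (f j) }.

Definition rep_kernels (R : realType) (L : rt_precategory R) :
    set (hom_family L) :=
  [set N : hom_family L |
    exists (B : cstar_algebra R) (pi : forall n m, L n m -> B),
    [/\ is_rtrep (fam_full L) pi, coisometric_on (fam_full L) pi
      & N = rep_ker (fam_full L) pi]].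

Arguments rep_kernels {R} L.

Definition inv_sat_ideals (R : realType) (L : rt_precategory R) :
    set (hom_family L) :=
  [set N : hom_family L | [/\ is_ideal N, tens_invariant N & tens_saturated N]].

Arguments inv_sat_ideals {R} L.

Definition gauge_ideals (R : realType) (O : cstar_algebra R)
    (gamma : R[i] -> O -> O) : set (set O) :=
  [set P : set O | is_alg_ideal P /\ gauge_invariant gamma P].

(* Main.v *)
(* A *-homomorphism is contractive: if y = y^* has norm < 1, then the fixed point k
   of k |-> (y^2 + k^2) / 2 makes 1 - k + i y unitary, and this survives in the image.
   It also follows that V = 1 - 2 y^2 is a contraction, and the Cesaro means of its
   powers, which are 1 - e with e in the ideal of y, satisfy the mean ergodic estimate
   |y^2 (1 - e)| <= 1/n.  These e serve as approximate units (closed ideals are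
   self-adjoint, quotients are C*-algebras) and as spectral cut-offs: an element of a
   C*-algebra whose image is close to an ideal is close to the preimage of that ideal.

   A C*-norm with isometric circle action on a graded *-algebra is determined
   by its values on the homogeneous elements, even when those are only known up to a
   constant factor.  Indeed
   Fourier coefficients bound |x| by a multiple of max_k |x_k| growing linearly with the
   number of degrees, and applying this to the powers (x^* x)^(2^j), of norm
   |x|^(2^(j+1)), the constant disappears.  This integrates coisometric representations,
   identifies DR(N) with O(N), and shows that a gauge invariant ideal P and the ideal
   generated by its homogeneous elements have the same quotient norm.  Conversely an
   element iota(a) of O(N) is approximated by homogeneous elements of N in its degree,
   hence a (x) 1^s is close to N for large s, hence a is close to N by saturation. *)

Require Import Defs.
From HB Require Import structures.
From mathcomp Require Import all_boot all_order all_algebra.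
From mathcomp Require Import complex ring lra zify.
From mathcomp Require cyclic separable cyclotomic.
From mathcomp Require Import all_classical all_reals all_analysis.

Set Implicit Arguments.
Unset Strict Implicit.
Unset Printing Implicit Defensive.

Import Order.TTheory GRing.Theory Num.Theory.
Import numFieldNormedType.Exports.

Local Open Scope classical_set_scope.
Local Open Scope complex_scope.
Local Open Scope ring_scope.

(** * Linear identities *)

(** No spectrum, positivity or functional calculus enters: every C*-estimate comes from the
    C*-identity. The price is a constant: where an injective homomorphism between quotients would be
    isometric, iterated halving of distances only yields the factor 4, the sum of steps 2 eps, eps,
    eps / 2, ... The factor is uniform in the degree, which is what allows the comparison of norms
    by powers to absorb it. The same distance estimate serves both compositions of the
    correspondence: applied to iterated tensoring it recovers N from O(N), applied to [iota] it
    recovers P from its homogeneous part. The kernel of an integrated representation need not be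
    gauge invariant: a point evaluation on C(S^1) is injective in each degree. The passage from N to
    an ideal of O therefore goes through the quotient of O by O(N), not through an arbitrary
    representation with kernel N. *)

Section LinearExpressions.
Variables (K : comNzRingType) (V : lmodType K).

(** Reflection syntax: atoms are positions in a list, so that an identity of linear combinations
    splits into one scalar identity per atom. *)
Inductive lexpr :=
  | LVar of nat | LZero | LAdd of lexpr & lexpr | LOpp of lexpr
  | LScale of K & lexpr.

Fixpoint leval (env : seq V) (e : lexpr) : V :=
  match e with
  | LVar i => nth 0 env i
  | LZero => 0
  | LAdd a b => leval env a + leval env b
  | LOpp a => - leval env a
  | LScale c a => c *: leval env a
  end.

Fixpoint lcoef (e : lexpr) (i : nat) : K :=
  match e with
  | LVar j => if i == j then 1 else 0
  | LZero => 0
  | LAdd a b => lcoef a i + lcoef b i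
  | LOpp a => - lcoef a i
  | LScale c a => c * lcoef a i
  end.

Lemma levalE env e : leval env e = \sum_(i < size env) lcoef e i *: nth 0 env i.
Proof.
elim: e => [j||a IHa b IHb|a IHa|c a IHa] /=.
- have [jlt|jge] := ltnP j (size env).
    rewrite (bigD1 (Ordinal jlt)) //= eqxx scale1r big1 ?addr0 // => i.
    by rewrite -val_eqE /= => /negbTE ->; rewrite scale0r.
  rewrite nth_default // big1 // => i _.
  by rewrite ltn_eqF ?scale0r // (leq_trans _ jge).
- by rewrite big1 // => i _; rewrite scale0r.
- by rewrite IHa IHb -big_split; apply: eq_bigr => i _; rewrite scalerDl.
- by rewrite IHa -sumrN; apply: eq_bigr => i _; rewrite scaleNr.
- by rewrite IHa scaler_sumr; apply: eq_bigr => i _; rewrite scalerA.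
Qed.

(** A conjunction by recursion rather than a quantifier over indices: after [/=], repeated [split]
    leaves separate goals for [ring]. *)
Fixpoint lcoef_eq (n : nat) (e1 e2 : lexpr) : Prop :=
  match n with
  | 0 => True
  | n'.+1 => lcoef e1 n' = lcoef e2 n' /\ lcoef_eq n' e1 e2
  end.

Lemma leval_eq env e1 e2 : lcoef_eq (size env) e1 e2 -> leval env e1 = leval env e2.
Proof.
move=> h; rewrite !levalE; apply: eq_bigr => i _; congr (_ *: _).
elim: (size env) h i => [_ []//|n IHn] /= [h1 h2] [k /=].
by rewrite ltnS leq_eqVlt => /orP[/eqP -> //|klt]; apply: (IHn h2 (Ordinal klt)).
Qed.

End LinearExpressions.

Arguments LZero {K}.
Arguments LVar {K}.

Ltac lmod_mem x l :=
  match l with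
  | nil => constr:(false)
  | cons x _ => constr:(true)
  | cons _ ?l' => lmod_mem x l'
  end.
Ltac lmod_idx x l :=
  match l with
  | cons x _ => constr:(O)
  | cons _ ?l' => let n := lmod_idx x l' in constr:(S n)
  end.
Ltac lmod_vars t l :=
  match t with
  | @GRing.add _ ?a ?b => let l1 := lmod_vars a l in lmod_vars b l1
  | @GRing.opp _ ?a => lmod_vars a l
  | @GRing.zero _ => l
  | @GRing.scale _ _ _ ?a => lmod_vars a l
  | _ => match lmod_mem t l with true => l | false => constr:(cons t l) end
  end.
Ltac lmod_reify K l t :=
  match t with
  | @GRing.add _ ?a ?b =>
      let e1 := lmod_reify K l a in let e2 := lmod_reify K l b in
      constr:(@LAdd K e1 e2)
  | @GRing.opp _ ?a => let e1 := lmod_reify K l a in constr:(@LOpp K e1)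
  | @GRing.zero _ => constr:(@LZero K)
  | @GRing.scale _ _ ?c ?a => let e1 := lmod_reify K l a in constr:(@LScale K c e1)
  | _ => let n := lmod_idx t l in constr:(@LVar K n)
  end.
(* Decides equalities of linear combinations in a module over [R[i]]; coefficients
   that [ring] cannot compare are left as goals. *)
Ltac lmod R :=
  match goal with
  | |- @eq ?V ?a ?b =>
      let l1 := lmod_vars a (@nil V) in
      let l := lmod_vars b l1 in
      let e1 := lmod_reify (R[i]) l a in
      let e2 := lmod_reify (R[i]) l b in
      apply: (@leval_eq _ _ l e1 e2);
      rewrite /=; do ?split; try ring
  end.

(** * Norms and limits *)

Section Norms.
Variables (R : realType).
Local Notation C := R[i].

Implicit Types V : normedModType C.

Lemma normE V (x : V) : `|x| = (rnorm x)%:C.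
Proof. by rewrite /rnorm RRe_real // ger0_real. Qed.

Lemma rnorm_ge0 V (x : V) : 0 <= rnorm x.
Proof. by rewrite -ler0c -normE. Qed.

Lemma rnorm0 V : rnorm (0 : V) = 0.
Proof. by rewrite /rnorm normr0. Qed.

Lemma rnorm_eq0 V (x : V) : rnorm x = 0 -> x = 0.
Proof. by move=> x0; apply/normr0_eq0; rewrite normE x0. Qed.

Lemma rnormN V (x : V) : rnorm (- x) = rnorm x.
Proof. by rewrite /rnorm normrN. Qed.

Lemma rnormB V (x y : V) : rnorm (x - y) = rnorm (y - x).
Proof. by rewrite /rnorm distrC. Qed.

Lemma rnormD V (x y : V) : rnorm (x + y) <= rnorm x + rnorm y.
Proof. by rewrite -lecR rmorphD /= -!normE ler_normD. Qed.

Lemma rnorm_dist V (x y z : V) : rnorm (x - z) <= rnorm (x - y) + rnorm (y - z).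
Proof. by apply: le_trans (rnormD _ _); rewrite addrA subrK. Qed.

Definition cabs (c : C) : R := complex.Re `|c|.

Lemma cabsE c : `|c| = (cabs c)%:C.
Proof. by rewrite /cabs RRe_real // ger0_real. Qed.

Lemma cabs_ge0 c : 0 <= cabs c.
Proof. by rewrite -ler0c -cabsE. Qed.

Lemma cabsM c d : cabs (c * d) = cabs c * cabs d.
Proof. by apply: (@complexI R); rewrite rmorphM /= -!cabsE normrM. Qed.

Lemma cabs_real (r : R) : 0 <= r -> cabs r%:C = r.
Proof. by move=> r0; apply: (@complexI R); rewrite -cabsE ger0_norm ?ler0c. Qed.

Lemma rnormZ V (c : C) (x : V) : rnorm (c *: x) = cabs c * rnorm x.
Proof. by apply: (@complexI R); rewrite rmorphM /= -cabsE -!normE normrZ. Qed.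

Lemma rnormZr V (r : R) (x : V) : 0 <= r -> rnorm (r%:C *: x) = r * rnorm x.
Proof. by move=> r0; rewrite rnormZ cabs_real. Qed.

Lemma rnorm_sum V I (r : seq I) (P : pred I) (F : I -> V) :
  rnorm (\sum_(i <- r | P i) F i) <= \sum_(i <- r | P i) rnorm (F i).
Proof.
elim/big_rec2: _ => [|i y x _ h]; first by rewrite rnorm0.
by apply: le_trans (rnormD _ _) _; rewrite lerD2l.
Qed.

Lemma ball_rnormP V (x y : V) (e : R) : ball x e%:C y <-> rnorm (x - y) < e.
Proof. by rewrite -ball_normE /ball_ /= normE ltcR. Qed.

Lemma nbhs_rnormP V (x : V) (A : set V) :
  nbhs x A <-> exists2 e : R, 0 < e & forall y, rnorm (x - y) < e -> A y.
Proof.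
split.
  move=> /nbhs_ballP[e /= e0 h].
  have ee : e = (complex.Re e)%:C by rewrite RRe_real // gtr0_real.
  exists (complex.Re e); first by rewrite -ltcR -ee.
  by move=> y hy; apply: h; rewrite ee; apply/ball_rnormP.
move=> [e e0 h]; apply/nbhs_ballP; exists e%:C => /=; first by rewrite ltcR.
by move=> y /ball_rnormP; exact: h.
Qed.

Lemma closureP V (S : set V) (x : V) :
  closure S x <-> forall e : R, 0 < e -> exists2 y, S y & rnorm (x - y) < e.
Proof.
split.
  move=> h e e0; have [|y [Sy hy]] := h [set y | rnorm (x - y) < e].
    by apply/nbhs_rnormP; exists e.
  by exists y.
move=> h B /nbhs_rnormP[e e0 hB]; have [y Sy hy] := h e e0.
by exists y; split => //; apply: hB.
Qed.

Lemma closed_approx V (S : set V) : closed S ->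
  forall x, (forall e : R, 0 < e -> exists2 y, S y & rnorm (x - y) < e) -> S x.
Proof. by move=> cS x h; rewrite (closure_id S).1 //; apply/closureP. Qed.

Lemma closed_of_approx V (S : set V) :
  (forall x, (forall e : R, 0 < e -> exists2 y, S y & rnorm (x - y) < e) -> S x) ->
  closed S.
Proof. by move=> h; apply/closure_id/seteqP; split; [exact: subset_closure|move=> x /closureP/h]. Qed.

(** Sequences with real epsilons: the balls of a [normedModType R[i]] have radii in [R[i]], which is
    only partially ordered. *)
Definition rcauchy V (u : nat -> V) := forall e : R, 0 < e ->
  exists N, forall n m, (N <= n)%N -> (N <= m)%N -> rnorm (u n - u m) < e.

Definition rlim V (u : nat -> V) (l : V) := forall e : R, 0 < e ->
  exists N, forall n, (N <= n)%N -> rnorm (u n - l) < e.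

Lemma rlim_cvg V (u : nat -> V) (l : V) : rlim u l <-> u @ \oo --> l.
Proof.
split.
  move=> h A /nbhs_rnormP[e e0 hA]; have [N hN] := h e e0.
  by exists N => // n /= Nn; apply: hA; rewrite rnormB; apply: hN.
move=> h e e0; have [|N _ hN] := h [set y | rnorm (y - l) < e].
  by apply/nbhs_rnormP; exists e => // y; rewrite rnormB.
by exists N => n Nn; apply: hN.
Qed.

Lemma rlim_complete (V : completeNormedModType C) (u : nat -> V) :
  rcauchy u -> exists l, rlim u l.
Proof.
move=> cu; suff /cvg_ex[l hl] : cvg (u @ \oo) by exists l; apply/rlim_cvg.
apply: cauchy_cvg; apply: cauchy_exP => e e0.
have ee : e = (complex.Re e)%:C by rewrite RRe_real // gtr0_real.
have e0' : 0 < complex.Re e by rewrite -ltcR -ee.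
have [N hN] := cu _ e0'; exists (u N); exists N => // n /= Nn.
by rewrite ee; apply/ball_rnormP; apply: hN.
Qed.

Lemma rlim_unique V (u : nat -> V) (l l' : V) : rlim u l -> rlim u l' -> l = l'.
Proof.
move=> h h'; apply/eqP; rewrite -subr_eq0; apply/eqP/rnorm_eq0/le_anti.
rewrite rnorm_ge0 andbT leNgt; apply/negP => d0.
have d2 : 0 < rnorm (l - l') / 2 by rewrite divr_gt0.
have [N hN] := h _ d2; have [M hM] := h' _ d2.
have := hN (maxn N M) (leq_maxl _ _); have := hM (maxn N M) (leq_maxr _ _).
have := rnorm_dist l (u (maxn N M)) l'; rewrite (rnormB l (u _)); lra.
Qed.

End Norms.

Section Limits.
Variables (R : realType).
Local Notation C := R[i].
Implicit Types V : normedModType C.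

(** A Lipschitz bound is enough to pass to the limit; scaling, the involution and one-sided
    multiplication are all treated this way. *)
Lemma rlim_dom V (W : normedModType C) (u : nat -> V) l (w : nat -> W) l2 (M : R) :
  rlim u l -> (forall n, rnorm (w n - l2) <= M * rnorm (u n - l)) -> rlim w l2.
Proof.
move=> hu h e e0; have M0 : 0 < `|M| + 1 by rewrite ltr_wpDl.
have [N hN] := hu (e / (`|M| + 1)) (divr_gt0 e0 M0).
exists N => n /hN; rewrite ltr_pdivlMr // => hn.
apply: le_lt_trans (h n) _; apply: le_lt_trans hn; rewrite mulrC.
apply: ler_wpM2l; first exact: rnorm_ge0.
by apply: le_trans (ler_norm _) _; rewrite lerDl.
Qed.

Lemma rlim_shift V (u : nat -> V) l : rlim u l -> rlim (fun n => u n.+1) l.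
Proof. by move=> h e /h[N hN]; exists N => n Nn; apply: hN; apply: leqW. Qed.

Lemma rlim_cst V (l : V) : rlim (fun=> l) l.
Proof. by move=> e e0; exists 0 => n _; rewrite subrr rnorm0. Qed.

Lemma rlimD V (u v : nat -> V) l l' : rlim u l -> rlim v l' ->
  rlim (fun n => u n + v n) (l + l').
Proof.
move=> hu hv e e0; have e2 : 0 < e / 2 by rewrite divr_gt0.
have [N hN] := hu _ e2; have [M hM] := hv _ e2; exists (maxn N M) => n.
rewrite geq_max => /andP[/hN h1 /hM h2].
rewrite (_ : _ - _ = (u n - l) + (v n - l')); last by lmod R.
by apply: le_lt_trans (rnormD _ _) _; rewrite [e]splitr ltrD.
Qed.

Lemma rlimZ V (c : C) (u : nat -> V) l : rlim u l -> rlim (fun n => c *: u n) (c *: l).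
Proof.
by move=> h; apply: (rlim_dom (M := cabs c) h) => n; rewrite -scalerBr rnormZ.
Qed.

Lemma closed_rlim V (S : set V) (u : nat -> V) l :
  closed S -> (forall n, S (u n)) -> rlim u l -> S l.
Proof.
move=> cS Su h; apply: closed_approx => // e e0; have [N hN] := h e e0.
by exists (u N) => //; rewrite rnormB; apply: hN.
Qed.

Lemma rlim_le V (u : nat -> V) l (M : R) :
  (forall n, rnorm (u n) <= M) -> rlim u l -> rnorm l <= M.
Proof.
move=> hM h; apply/ler_addgt0Pr => e e0; have [N hN] := h e e0.
have := hN N (leqnn _); rewrite rnormB => hl.
have := rnorm_dist l (u N) 0; rewrite !subr0 => h3; have := hM N; lra.
Qed.

Lemma exists_small_expr (M q e : R) : 0 <= q -> q < 1 -> 0 < e ->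
  exists n, M * q ^+ n < e.
Proof.
move=> q0 q1 e0; have M0 : 0 < `|M| + 1 by rewrite ltr_wpDl.
have q1' : `|q| < 1 by rewrite ger0_norm.
have /cvgrPdist_lt/(_ _ (divr_gt0 e0 M0))[n _ /(_ n (leqnn n))] := cvg_expr q1'.
rewrite /= sub0r normrN normrX ger0_norm // ltr_pdivlMr // => h; exists n.
apply: le_lt_trans h; rewrite mulrC ler_wpM2l ?exprn_ge0 //.
by apply: le_trans (ler_norm _) _; rewrite lerDl.
Qed.

Lemma geometric_dist V (u : nat -> V) (M q : R) : 0 <= q -> q < 1 ->
  (forall n, rnorm (u n.+1 - u n) <= M * q ^+ n) ->
  forall n k, rnorm (u (k + n)%N - u n) <= M / (1 - q) * q ^+ n * (1 - q ^+ k).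
Proof.
move=> q0 q1 h n; elim=> [|k IHk]; first by rewrite add0n subrr rnorm0 expr0 subrr mulr0.
apply: le_trans (rnorm_dist _ (u (k + n)%N) _) _.
apply: le_trans (lerD (h _) IHk) _; rewrite exprD exprS.
by rewrite le_eqVlt; apply/orP; left; apply/eqP; field; rewrite subr_eq0 gt_eqF.
Qed.

(** The explicit distance to the limit matters as much as its existence: it produces the constant 4
    of [lift_distance]. *)
Lemma geometric_limit (V : completeNormedModType C) (u : nat -> V) (M q : R) :
  0 <= M -> 0 <= q -> q < 1 -> (forall n, rnorm (u n.+1 - u n) <= M * q ^+ n) ->
  exists2 l, rlim u l & forall n, rnorm (l - u n) <= M / (1 - q) * q ^+ n.
Proof.
move=> M0 q0 q1 h.
have q1' : 0 < 1 - q by rewrite subr_gt0.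
have hd n m : (n <= m)%N -> rnorm (u m - u n) <= M / (1 - q) * q ^+ n.
  move=> /subnK <-; apply: le_trans (geometric_dist q0 q1 h n _) _.
  rewrite -[leRHS]mulr1; apply: ler_wpM2l.
    by rewrite mulr_ge0 ?exprn_ge0 // divr_ge0 // ltW.
  by rewrite gerBl exprn_ge0.
have [|l hl] := @rlim_complete _ V u.
  move=> e e0; have e2 : 0 < e / 2 by rewrite divr_gt0.
  have [N hN] := exists_small_expr (M / (1 - q)) q0 q1 e2.
  exists N => n m Nn Nm; apply: le_lt_trans (rnorm_dist _ (u N) _) _.
  have := hd _ _ Nn; have := hd _ _ Nm; rewrite (rnormB (u m)); lra.
exists l => // n; apply: (@rlim_le _ (fun k => u (k + n)%N - u n)).
  by move=> k; apply: hd; rewrite leq_addl.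
apply: rlimD; last exact: rlim_cst.
by move=> e /hl[N hN]; exists N => k Nk; apply: hN; apply: leq_trans (leq_addr _ _).
Qed.

End Limits.

(** * Contractivity of *-homomorphisms *)

Notation "a ** b" := (cp_comp a b) (at level 40, left associativity).
Notation "a ^s" := (cp_star a) (at level 2, format "a ^s").

Section Precategories.
Variables (R : realType) (T : cstar_precategory R).
Local Notation C := R[i].

Lemma compDl n m l (a b : T n m) (d : T m l) : (a + b) ** d = a ** d + b ** d.
Proof. by have := cp_compDZl 1 a b d; rewrite !scale1r. Qed.
Lemma comp0l n m l (d : T m l) : (0 : T n m) ** d = 0.
Proof. by apply: (addrI (0 ** d)); rewrite -compDl !addr0. Qed.
Lemma compZl n m l c (a : T n m) (d : T m l) : (c *: a) ** d = c *: (a ** d).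
Proof. by have := cp_compDZl c a 0 d; rewrite comp0l !addr0. Qed.
Lemma compNl n m l (a : T n m) (d : T m l) : (- a) ** d = - (a ** d).
Proof. by rewrite -scaleN1r compZl scaleN1r. Qed.
Lemma compDr n m l (d : T n m) (a b : T m l) : d ** (a + b) = d ** a + d ** b.
Proof. by have := cp_compDZr 1 d a b; rewrite !scale1r. Qed.
Lemma comp0r n m l (d : T n m) : d ** (0 : T m l) = 0.
Proof. by apply: (addrI (d ** 0)); rewrite -compDr !addr0. Qed.
Lemma compZr n m l c (d : T n m) (a : T m l) : d ** (c *: a) = c *: (d ** a).
Proof. by have := cp_compDZr c d a 0; rewrite comp0r !addr0. Qed.
Lemma compNr n m l (d : T n m) (a : T m l) : d ** (- a) = - (d ** a).
Proof. by rewrite -scaleN1r compZr scaleN1r. Qed.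

Definition mcompE := (compDl, compZl, compNl, comp0l, compDr, compZr, compNr, comp0r).

Lemma starD n m (a b : T n m) : (a + b)^s = a^s + b^s.
Proof. by have := cp_starDZ 1 a b; rewrite conjc1 !scale1r. Qed.
Lemma star0 n m : (0 : T n m)^s = 0.
Proof. by apply: (addrI (0^s)); rewrite -starD !addr0. Qed.
Lemma starZ n m c (a : T n m) : (c *: a)^s = conjc c *: a^s.
Proof. by have := cp_starDZ c a 0; rewrite star0 !addr0. Qed.
Lemma starN n m (a : T n m) : (- a)^s = - a^s.
Proof. by apply: (addrI (a^s)); rewrite -starD !subrr star0. Qed.

Definition mstarE := (starD, starZ, starN, star0, @cp_starM, @cp_starK).

Lemma rnorm_comp n m l (a : T n m) (b : T m l) : rnorm (a ** b) <= rnorm a * rnorm b.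
Proof. by rewrite -lecR rmorphM /= -!normE cp_normM. Qed.

Lemma rnorm_cstar n m (a : T n m) : rnorm (a^s ** a) = rnorm a ^+ 2.
Proof. by apply: (@complexI R); rewrite rmorphXn /= -!normE cp_normC. Qed.

Lemma rnorm_star n m (a : T n m) : rnorm a^s = rnorm a.
Proof.
have h k l (b : T k l) : rnorm b <= rnorm b^s.
  have [->|b0] := eqVneq (rnorm b) 0; first exact: rnorm_ge0.
  have b1 : 0 < rnorm b by rewrite lt_neqAle eq_sym b0 rnorm_ge0.
  by rewrite -(ler_pM2r b1) -expr2 -rnorm_cstar rnorm_comp.
by apply/le_anti; rewrite h -{2}(cp_starK a) h.
Qed.

Lemma rnorm_cstarr n m (a : T n m) : rnorm (a ** a^s) = rnorm a ^+ 2.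
Proof. by rewrite -{1}(cp_starK a) rnorm_cstar rnorm_star. Qed.

Lemma rnorm_sa_sqr m (y : T m m) : y^s = y -> rnorm (y ** y) = rnorm y ^+ 2.
Proof. by move=> ys; rewrite -{1}ys rnorm_cstar. Qed.

Lemma rlim_star n m (u : nat -> T n m) l : rlim u l -> rlim (fun k => (u k)^s) l^s.
Proof.
by move=> h; apply: (rlim_dom (M := 1) h) => k; rewrite -starN -starD rnorm_star mul1r.
Qed.

Lemma rlim_compr n m l (b : T n m) (u : nat -> T m l) x :
  rlim u x -> rlim (fun k => b ** u k) (b ** x).
Proof.
by move=> h; apply: (rlim_dom (M := rnorm b) h) => k; rewrite -compNr -compDr rnorm_comp.
Qed.

Lemma rlim_compl n m l (b : T m l) (u : nat -> T n m) x :
  rlim u x -> rlim (fun k => u k ** b) (x ** b).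
Proof.
move=> h; apply: (rlim_dom (M := rnorm b) h) => k; rewrite -compNl -compDl mulrC.
exact: rnorm_comp.
Qed.

(** * Square roots of 1 - y^2 inside a closed subalgebra *)

Section SquareRoot.
Variables (m : nat) (S : set (T m m)).
Hypothesis (Slin : lin_subspace S) (Sclosed : closed S).
Hypothesis (Smul : forall a b, S a -> S b -> S (a ** b)).
Variables (y : T m m).
Hypothesis (Sy : S y) (ys : y^s = y) (y1 : rnorm y < 1).

Let half : C := (2^-1 : R)%:C.
Let half_cabs : cabs half = 2^-1.
Proof. by rewrite cabs_real // invr_ge0. Qed.
Let halfD : half + half = 1.
Proof. by rewrite /half -rmorphD /=; have -> : 2^-1 + 2^-1 = 1 :> R by lra. Qed.

Fixpoint sqrt_iter (n : nat) : T m m :=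
  match n with
  | 0 => 0
  | n'.+1 => half *: (y ** y + sqrt_iter n' ** sqrt_iter n')
  end.

Let rho := rnorm y.

Let k_norm n : rnorm (sqrt_iter n) <= rho.
Proof.
elim: n => [|n IHn] /=; first by rewrite rnorm0 rnorm_ge0.
rewrite rnormZ half_cabs mulrC ler_pdivrMr //.
apply: le_trans (rnormD _ _) _.
have r0 : 0 <= rho := rnorm_ge0 y.
have rr : rho * rho <= rho by rewrite ler_piMl // ltW.
apply: le_trans (lerD (rnorm_comp _ _) (rnorm_comp _ _)) _.
have : rnorm (sqrt_iter n) * rnorm (sqrt_iter n) <= rho * rho.
  by apply: ler_pM => //; exact: rnorm_ge0.
rewrite -/rho; lra.
Qed.

Let k_star n : (sqrt_iter n)^s = sqrt_iter n.
Proof. by elim: n => [|n IHn] /=; rewrite !mstarE // IHn ys conjc_real. Qed.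

Let k_comm n : sqrt_iter n ** y = y ** sqrt_iter n.
Proof.
elim: n => [|n IHn] /=; rewrite !mcompE // !cp_compA.
by rewrite -[sqrt_iter n ** _ ** y]cp_compA IHn !cp_compA IHn.
Qed.

Let k_S n : S (sqrt_iter n).
Proof.
elim: n => [|n IHn] /=; first exact: Slin.1.
rewrite -[_ *: _]addr0; apply: Slin.2; last exact: Slin.1.
by rewrite -[y ** y]scale1r; apply: Slin.2; apply: Smul.
Qed.

(** Without commutativity, k1^2 - k0^2 = k1 (k1 - k0) + (k1 - k0) k0; as all iterates have norm at
    most [rho], each step contracts by [rho]. *)
Let k_step n : rnorm (sqrt_iter n.+1 - sqrt_iter n) <= rho * rho ^+ n.
Proof.
have r0 : 0 <= rho := rnorm_ge0 y.
elim: n => [|n IHn].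
  by rewrite subr0 expr0 mulr1 k_norm.
have e1 : sqrt_iter n.+2 = half *: (y ** y + sqrt_iter n.+1 ** sqrt_iter n.+1) by [].
have e0 : sqrt_iter n.+1 = half *: (y ** y + sqrt_iter n ** sqrt_iter n) by [].
rewrite e1 [X in rnorm (_ - X)]e0.
move: (sqrt_iter n.+1) (sqrt_iter n) IHn (k_norm n.+1) (k_norm n) => k1 k0 IHn hk1 hk0.
rewrite (_ : _ - _ = half *: (k1 ** (k1 - k0) + (k1 - k0) ** k0)); last first.
  by rewrite !mcompE; lmod R.
rewrite rnormZ half_cabs mulrC ler_pdivrMr //.
apply: le_trans (rnormD _ _) _.
apply: le_trans (lerD (rnorm_comp _ _) (rnorm_comp _ _)) _.
rewrite [rnorm (k1 - k0) * _]mulrC -mulrDl exprS.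
rewrite [leRHS](_ : _ = (rho + rho) * (rho * rho ^+ n)); last by ring.
apply: ler_pM => //; first by rewrite addr_ge0 ?rnorm_ge0.
  exact: rnorm_ge0.
by apply: lerD.
Qed.

(* [1 - k] is the square root of [1 - y^2]: [k] is the fixed point of the
   contraction [k |-> (y^2 + k^2) / 2]. *)
Lemma sqrt_complement : exists k : T m m,
  [/\ S k, k^s = k, k ** y = y ** k & k + k = y ** y + k ** k].
Proof.
have [k hk _] := geometric_limit (rnorm_ge0 y) (rnorm_ge0 y) y1 k_step.
have kle := rlim_le k_norm hk.
exists k; split.
- exact: closed_rlim hk.
- apply: rlim_unique (rlim_star hk) _.
  by rewrite (_ : (fun _ => _) = sqrt_iter) //; apply: funext => n; apply: k_star.
- apply: rlim_unique (rlim_compl y hk) _.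
  rewrite (_ : (fun _ => _) = (fun n => y ** sqrt_iter n)); last first.
    by apply: funext => n; apply: k_comm.
  exact: rlim_compr.
have h1 : rlim (fun n => sqrt_iter n.+1) (half *: (y ** y + k ** k)).
  apply: (rlim_dom (M := rnorm k + rho) hk) => n /=.
  rewrite (_ : _ - _ = half *: ((sqrt_iter n - k) ** sqrt_iter n
      + k ** (sqrt_iter n - k))); last by rewrite !mcompE; lmod R.
  rewrite rnormZ half_cabs mulrC ler_pdivrMr //.
  apply: le_trans (rnormD _ _) _.
  apply: le_trans (lerD (rnorm_comp _ _) (rnorm_comp _ _)) _.
  have := k_norm n; have := rnorm_ge0 k; have := rnorm_ge0 (sqrt_iter n - k).
  have := rnorm_ge0 y; rewrite -/rho; set d := rnorm (_ - _).
  move=> r0 d0 kk0 hn.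
  have : d * rnorm (sqrt_iter n) <= d * rho by apply: ler_wpM2l.
  have : 0 <= d * rho by apply: mulr_ge0.
  have : 0 <= d * rnorm k by apply: mulr_ge0.
  by rewrite [rnorm k * d]mulrC !mulrDl mulrDr [rho * d]mulrC [rnorm k * d]mulrC; lra.
have e := rlim_unique (rlim_shift hk) h1.
by rewrite {1 2}e -scalerDl halfD scale1r.
Qed.

End SquareRoot.

Lemma lin_setT (V : normedModType C) : lin_subspace (setT : set V).
Proof. by []. Qed.

(** * Unitaries built from the square root *)

Section UnitaryDilation.
Variables (m : nat) (y k : T m m).
Hypothesis (ys : y^s = y) (ks : k^s = k) (ky : k ** y = y ** k).
Hypothesis (kk : k + k = y ** y + k ** k).

(** Oriented rewrite rules: [hk] moves [k] to the right of [y] and [hkk] eliminates the square of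
    [k], after which only a linear identity remains. *)
Let hk l (z : T l m) : z ** k ** y = z ** y ** k.
Proof. by rewrite -!cp_compA ky. Qed.
Let hkk l (z : T l m) : z ** k ** k = z ** k + z ** k - z ** y ** y.
Proof. by rewrite -!cp_compA -compDr kk compDr addrC addKr. Qed.

(* Here [c] is [i] or [-i], and [1 - k + c y] is unitary. *)
Lemma unitary_norm n (x : T n m) (c : C) : c * c = -1 -> conjc c = - c ->
  rnorm (x - x ** k + c *: (x ** y)) = rnorm x.
Proof.
move=> c1 c2.
apply/eqP; rewrite -(@eqrXn2 _ 2) ?rnorm_ge0 // -!rnorm_cstarr; apply/eqP; congr rnorm.
rewrite !mstarE ys ks !mcompE !cp_compA hk hkk !mcompE c2; lmod R; ring: c1.
Qed.

Let i2 : ('i%C : C) * 'i%C = -1.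
Proof. by rewrite -expr2 sqr_i. Qed.
Let ic : conjc 'i%C = - 'i%C :> C.
Proof. by apply/eqP; rewrite eq_complex /= oppr0 !eqxx. Qed.
Let ni2 : (- 'i%C : C) * - 'i%C = -1.
Proof. by rewrite mulrNN. Qed.
Let nic : conjc (- 'i%C) = - - 'i%C :> C.
Proof. by apply/eqP; rewrite eq_complex /= ?oppr0 ?opprK !eqxx. Qed.

(** The element i y is half the difference of the unitaries 1 - k + i y and 1 - k - i y. Applying
    both to y itself gives 2 |y|^2 <= 2 |y|. No bound on y is assumed: the algebraic relations
    between y and k force it, and such relations survive in images. *)
Lemma dilation_norm_le1 : rnorm y <= 1.
Proof.
have h1 := unitary_norm y i2 ic; have h2 := unitary_norm y ni2 nic.
have e : 'i%C *: (y ** y + y ** y) =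
  (y - y ** k + 'i%C *: (y ** y)) - (y - y ** k + - 'i%C *: (y ** y)) by lmod R.
have : rnorm ('i%C *: (y ** y + y ** y)) <= rnorm y + rnorm y.
  by rewrite e; apply: le_trans (rnormD _ _) _; rewrite rnormN h1 h2.
have ci : cabs ('i%C : C) = 1.
  by rewrite /cabs normc_def /= expr0n expr1n add0r sqrtr1.
rewrite rnormZ ci mul1r.
have -> : y ** y + y ** y = (2 : R)%:C *: (y ** y).
  by rewrite rmorph_nat -mulr2n scaler_nat.
rewrite rnormZr // rnorm_sa_sqr // => h.
rewrite leNgt; apply/negP => h3; nra.
Qed.

(** The relation 2 k = y^2 + k^2 makes 1 - 2 y^2 the mean of the squares of the two unitaries 1 - k
    + i y and 1 - k - i y. *)
Lemma reflection_contractive n (x : T n m) :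
  rnorm (x - (x ** y ** y + x ** y ** y)) <= rnorm x.
Proof.
pose u z : T n m := z - z ** k + 'i%C *: (z ** y).
pose v z : T n m := z - z ** k + - 'i%C *: (z ** y).
have e : (2 : R)%:C *: (x - (x ** y ** y + x ** y ** y)) = u (u x) + v (v x).
  have -> : (2 : R)%:C = 1 + 1 by rewrite rmorph_nat.
  rewrite /u /v !mcompE hk hkk; lmod R; ring: i2.
rewrite -(ler_pM2l (ltr0n R 2)) -rnormZr // e; apply: le_trans (rnormD _ _) _.
by rewrite /u /v !unitary_norm // mulr_natl mulr2n.
Qed.

End UnitaryDilation.

Lemma reflection_norm m (y : T m m) : y^s = y -> rnorm y < 1 ->
  forall n (x : T n m), rnorm (x - (x ** y ** y + x ** y ** y)) <= rnorm x.
Proof.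
move=> ys y1 n x.
have [k [_ ks ky kk]] := sqrt_complement (lin_setT _) closedT (fun _ _ _ _ => I) I ys y1.
exact: (reflection_contractive ys ks ky kk).
Qed.

End Precategories.

Section Contractivity.
Variables (R : realType) (T T' : cstar_precategory R).

(** Scaled into the open unit ball, y has a companion k in S; f carries the relations between them
    to the target, where [dilation_norm_le1] applies. Hence f has to respect the operations on S
    only, and the involution only at self-adjoint elements such as y and k. *)
Lemma star_map_contractive m m' (S : set (T m m)) (f : T m m -> T' m' m') :
  lin_subspace S -> closed S -> (forall a b, S a -> S b -> S (a ** b)) ->
  (forall c a b, S a -> S b -> f (c *: a + b) = c *: f a + f b) ->
  (forall a b, S a -> S b -> f (a ** b) = f a ** f b) ->
  (forall a, S a -> a^s = a -> f a^s = (f a)^s) ->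
  forall y, S y -> y^s = y -> rnorm (f y) <= rnorm y.
Proof.
move=> Sl Sc Sm flin fm fs y Sy ys.
have S0 := Sl.1.
have f0 : f 0 = 0.
  have := flin 1 0 0 S0 S0; rewrite !scale1r addr0 => e.
  by apply: (addrI (f 0)); rewrite addr0 -e.
have SZ c a : S a -> S (c *: a) by move=> Sa; rewrite -[_ *: _]addr0; apply: Sl.2.
have fZ c a : S a -> f (c *: a) = c *: f a.
  by move=> Sa; rewrite -[_ *: _]addr0 flin // f0 addr0.
have fD a b : S a -> S b -> f (a + b) = f a + f b.
  by move=> Sa Sb; have := flin 1 a b Sa Sb; rewrite !scale1r.
have unit_ball z : S z -> z^s = z -> rnorm z < 1 -> rnorm (f z) <= 1.
  move=> Sz zs z1.
  have [k [Sk ks kz kk]] := sqrt_complement Sl Sc Sm Sz zs z1.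
  apply: (@dilation_norm_le1 R T' m' (f z) (f k)).
  - by rewrite -fs ?zs.
  - by rewrite -fs ?ks.
  - by rewrite -!fm ?kz.
  - by rewrite -!fm // -!fD ?kk //; apply: Sm.
apply/ler_addgt0Pr => e e0; set r := rnorm y + e.
have r0 : 0 < r by rewrite ltr_wpDl // rnorm_ge0.
have rV : 0 <= r^-1 by rewrite invr_ge0 ltW.
have := unit_ball ((r^-1)%:C *: y) (SZ _ _ Sy).
rewrite starZ ys conjc_real fZ // !rnormZr // !(mulrC r^-1).
rewrite ltr_pdivrMr // mul1r ltrDl ler_pdivrMr // mul1r.
by apply.
Qed.

(** With an object map [rho], one notion covers representations (constant target), iterated
    tensoring and homomorphisms of C*-algebras. *)
Record star_functor (N : hom_family T) (rho : nat -> nat)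
    (F : forall n m, T n m -> T' (rho n) (rho m)) : Prop := StarFunctor {
  functorDZ : forall n m (c : R[i]) (a b : T n m), N n m a -> N n m b ->
    F n m (c *: a + b) = c *: F n m a + F n m b;
  functorM : forall n m l (a : T n m) (b : T m l), N n m a -> N m l b ->
    F n l (a ** b) = F n m a ** F m l b;
  functorS : forall n m (a : T n m), N n m a -> F m n a^s = (F n m a)^s }.

(** The C*-identity on both sides replaces a morphism by the self-adjoint endomorphism
    [a^s ** a]. *)
Lemma star_functor_contractive N rho F : is_ideal N ->
  (forall n m (a : T n m), N n m a -> N m n a^s) -> @star_functor N rho F ->
  forall n m (a : T n m), N n m a -> rnorm (F n m a) <= rnorm a.
Proof.
move=> iN sN sF n m a Na; have Nas := sN _ _ _ Na.
rewrite -(@ler_pXn2r _ 2) ?nnegrE ?rnorm_ge0 //.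
rewrite -!rnorm_cstar -(functorS sF) // -(functorM sF) //.
apply: (@star_map_contractive _ _ (N m m) (F m m)).
- exact: ideal_subspace.
- exact: ideal_closed.
- by move=> ? ? ? ?; apply: ideal_compl.
- by move=> ? ? ?; apply: (functorDZ sF).
- by move=> ? ?; apply: (functorM sF).
- by move=> ? ? ?; apply: (functorS sF).
- exact: (ideal_compl iN).
- by rewrite cp_starM cp_starK.
Qed.

End Contractivity.

(** * Approximate units and quotient norms *)

Section QuotientNorm.
Variables (R : realType) (V : normedModType R[i]) (S : set V).
Hypothesis Slin : lin_subspace S.

Let nonempty x : [set rnorm (x - y) | y in S] !=set0.
Proof. by exists (rnorm (x - 0)), 0 => //; exact: Slin.1. Qed.
Let hlb x : has_lbound [set rnorm (x - y) | y in S].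
Proof. by exists 0 => _ [y _ <-]; exact: rnorm_ge0. Qed.

Lemma qnorm_ge0 x : 0 <= quotient_norm S x.
Proof. by apply: lb_le_inf => // _ [y _ <-]; exact: rnorm_ge0. Qed.

Lemma qnorm_le x y : S y -> quotient_norm S x <= rnorm (x - y).
Proof. by move=> Sy; apply: ge_inf => //; exists y. Qed.

Lemma qnorm_lt x e : quotient_norm S x < e -> exists2 y, S y & rnorm (x - y) < e.
Proof.
by move=> h; have [_ [y Sy <-] he] := inf_lt (nonempty x) h; exists y.
Qed.

Lemma qnorm_le_rnorm x : quotient_norm S x <= rnorm x.
Proof. by rewrite -[in leRHS](subr0 x); apply: qnorm_le; exact: Slin.1. Qed.

Lemma qnorm_mem x : S x -> quotient_norm S x = 0.
Proof.
by move=> Sx; apply/le_anti; rewrite qnorm_ge0 andbT -(rnorm0 V) -(subrr x) qnorm_le.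
Qed.

Lemma qnorm_closed x : closed S -> quotient_norm S x = 0 -> S x.
Proof.
move=> cS h; apply: (closed_approx cS) => e e0; apply: qnorm_lt; by rewrite h.
Qed.

Lemma lin_subspaceZ c x : S x -> S (c *: x).
Proof. by move=> Sx; rewrite -[_ *: _]addr0; apply: Slin.2 => //; exact: Slin.1. Qed.
Lemma lin_subspaceD x y : S x -> S y -> S (x + y).
Proof. by move=> Sx Sy; rewrite -[x]scale1r; apply: Slin.2. Qed.
Lemma lin_subspaceN x : S x -> S (- x).
Proof. by move=> Sx; rewrite -scaleN1r; apply: lin_subspaceZ. Qed.
Lemma lin_subspaceB x y : S x -> S y -> S (x - y).
Proof. by move=> Sx Sy; apply: lin_subspaceD => //; apply: lin_subspaceN. Qed.
Lemma lin_subspace_sum I (r : seq I) (P : pred I) (F : I -> V) :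
  (forall i, P i -> S (F i)) -> S (\sum_(i <- r | P i) F i).
Proof.
by move=> h; elim/big_rec: _ => [|i x Pi Sx]; [exact: Slin.1|apply: lin_subspaceD; auto].
Qed.

Lemma qnormD x y : quotient_norm S (x + y) <= quotient_norm S x + quotient_norm S y.
Proof.
apply/ler_addgt0Pr => e e0; have e2 : 0 < e / 2 by rewrite divr_gt0.
have [|x' Sx' hx] := @qnorm_lt x (quotient_norm S x + e / 2); first by rewrite ltrDl.
have [|y' Sy' hy] := @qnorm_lt y (quotient_norm S y + e / 2); first by rewrite ltrDl.
have := qnorm_le (x + y) (lin_subspaceD Sx' Sy').
have := rnormD (x - x') (y - y').
by rewrite (_ : x - x' + (y - y') = x + y - (x' + y')); [lra|lmod R].
Qed.

Let qnormZ_le c x : quotient_norm S (c *: x) <= cabs c * quotient_norm S x.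
Proof.
apply/ler_addgt0Pr => e e0; have c0 := cabs_ge0 c.
have M0 : 0 < cabs c + 1 by rewrite ltr_wpDl.
have [|x' Sx' hx] := @qnorm_lt x (quotient_norm S x + e / (cabs c + 1)).
  by rewrite ltrDl divr_gt0.
apply: le_trans (qnorm_le _ (lin_subspaceZ c Sx')) _.
rewrite -scalerBr rnormZ; apply: le_trans (ler_wpM2l c0 (ltW hx)) _.
rewrite mulrDr lerD2l mulrCA ler_piMr ?(ltW e0) // ler_pdivrMr // mul1r lerDl //.
Qed.

Lemma qnormZ c x : quotient_norm S (c *: x) = cabs c * quotient_norm S x.
Proof.
apply/le_anti; rewrite qnormZ_le /=.
have [->|c0] := eqVneq c 0.
  by rewrite /cabs normr0 mul0r qnorm_ge0.
have cc : 0 < cabs c by rewrite -ltcR -cabsE normr_gt0.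
rewrite -ler_pdivlMl //.
have e : (cabs c)^-1 = cabs c^-1.
  by apply: (mulfI (lt0r_neq0 cc)); rewrite divff ?lt0r_neq0 // -cabsM divff //
    cabs_real.
by have := qnormZ_le c^-1 (c *: x); rewrite scalerK // -e.
Qed.

Lemma qnorm_diff x y : quotient_norm S x <= quotient_norm S y + rnorm (x - y).
Proof.
rewrite -[in leLHS](subrK y x) addrC; apply: le_trans (qnormD _ _) _.
by rewrite lerD2l qnorm_le_rnorm.
Qed.

End QuotientNorm.

Section ApproximateUnit.
Variables (R : realType) (T : cstar_precategory R).
Local Notation C := R[i].

(** * Cesaro means of the powers of 1 - 2 y^2 *)

Section Cesaro.
Variables (m : nat) (y : T m m).
Hypothesis (ys : y^s = y) (y1 : rnorm y < 1).

Definition reflection l (x : T l m) := x - (x ** y ** y + x ** y ** y).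

(* In the unitization, [1 - defect j] is the [j]-th power of [1 - 2 y^2]. *)
Fixpoint defect (j : nat) : T m m :=
  match j with
  | 0 => 0
  | j'.+1 => defect j' + (y ** y + y ** y) -
      (defect j' ** y ** y + defect j' ** y ** y)
  end.

Definition mean_defect (n : nat) : T m m := ((n%:R : R)^-1)%:C *: \sum_(j < n) defect j.

Lemma reflection_defect l (x : T l m) j :
  reflection (x - x ** defect j) = x - x ** defect j.+1.
Proof. by rewrite /reflection /= !mcompE !cp_compA; lmod R. Qed.

Lemma defect_iter l (x : T l m) j : x - x ** defect j = iter j (@reflection l) x.
Proof.
elim: j => [|j IHj] /=; first by rewrite comp0r subr0.
by rewrite -IHj reflection_defect.
Qed.

Lemma defect_comm j : defect j ** y = y ** defect j.
Proof.
elim: j => [|j IHj] /=; first by rewrite comp0l comp0r.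
by rewrite !mcompE !cp_compA -IHj.
Qed.

Lemma defect_star j : (defect j)^s = defect j.
Proof.
elim: j => [|j IHj] /=; first by rewrite star0.
rewrite !mstarE !ys IHj; congr (_ + _ - (_ + _)).
all: by rewrite -defect_comm cp_compA -defect_comm.
Qed.

Lemma defect_norm l (x : T l m) j : rnorm (x - x ** defect j) <= rnorm x.
Proof.
rewrite defect_iter; elim: j => [|j IHj] //=.
exact: le_trans (reflection_norm ys y1 _) IHj.
Qed.

Lemma defect_mem (S : set (T m m)) : lin_subspace S -> S y ->
  (forall a, S a -> S (a ** y)) -> forall j, S (defect j).
Proof.
move=> Sl Sy Sm; elim=> [|j IHj] /=; first exact: Sl.1.
have Syy := Sm _ Sy; have Sd := Sm _ (Sm _ IHj).
by apply: (lin_subspaceB Sl); do ?[apply: (lin_subspaceD Sl)].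
Qed.

Variables (n : nat).
Hypothesis n0 : (0 < n)%N.
Let e := mean_defect n.
Let nR0 : 0 < n%:R :> R. Proof. by rewrite ltr0n. Qed.
Let nV0 : 0 <= (n%:R : R)^-1. Proof. by rewrite invr_ge0 ler0n. Qed.

Lemma comp_sumr k l I (r : seq I) (P : pred I) (x : T k m) (F : I -> T m l) :
  x ** (\sum_(i <- r | P i) F i) = \sum_(i <- r | P i) (x ** F i).
Proof. by apply: (big_morph (fun z => x ** z)) => [? ?|]; rewrite !mcompE. Qed.

Lemma comp_suml k l I (r : seq I) (P : pred I) (x : T m l) (F : I -> T k m) :
  (\sum_(i <- r | P i) F i) ** x = \sum_(i <- r | P i) (F i ** x).
Proof. by apply: (big_morph (fun z => z ** x)) => [? ?|]; rewrite !mcompE. Qed.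

Lemma mean_defect_comm : e ** y = y ** e.
Proof.
rewrite /e /mean_defect !mcompE comp_sumr comp_suml; congr (_ *: _).
by apply: eq_bigr => j _; apply: defect_comm.
Qed.

Lemma mean_defect_star : e^s = e.
Proof.
rewrite /e /mean_defect starZ conjc_real; congr (_ *: _).
rewrite (big_morph (fun z : T m m => z^s) (@starD _ _ _ _) (@star0 _ _ _ _)).
by apply: eq_bigr => j _; apply: defect_star.
Qed.

Lemma mean_defect_mem (S : set (T m m)) : lin_subspace S -> S y ->
  (forall a, S a -> S (a ** y)) -> S e.
Proof.
move=> Sl Sy Sm; apply: (lin_subspaceZ Sl); apply: (lin_subspace_sum Sl) => j _.
exact: defect_mem.
Qed.

Lemma mean_defectE l (x : T l m) :
  x - x ** e = ((n%:R : R)^-1)%:C *: \sum_(j < n) (x - x ** defect j).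
Proof.
rewrite sumrB scalerBr sumr_const card_ord /e /mean_defect mcompE comp_sumr.
rewrite -[x *+ n]scaler_nat scalerA -(rmorph_nat (real_complex R)) -rmorphM /=.
by rewrite mulVf ?scale1r // lt0r_neq0.
Qed.

Lemma mean_defect_norm l (x : T l m) : rnorm (x - x ** e) <= rnorm x.
Proof.
rewrite mean_defectE rnormZr // ler_pdivrMl //.
apply: le_trans (rnorm_sum _ _ _) _.
rewrite mulr_natl -[leRHS](_ : \sum_(j < n) rnorm x = _); last first.
  by rewrite sumr_const card_ord.
by apply: ler_sum => j _; apply: defect_norm.
Qed.

Lemma mean_defect_norml l (x : T m l) : rnorm (x - e ** x) <= rnorm x.
Proof.
rewrite -rnorm_star -(rnorm_star x) starD starN cp_starM mean_defect_star.
exact: mean_defect_norm.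
Qed.

(* The mean ergodic estimate: [1 - V^n] telescopes, for the reflection
   [V = 1 - 2 y^2]. *)
Lemma mean_defect_ergodic l (x : T l m) :
  rnorm ((x - x ** e) ** y ** y) <= rnorm x / n%:R.
Proof.
have h : (x - x ** e) ** y ** y + (x - x ** e) ** y ** y =
    ((n%:R : R)^-1)%:C *: (x - (x - x ** defect n)).
  have -> : (x - x ** e) ** y ** y + (x - x ** e) ** y ** y =
    (x - x ** e) - reflection (x - x ** e) by rewrite /reflection; lmod R.
  have -> : reflection (x - x ** e) = ((n%:R : R)^-1)%:C *:
      \sum_(j < n) reflection (x - x ** defect j).
    rewrite mean_defectE /reflection !mcompE !comp_suml -scalerDr -scalerBr.
    by rewrite -big_split -sumrB.
  rewrite mean_defectE -scalerBr -sumrB; congr (_ *: _).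
  under eq_bigr do rewrite reflection_defect.
  rewrite (eq_bigr (fun j : 'I_n => (- (x - x ** defect j.+1)) - (- (x - x ** defect j)))).
    rewrite -(big_mkord xpredT (fun j => - (x - x ** defect j.+1) - - (x - x ** defect j))).
    by rewrite telescope_sumr // /= comp0r; lmod R.
  by move=> j _; lmod R.
have : rnorm ((x - x ** e) ** y ** y + (x - x ** e) ** y ** y) <= 2 * (rnorm x / n%:R).
  rewrite h rnormZr // mulrC mulrA ler_wpM2r //.
  apply: le_trans (rnormD _ _) _; rewrite rnormN.
  by have := defect_norm x n; lra.
have -> : (x - x ** e) ** y ** y + (x - x ** e) ** y ** y =
   (2 : R)%:C *: ((x - x ** e) ** y ** y) by rewrite rmorph_nat -mulr2n scaler_nat.
by rewrite rnormZr // ler_pM2l.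
Qed.

(** The defect of the j-th power of V = 1 - 2 y^2 is 2 y^2 times the sum of the lower powers, so
    [x ** e] is built from iterates of V on [x ** y ** y]. In the application [d] is the distance
    from an image to an ideal, and V does not increase it. Bounding each j by n costs a harmless
    factor. *)
Lemma mean_defect_seminorm l (x : T l m) (d : T l m -> R) :
  (forall a, 0 <= d a) -> (forall a b, d (a + b) <= d a + d b) ->
  (forall c a, 0 <= c -> d (c%:C *: a) = c * d a) ->
  (forall a, d (reflection a) <= d a) ->
  d (x ** e) <= 2 * n%:R * d (x ** y ** y).
Proof.
move=> d_ge0 dD dZ dV; set D := d (x ** y ** y).
have d0 : d 0 = 0 by have := dZ 0 0 (lexx _); rewrite scaler0 mul0r.
have hiter j : d (iter j (@reflection l) (x ** y ** y)) <= D.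
  by elim: j => [|j IHj] //=; apply: le_trans (dV _) IHj.
have hd j : d (x ** defect j) <= 2 * j%:R * D.
  elim: j => [|j IHj]; first by rewrite /= comp0r d0 mulr0 mul0r.
  have -> : x ** defect j.+1 = x ** defect j + (2 : R)%:C *:
      iter j (@reflection l) (x ** y ** y).
    rewrite -defect_iter rmorph_nat scaler_nat mulr2n /= !mcompE !cp_compA.
    have hc (z : T l m) : z ** y ** defect j = z ** defect j ** y.
      by rewrite -!cp_compA defect_comm.
    by rewrite !hc; lmod R.
  apply: le_trans (dD _ _) _; rewrite dZ // -natr1.
  by have := hiter j; lra.
rewrite /e /mean_defect compZr dZ // ler_pdivrMl // comp_sumr.
have dsum (F : 'I_n -> T l m) : d (\sum_(j < n) F j) <= \sum_(j < n) d (F j).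
  elim/big_rec2: _ => [|j u v _ h]; first by rewrite d0.
  by apply: le_trans (dD _ _) _; rewrite lerD2l.
apply: le_trans (dsum _) _.
have D0 : 0 <= D := d_ge0 _.
have -> : n%:R * (2 * n%:R * D) = \sum_(j < n) (2 * n%:R * D).
  by rewrite sumr_const card_ord -[RHS]mulr_natl.
apply: ler_sum => j _; apply: le_trans (hd _) _.
by rewrite ler_wpM2r // ler_wpM2l // ler_nat ltnW.
Qed.

(** With g = (y (1 - e))^2, commutation gives g^2 = g (1 - e)^2 y^2. Squaring thus creates the
    factor y^2 on which the ergodic estimate acts, whence |g|^2 <= |g| / n. *)
Lemma mean_defect_small : rnorm (y - y ** e) ^+ 2 <= (n%:R)^-1.
Proof.
have es := mean_defect_star; have ec := mean_defect_comm.
have er := @mean_defect_ergodic m; have en := @mean_defect_norm m.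
move: e es ec er en => f es ec er en.
set z := y - y ** f; set g := z ** z.
have zs : z^s = z by rewrite /z !mstarE ys es ec.
have gs : g^s = g by rewrite /g mstarE zs.
have hc l (x : T l m) : x ** f ** y = x ** y ** f.
  by rewrite -!cp_compA ec.
have e4 : g ** g = (g - g ** f - (g - g ** f) ** f) ** y ** y.
  by rewrite {2}/g cp_compA /z !mcompE !cp_compA !hc; lmod R.
have h4 : rnorm g ^+ 2 <= rnorm g / n%:R.
  rewrite -rnorm_sa_sqr // e4; apply: le_trans (er _) _.
  by rewrite ler_pM2r ?invr_gt0 // en.
have hg : rnorm g = rnorm z ^+ 2 by rewrite /g rnorm_sa_sqr.
rewrite -hg; have [g0|g0] := eqVneq (rnorm g) 0; first by rewrite g0.
have gp : 0 < rnorm g by rewrite lt_neqAle eq_sym g0 rnorm_ge0.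
by rewrite -(ler_pM2l gp) -expr2.
Qed.

End Cesaro.

(** Since [a^s ** a] is s y, the square of |a (1 - e)| is the norm of s (1 - e) y (1 - e), at most s
    |y (1 - e)|. A second squaring, to use [mean_defect_small], explains the fourth power. *)
Lemma spectral_cut l m (a : T l m) (s : R) (n : nat) :
  0 < s -> rnorm (a^s ** a) < s -> (0 < n)%N ->
  let y := (s^-1)%:C *: (a^s ** a) in
  [/\ y^s = y, rnorm y < 1, (mean_defect y n)^s = mean_defect y n &
    rnorm (a - a ** mean_defect y n) ^+ 4 <= s ^+ 2 / n%:R].
Proof.
move=> s0 hs n0 y.
have ys : y^s = y by rewrite /y !mstarE conjc_real.
have y1 : rnorm y < 1.
  by rewrite /y rnormZr ?invr_ge0 ?(ltW s0) // ltr_pdivrMl // mulr1.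
have es := mean_defect_star ys n.
have en := @mean_defect_norml m y ys y1 n n0; have esm := mean_defect_small ys y1 n0.
split => //; move: (mean_defect y n) es en esm => e es en esm.
have sy : s%:C *: y = a^s ** a.
  by rewrite /y scalerA -rmorphM /= divff ?lt0r_neq0 // scale1r.
have h : (a - a ** e)^s ** (a - a ** e) = s%:C *: (y - y ** e - e ** (y - y ** e)).
  have -> : s%:C *: (y - y ** e - e ** (y - y ** e)) =
      (s%:C *: y) - (s%:C *: y) ** e - e ** (s%:C *: y - (s%:C *: y) ** e).
    by rewrite !mcompE; lmod R.
  by rewrite sy !mstarE es !mcompE !cp_compA; lmod R.
have s0' := ltW s0.
have : rnorm (a - a ** e) ^+ 2 <= s * rnorm (y - y ** e).
  rewrite -rnorm_cstar h rnormZr // ler_wpM2l //.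
move=> h2; rewrite (_ : 4 = 2 * 2)%N // exprM.
apply: le_trans (_ : _ <= (s * rnorm (y - y ** e)) ^+ 2) _.
  by rewrite ler_pXn2r // nnegrE ?exprn_ge0 ?mulr_ge0 ?rnorm_ge0.
by rewrite exprMn ler_wpM2l ?exprn_ge0.
Qed.

End ApproximateUnit.

Section Ideals.
Variables (R : realType) (T : cstar_precategory R).

Lemma exists_large_nat (x : R) : exists2 n, (0 < n)%N & x < n%:R.
Proof.
have h : x < (Num.bound `|x|)%:R.
  by apply: le_lt_trans (ler_norm _) _; apply: archi_boundP.
by exists (Num.bound `|x|).+1 => //; apply: lt_trans h _; rewrite ltr_nat.
Qed.

(** The last clause locates e in every subspace that contains [a^s ** a] and is stable under right
    multiplication. It does not presuppose self-adjointness, and so can be used to prove that ideals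
    are self-adjoint. *)
Lemma approximate_unit l m (a : T l m) (d : R) : 0 < d -> exists e : T m m,
  [/\ e^s = e, rnorm (a - a ** e) < d,
     (forall k (x : T k m), rnorm (x - x ** e) <= rnorm x) &
     forall S : set (T m m), lin_subspace S -> S (a^s ** a) ->
       (forall b c, S b -> S (b ** c)) -> S e].
Proof.
move=> d0; pose s := rnorm (a^s ** a) + 1.
have s0 : 0 < s by rewrite ltr_wpDl ?rnorm_ge0.
(* This n makes the bound s^2 / n of [spectral_cut] smaller than d^4. *)
have [n n0 hn] := exists_large_nat (s ^+ 2 / d ^+ 4).
have hs : rnorm (a^s ** a) < s by rewrite ltrDl.
have [ys y1 es h4] := spectral_cut s0 hs n0.
set y := _ *: _ in ys y1 es h4; exists (mean_defect y n); split => //.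
- rewrite -(@ltr_pXn2r _ 4) ?nnegrE ?rnorm_ge0 ?(ltW d0) //.
  apply: le_lt_trans h4 _; rewrite ltr_pdivrMr ?ltr0n // mulrC -ltr_pdivrMr //.
  by rewrite exprn_gt0.
- by move=> k x; apply: mean_defect_norm.
move=> S Sl Sh Sm; apply: mean_defect_mem => //; first exact: lin_subspaceZ.
by move=> b Sb; apply: Sm.
Qed.

Section IdealStar.
Variables (N : hom_family T) (iN : is_ideal N).
Arguments N : clear implicits.

(** If a e is close to a, with e self-adjoint and in the ideal, then e [a^s] is close to [a^s], and
    it belongs to the ideal because of e. *)
Lemma ideal_star n m (a : T n m) : N n m a -> N m n a^s.
Proof.
move=> Na; apply: (closed_approx (@ideal_closed _ _ _ iN _ _)) => d d0.
have [e [es he _ eN]] := approximate_unit a d0.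
exists (e ** a^s).
  apply: (ideal_compr iN); apply: eN; first exact: ideal_subspace.
    exact: (ideal_compl iN).
  by move=> b c; apply: (ideal_compr iN).
by rewrite -es -cp_starM -starN -starD rnorm_star.
Qed.

Let qn n m := quotient_norm (N n m).
Let lN n m : lin_subspace (N n m). Proof. exact: ideal_subspace. Qed.

Lemma qnorm_star n m (a : T n m) : quotient_norm (N m n) a^s = quotient_norm (N n m) a.
Proof.
have h k l (b : T k l) : quotient_norm (N l k) b^s <= quotient_norm (N k l) b.
  apply/ler_addgt0Pr => e e0.
  have [|x Nx hx] := @qnorm_lt R _ _ (lN k l) b (qn b + e); first by rewrite ltrDl.
  apply: le_trans (qnorm_le _ (ideal_star Nx)) _.
  by rewrite -starN -starD rnorm_star ltW.
by apply/le_anti; rewrite h -{1}(cp_starK a) h.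
Qed.

Lemma qnorm_compr n m l (a : T n m) (b : T m l) :
  quotient_norm (N n l) (a ** b) <= quotient_norm (N n m) a * rnorm b.
Proof.
have b1 : 0 < rnorm b + 1 by rewrite ltr_wpDl ?rnorm_ge0.
apply/ler_addgt0Pr => e e0.
have [|x Nx hx] := @qnorm_lt R _ _ (lN n m) a (qn a + e / (rnorm b + 1)).
  by rewrite ltrDl divr_gt0.
apply: le_trans (qnorm_le _ (ideal_compr iN b Nx)) _.
rewrite -compNl -compDl; apply: le_trans (rnorm_comp _ _) _.
apply: le_trans (ler_wpM2r (rnorm_ge0 b) (ltW hx)) _.
rewrite mulrDl lerD2l mulrAC ler_pdivrMr // ler_wpM2l ?(ltW e0) // lerDl //.
Qed.

Lemma qnorm_comp n m l (a : T n m) (b : T m l) :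
  quotient_norm (N n l) (a ** b) <= quotient_norm (N n m) a * quotient_norm (N m l) b.
Proof.
have a1 : 0 < qn a + 1 by rewrite ltr_wpDl ?qnorm_ge0.
apply/ler_addgt0Pr => e e0.
have [|x Nx hx] := @qnorm_lt R _ _ (lN m l) b (qn b + e / (qn a + 1)).
  by rewrite ltrDl divr_gt0.
have -> : a ** b = a ** (b - x) + a ** x by rewrite -compDr subrK.
apply: le_trans (qnormD (lN _ _) _ _) _.
rewrite (qnorm_mem (lN _ _) (ideal_compl iN a Nx)) addr0.
apply: le_trans (qnorm_compr _ _) _.
apply: le_trans (ler_wpM2l (qnorm_ge0 (lN _ _) _) (ltW hx)) _.
rewrite mulrDr lerD2l mulrCA ler_piMr ?(ltW e0) // ler_pdivrMr // mul1r lerDl //.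
Qed.

(* Multiplying by [1 - e], for an approximate unit [e] of the ideal, turns an
   approximation of [a^* a] by the ideal into one of [a]. *)
Lemma qnorm_cstar n m (a : T n m) :
  quotient_norm (N m m) (a^s ** a) = quotient_norm (N n m) a ^+ 2.
Proof.
apply/le_anti/andP; split.
  by apply: le_trans (qnorm_comp _ _) _; rewrite qnorm_star expr2.
apply/ler_addgt0Pr => d d0; have d2 : 0 < d / 2 by rewrite divr_gt0.
have [|p Np hp] := @qnorm_lt R _ _ (lN m m) (a^s ** a) (qn (a^s ** a) + d / 2).
  by rewrite ltrDl.
have [e [es he e1 eN]] := approximate_unit p d2.
have Ne : N m m e.
  apply: eN => //; first exact: (ideal_compl iN).
  by move=> b c; apply: (ideal_compr iN).
have e1l k (x : T m k) : rnorm (x - e ** x) <= rnorm x.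
  by rewrite -rnorm_star -(rnorm_star x) starD starN cp_starM es.
apply: le_trans (_ : _ <= rnorm (a - a ** e) ^+ 2) _.
  rewrite ler_pXn2r ?nnegrE ?rnorm_ge0 ?qnorm_ge0 //.
  by apply: qnorm_le => //; apply: (ideal_compl iN).
have -> : rnorm (a - a ** e) ^+ 2 =
    rnorm ((a^s ** a - a^s ** a ** e) - e ** (a^s ** a - a^s ** a ** e)).
  rewrite -rnorm_cstar; congr rnorm.
  by rewrite starD starN cp_starM es !mcompE !cp_compA; lmod R.
apply: le_trans (e1l _ _) _.
have -> : a^s ** a - a^s ** a ** e =
    ((a^s ** a - p) - (a^s ** a - p) ** e) + (p - p ** e) by rewrite !mcompE; lmod R.
apply: le_trans (rnormD _ _) _.
by have := e1 _ (a^s ** a - p); rewrite -/(qn _); lra.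
Qed.

End IdealStar.
End Ideals.

(** * Distances to an ideal along a functor *)

Section RelativeIdeals.
Variables (R : realType) (T T' : cstar_precategory R) (rho : nat -> nat).
Variables (F : forall n m, T n m -> T' (rho n) (rho m)).
Hypothesis (sF : star_functor (fam_full T) F).
Variables (I : hom_family T') (iI : is_ideal I).
Arguments I : clear implicits.

Let lI n m : lin_subspace (I n m). Proof. exact: ideal_subspace. Qed.

Lemma full_ideal : is_ideal (fam_full T).
Proof. by split => // n m; exact: closedT. Qed.

Lemma functor_contractive n m (a : T n m) : rnorm (F a) <= rnorm a.
Proof. by apply: (star_functor_contractive full_ideal _ sF). Qed.

Let FD n m (a b : T n m) : F (a + b) = F a + F b.
Proof. by have := functorDZ sF 1 (Logic.I : fam_full T n m a) (Logic.I : fam_full T n m b); rewrite !scale1r. Qed.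
Let F0 n m : F (0 : T n m) = 0.
Proof. by apply: (addrI (F 0)); rewrite -FD !addr0. Qed.
Let FZ n m c (a : T n m) : F (c *: a) = c *: F a.
Proof.
by have := functorDZ sF c (Logic.I : fam_full T n m a) (Logic.I : fam_full T n m 0); rewrite F0 !addr0.
Qed.
Let FN n m (a : T n m) : F (- a) = - F a.
Proof. by rewrite -scaleN1r FZ scaleN1r. Qed.
Let FM n m l (a : T n m) (b : T m l) : F (a ** b) = F a ** F b.
Proof. exact: (functorM sF Logic.I Logic.I). Qed.
Let FS n m (a : T n m) : F a^s = (F a)^s.
Proof. exact: (functorS sF Logic.I). Qed.

Let d n m (a : T n m) := quotient_norm (I (rho n) (rho m)) (F a).

(* With [h = a^* a], [y = h / s], [s = 2 eps^2 p] and [p^2] terms in the Cesaro mean,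
   [a e] is within [2 eps] of [a], and at distance at most
   [2 p^2 s^-2 d(a h h) <= eps / 2] of the ideal. *)
Lemma halve_distance n m (a : T n m) (eps : R) : 0 < eps -> d a <= eps ->
  exists b : T n m, d b <= eps / 2 /\ rnorm (b - a) <= 2 * eps.
Proof.
move=> e0 da; have e20 : 0 < eps ^+ 2 by rewrite exprn_gt0.
have [p p0 hp] := exists_large_nat (rnorm (a^s ** a) / (2 * eps ^+ 2)).
have pR : 0 < p%:R :> R by rewrite ltr0n.
pose s : R := 2 * eps ^+ 2 * p%:R.
have s0 : 0 < s by rewrite !mulr_gt0.
have hs : rnorm (a^s ** a) < s.
  by rewrite /s mulrC -ltr_pdivrMr // mulr_gt0.
have n0 : (0 < p ^ 2)%N by rewrite expn_gt0 p0.
have [ys y1 _ h4] := spectral_cut s0 hs n0.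
set y := _ *: _ in ys y1 h4; set e := mean_defect y _ in h4.
exists (a ** e); split; last first.
  rewrite rnormB -(@ler_pXn2r _ 4) ?nnegrE ?rnorm_ge0 ?mulr_ge0 ?(ltW e0) //.
  apply: le_trans h4 _.
  have -> : s ^+ 2 / (p ^ 2)%:R = 4 * eps ^+ 4.
    by rewrite /s natrX; field; rewrite lt0r_neq0.
  have -> : (2 * eps) ^+ 4 = 16 * eps ^+ 4 by ring.
  by rewrite ler_wpM2r ?exprn_ge0 ?(ltW e0) // ler_nat.
have dD u v : d (u + v : T n m) <= d u + d v by rewrite /d FD; apply: qnormD.
have dZ c (u : T n m) : 0 <= c -> d (c%:C *: u) = c * d u.
  by move=> c0; rewrite /d FZ qnormZ // cabs_real.
(* F turns the reflection along y into the one along F y, which is a contraction and maps the ideal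
   I to itself. *)
have dV (u : T n m) : d (reflection y u) <= d u.
  have Fys : (F y)^s = F y by rewrite -FS ys.
  have Fy1 : rnorm (F y) < 1 by apply: le_lt_trans (functor_contractive _) y1.
  apply/ler_addgt0Pr => g g0.
  have [|x Ix hx] := @qnorm_lt R _ _ (lI _ _) (F u) (d u + g); first by rewrite ltrDl.
  have -> : d (reflection y u) = quotient_norm (I _ _) (reflection (F y) (F u)).
    by rewrite /d /reflection !FD !FN !FD !FM.
  apply: le_trans (@qnorm_le R _ _ _ (reflection (F y) x) _) _.
    have Ixyy := ideal_compr iI (F y) (ideal_compr iI (F y) Ix).
    by apply: lin_subspaceB => //; apply: lin_subspaceD.
  apply: le_trans (ltW hx).
  have -> : reflection (F y) (F u) - reflection (F y) x = reflection (F y) (F u - x).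
    by rewrite /reflection !mcompE; lmod R.
  exact: reflection_norm.
have dge (u : T n m) : 0 <= d u by apply: qnorm_ge0.
have := mean_defect_seminorm n0 a dge dD dZ dV.
rewrite -/e => h; apply: le_trans h _.
have s0' : 0 <= s^-1 by rewrite invr_ge0 ltW.
have -> : a ** y ** y = ((s^-1 * s^-1)%:C) *: (a ** (a^s ** a) ** (a^s ** a)).
  by rewrite /y !mcompE scalerA rmorphM.
rewrite dZ ?mulr_ge0 //.
(* The C*-identity of the quotient norm makes the distance of [a^s ** a] the square of that of a, so
   one a and two copies of h give exponent 5; the factor 2 p^2 / s^2 = 1 / (2 eps^4) then leaves eps
   / 2. *)
have hd : d (a ** (a^s ** a) ** (a^s ** a)) <= eps ^+ 5.
  rewrite /d !FM FS.
  apply: le_trans (qnorm_comp iI _ _) _.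
  apply: le_trans (ler_wpM2r _ (qnorm_comp iI _ _)) _; first exact: qnorm_ge0.
  rewrite qnorm_cstar // -/(d a).
  have -> : d a * d a ^+ 2 * d a ^+ 2 = d a ^+ 5 by ring.
  by rewrite ler_pXn2r ?nnegrE ?(ltW e0) //; apply: dge.
apply: le_trans (ler_wpM2l _ (ler_wpM2l _ hd)) _; rewrite ?mulr_ge0 ?ler0n //.
rewrite natrX /s le_eqVlt; apply/orP; left; apply/eqP; field.
by rewrite !lt0r_neq0.
Qed.

(* Up to the constant, this is the isometry of the injective *-homomorphism that
   [F] induces between the quotients. *)
Lemma lift_distance n m (a : T n m) (eps : R) : 0 < eps -> d a <= eps ->
  exists b : T n m, I _ _ (F b) /\ rnorm (b - a) <= 4 * eps.
Proof.
move=> e0 da.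
(* Halving as a total function, with value 0 where its hypotheses fail, so that it can be
   iterated. *)
have [g hg] : exists g : T n m -> R -> T n m, forall x r, 0 < r -> d x <= r ->
    d (g x r) <= r / 2 /\ rnorm (g x r - x) <= 2 * r.
  have h (xr : T n m * R) : exists b : T n m, 0 < xr.2 -> d xr.1 <= xr.2 ->
      d b <= xr.2 / 2 /\ rnorm (b - xr.1) <= 2 * xr.2.
    have [[r0 hr]|h] := pselect (0 < xr.2 /\ d xr.1 <= xr.2).
      by have [b hb] := halve_distance r0 hr; exists b.
    by exists 0 => h1 h2; case: h.
  by have [g hg] := boolp.choice h; exists (fun x r => g (x, r)) => x r; exact: (hg (x, r)).
(* The k-th step halves a distance of at most eps / 2^k and moves by at most 2 eps / 2^k; the moves
   add up to 4 eps. *)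
pose fix u k := if k is k'.+1 then g (u k') (eps * 2^-1 ^+ k') else a.
have p0 k : 0 < eps * 2^-1 ^+ k by rewrite mulr_gt0 ?exprn_gt0 // invr_gt0.
have du k : d (u k) <= eps * 2^-1 ^+ k.
  elim: k => [|k IHk]; first by rewrite expr0 mulr1.
  have [h _] := hg _ _ (p0 k) IHk; apply: le_trans h _.
  by rewrite exprS mulrCA [leRHS]mulrC.
have hu k : rnorm (u k.+1 - u k) <= 2 * eps * 2^-1 ^+ k.
  by have [_ h] := hg _ _ (p0 k) (du k); rewrite -mulrA.
have [||||b lb hb] := @geometric_limit _ _ u (2 * eps) 2^-1 => //; rewrite ?invr_ge0 //.
- by rewrite mulr_ge0 // ltW.
- by rewrite invf_lt1 // ltr1n.
exists b; split; last first.
  have := hb 0; rewrite expr0 mulr1 /=; congr (_ <= _).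
  by field.
apply: (qnorm_closed (lI _ _)); first exact: (ideal_closed iI).
apply/le_anti; rewrite qnorm_ge0 // andbT; apply/ler_addgt0Pr => e1 e10; rewrite add0r.
have e2 : 0 < e1 / 2 by rewrite divr_gt0.
have [N hN] := lb _ e2.
have [k hk] : exists k, eps * 2^-1 ^+ k < e1 / 2.
  by apply: exists_small_expr; rewrite ?invr_ge0 // invf_lt1 // ltr1n.
have hm : d (u (maxn N k)) <= e1 / 2.
  apply: le_trans (du _) _; apply: le_trans (ltW hk); rewrite ler_pM2l //.
  by apply: ler_wiXn2l; rewrite ?leq_maxr ?invr_ge0 // invf_le1 // ler1n.
apply: le_trans (qnorm_diff (lI _ _) _ (F (u (maxn N k)))) _.
rewrite -FN -FD.
have := hN _ (leq_maxl N k); have := functor_contractive (b - u (maxn N k)).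
rewrite (rnormB b); move: hm; rewrite /d; lra.
Qed.

End RelativeIdeals.

(** * Quotient C*-algebras *)

(** One construction for two uses: the quotient by an ideal (S everything, q the distance) and an
    ideal as an algebra of its own (S the ideal, q the norm). The laws of q hold on all of A, while
    completeness concerns sequences of S. *)
Record cstar_seminorm (R : realType) (A : cstar_algebra R) (S : set A) (q : A -> R) :
    Prop := CstarSeminorm {
  csn_lin : lin_subspace S;
  csn_mul : forall a b, S a -> S b -> S (ca_mul a b);
  csn_star : forall a, S a -> S (ca_star a);
  csn_D : forall a b, q (a + b) <= q a + q b;
  csn_Z : forall c a, q (c *: a) = cabs c * q a;
  csn_M : forall a b, q (ca_mul a b) <= q a * q b;
  csn_C : forall a, q (ca_mul (ca_star a) a) = q a ^+ 2;
  csn_complete : forall u : nat -> A, (forall n, S (u n)) ->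
    (forall e, 0 < e -> exists N, forall n m, (N <= n)%N -> (N <= m)%N -> q (u n - u m) < e) ->
    exists2 l, S l & forall e, 0 < e -> exists N, forall n, (N <= n)%N -> q (u n - l) < e }.

Section SeparatedAlgebra.
Variables (R : realType) (A : cstar_algebra R) (S : set A) (q : A -> R).
Hypothesis (h : cstar_seminorm S q).
Local Notation C := R[i].

Let Sl : lin_subspace S := csn_lin h.
Let S0 : S 0 := Sl.1.

Let cabsN1 : cabs (- 1 : C) = 1.
Proof. by rewrite /cabs normrN normr1. Qed.

Lemma csn_N a : q (- a) = q a.
Proof. by rewrite -scaleN1r (csn_Z h) cabsN1 mul1r. Qed.
Lemma csn_0 : q 0 = 0.
Proof. by have := csn_Z h 0 0; rewrite scale0r /cabs normr0 mul0r. Qed.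
Lemma csn_ge0 a : 0 <= q a.
Proof. by have := csn_D h a (- a); rewrite subrr csn_0 csn_N; lra. Qed.
Lemma csn_B a b : q (a - b) = q (b - a).
Proof. by rewrite -csn_N opprB. Qed.

(* Elements outside [S] are sent to the class of [0]. *)
Definition class_repr (x : A) : A :=
  xget 0 [set y | S y /\ q ((if `[< S x >] then x else 0) - y) = 0].

Lemma class_reprP x : S x -> S (class_repr x) /\ q (x - class_repr x) = 0.
Proof.
move=> Sx; rewrite /class_repr (asboolT Sx).
by case: xgetP => [y _ [? ?]|xN] //; exfalso; apply: (xN x); rewrite /= subrr csn_0.
Qed.

Lemma class_repr_eq x y : S x -> S y -> q (x - y) = 0 -> class_repr x = class_repr y.
Proof.
move=> Sx Sy xy; rewrite /class_repr (asboolT Sx) (asboolT Sy); congr xget.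
apply/seteqP; split=> z [Sz hz]; split=> //; apply/le_anti; rewrite csn_ge0 andbT.
  have -> : y - z = (y - x) + (x - z) by lmod R.
  by apply: le_trans (csn_D h _ _) _; rewrite csn_B xy hz addr0.
have -> : x - z = (x - y) + (y - z) by lmod R.
by apply: le_trans (csn_D h _ _) _; rewrite xy hz addr0.
Qed.

(** Chosen representatives make equality of classes plain equality. The proof of [cstar_seminorm] is
    a parameter of the type, because the structures attached to the type depend on it. *)
Definition sep_quotient of cstar_seminorm S q := {x : A | `[< S x /\ class_repr x = x >]}.
Local Notation Q := (sep_quotient h).

HB.instance Definition _ := Choice.copy Q {x : A | `[< S x /\ class_repr x = x >]}.

Definition srepr (u : Q) : A := sval u.

Lemma srepr_mem u : S (srepr u).
Proof. by case: u => x /= /asboolP[]. Qed.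

Lemma class_subproof x : `[< S (class_repr x) /\ class_repr (class_repr x) = class_repr x >].
Proof.
apply/asboolP; have [Sx|nSx] := pselect (S x).
  have [Sr hr] := class_reprP Sx; split=> //; apply: class_repr_eq => //.
  by rewrite csn_B.
have -> : class_repr x = class_repr 0.
  by rewrite /class_repr (asboolF nSx) (asboolT S0).
have [Sr hr] := class_reprP S0; split=> //; apply: class_repr_eq => //.
by rewrite csn_B.
Qed.

Definition scls (x : A) : Q := exist _ (class_repr x) (class_subproof x).

Lemma sreprK : cancel srepr scls.
Proof. by move=> u; apply/val_inj; case: u => x /= /asboolP[]. Qed.

Lemma scls_eqP x y : S x -> S y -> scls x = scls y <-> q (x - y) = 0.
Proof.
move=> Sx Sy; split; last by move=> e; apply/val_inj => /=; apply: class_repr_eq.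
move=> /(congr1 srepr) /= e; have [_ hx] := class_reprP Sx; have [_ hy] := class_reprP Sy.
apply/le_anti; rewrite csn_ge0 andbT.
have -> : x - y = (x - class_repr x) + - (y - class_repr y) by rewrite e; lmod R.
by apply: le_trans (csn_D h _ _) _; rewrite csn_N hx hy addr0.
Qed.

Lemma srepr_scls x : S x -> q (srepr (scls x) - x) = 0.
Proof. by move=> /class_reprP[_]; rewrite csn_B. Qed.

Let SD a b : S a -> S b -> S (a + b). Proof. exact: lin_subspaceD. Qed.
Let SN a : S a -> S (- a). Proof. exact: lin_subspaceN. Qed.
Let SZ c a : S a -> S (c *: a). Proof. exact: lin_subspaceZ. Qed.

Definition sadd (u v : Q) := scls (srepr u + srepr v).
Definition sopp (u : Q) := scls (- srepr u).
Definition sscale (c : C) (u : Q) := scls (c *: srepr u).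
Definition smul (u v : Q) := scls (ca_mul (srepr u) (srepr v)).
Definition sstar (u : Q) := scls (ca_star (srepr u)).

Let q0D a b : q a = 0 -> q b = 0 -> q (a + b) = 0.
Proof.
move=> a0 b0; apply/le_anti; rewrite csn_ge0 andbT.
by apply: le_trans (csn_D h _ _) _; rewrite a0 b0 addr0.
Qed.

Lemma scls_D x y : S x -> S y -> scls (x + y) = sadd (scls x) (scls y).
Proof.
move=> Sx Sy; apply/scls_eqP; try by apply: SD => //; exact: srepr_mem.
rewrite csn_B; have -> : srepr (scls x) + srepr (scls y) - (x + y) =
  (srepr (scls x) - x) + (srepr (scls y) - y) by lmod R.
by rewrite q0D // srepr_scls.
Qed.

Lemma scls_N x : S x -> scls (- x) = sopp (scls x).
Proof.
move=> Sx; apply/scls_eqP; try by apply: SN => //; exact: srepr_mem.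
by rewrite opprK addrC srepr_scls.
Qed.

Lemma scls_Z c x : S x -> scls (c *: x) = sscale c (scls x).
Proof.
move=> Sx; apply/scls_eqP; try by apply: SZ => //; exact: srepr_mem.
by rewrite -scalerBr (csn_Z h) csn_B srepr_scls ?mulr0.
Qed.

Lemma separated_surj u : exists2 x, S x & u = scls x.
Proof. by exists (srepr u); [exact: srepr_mem|rewrite sreprK]. Qed.

Let elim3 (P : Q -> Q -> Q -> Prop) :
  (forall x y z, S x -> S y -> S z -> P (scls x) (scls y) (scls z)) ->
  forall u v w, P u v w.
Proof.
by move=> H u v w; have := H _ _ _ (srepr_mem u) (srepr_mem v) (srepr_mem w); rewrite !sreprK.
Qed.

Let addA : associative sadd.
Proof.
by apply: elim3 => x y z Sx Sy Sz; rewrite -!scls_D ?addrA //; apply: SD.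
Qed.
Let addC : commutative sadd.
Proof. by move=> u v; rewrite /sadd addrC. Qed.
Let add0 : left_id (scls 0) sadd.
Proof. by move=> u; have [x Sx ->] := separated_surj u; rewrite -scls_D // add0r. Qed.
Let addN : left_inverse (scls 0) sopp sadd.
Proof.
move=> u; have [x Sx ->] := separated_surj u; rewrite -scls_N // -scls_D ?addNr //.
exact: SN.
Qed.

HB.instance Definition _ := GRing.isZmodule.Build Q addA addC add0 addN.

Let scaleA a b u : sscale a (sscale b u) = sscale (a * b) u.
Proof.
have [x Sx ->] := separated_surj u; rewrite -!scls_Z ?scalerA //; exact: SZ.
Qed.
Let scale1 : left_id 1 sscale.
Proof. by move=> u; have [x Sx ->] := separated_surj u; rewrite -scls_Z // scale1r. Qed.
Let scaleDr : right_distributive sscale +%R.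
Proof.
move=> c u v; have [x Sx ->] := separated_surj u; have [y Sy ->] := separated_surj v.
rewrite -[_ + _]/(sadd _ _) -[X in _ = X]/(sadd _ _).
by rewrite -scls_D // -!scls_Z ?scalerDr ?scls_D //; do ?apply: SD; do ?apply: SZ.
Qed.
Let scaleDl u : {morph sscale^~ u : a b / a + b}.
Proof.
move=> a b; have [x Sx ->] := separated_surj u; rewrite -[X in _ = X]/(sadd _ _).
by rewrite -!scls_Z // -scls_D ?scalerDl //; apply: SZ.
Qed.

HB.instance Definition _ := GRing.Zmodule_isLmodule.Build C Q scaleA scale1 scaleDr scaleDl.

Let norm (u : Q) : C := (q (srepr u))%:C.

Lemma srepr_norm x : S x -> q (srepr (scls x)) = q x.
Proof.
move=> Sx; have h0 := srepr_scls Sx; apply/le_anti/andP; split.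
  have -> : srepr (scls x) = (srepr (scls x) - x) + x by lmod R.
  by apply: le_trans (csn_D h _ _) _; rewrite h0 add0r.
have -> : q x = q (- (srepr (scls x) - x) + srepr (scls x)) by congr q; lmod R.
by apply: le_trans (csn_D h _ _) _; rewrite csn_N h0 add0r.
Qed.

Let normD (u v : Q) : norm (u + v) <= norm u + norm v.
Proof.
have [x Sx ->] := separated_surj u; have [y Sy ->] := separated_surj v.
rewrite -[_ + _ in leLHS]/(sadd _ _) -scls_D // /norm -rmorphD /= lecR !srepr_norm //.
  exact: (csn_D h).
exact: SD.
Qed.
Let normZ (c : C) (u : Q) : norm (c *: u) = `|c| * norm u.
Proof.
have [x Sx ->] := separated_surj u.
rewrite -[_ *: _]/(sscale _ _) -scls_Z // /norm cabsE -rmorphM /= !srepr_norm ?(csn_Z h) //.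
exact: SZ.
Qed.
Let norm0 (u : Q) : norm u = 0 -> u = 0.
Proof.
have [x Sx ->] := separated_surj u; rewrite /norm => /complexI.
by rewrite srepr_norm // => x0; apply/scls_eqP; rewrite ?subr0.
Qed.

HB.instance Definition _ := Lmodule_isNormed.Build C Q normD normZ norm0.

Lemma rnorm_scls x : S x -> rnorm (scls x) = q x.
Proof. by move=> Sx; rewrite /rnorm -srepr_norm. Qed.

Lemma sclsB x y : S x -> S y -> scls x - scls y = scls (x - y).
Proof. by move=> Sx Sy; rewrite scls_D ?scls_N //; apply: SN. Qed.

Lemma separated_seq_complete (u : nat -> Q) : rcauchy u -> exists l, rlim u l.
Proof.
move=> cu; have Su n : S (srepr (u n)) by exact: srepr_mem.
have hq (v w : Q) : rnorm (v - w) = q (srepr v - srepr w).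
  rewrite -{1}(sreprK v) -{1}(sreprK w) sclsB ?rnorm_scls //; try exact: srepr_mem.
  by apply: SD; [|apply: SN]; exact: srepr_mem.
have [e /cu[N hN]|l Sl' hl] := csn_complete h Su.
  by exists N => n m Nn Nm; rewrite -hq; apply: hN.
exists (scls l) => e /hl[N hN]; exists N => n Nn.
rewrite -(sreprK (u n)) sclsB // rnorm_scls; first exact: hN.
by apply: SD => //; apply: SN.
Qed.

End SeparatedAlgebra.

Section SequentialCompleteness.
Variables (R : realType) (V : normedModType R[i]).

(** A Cauchy filter contains balls of radius 2^-n; their centres form a Cauchy sequence, to whose
    limit the filter converges. *)
Lemma seq_complete_cvg : (forall u : nat -> V, rcauchy u -> exists l, rlim u l) ->
  forall F : set_system V, ProperFilter F -> cauchy F -> cvg F.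
Proof.
move=> hV F PF /cauchyP cF.
have p0 n : 0 < 2^-1 ^+ n :> R by rewrite exprn_gt0 // invr_gt0.
have /boolp.choice[u hu] n : exists x, F (ball x ((2^-1 ^+ n : R)%:C)).
  by apply: cF; rewrite ltcR.
have small (e : R) : 0 < e -> exists N, 2^-1 ^+ N < e.
  move=> e0; have [|||N] := @exists_small_expr R 1 2^-1 e.
  - by rewrite invr_ge0.
  - by rewrite invf_lt1 // ltr1n.
  - exact: e0.
  by rewrite mul1r; exists N.
have anti n m : (n <= m)%N -> 2^-1 ^+ m <= 2^-1 ^+ n :> R.
  by move=> nm; apply: ler_wiXn2l; rewrite ?invr_ge0 // invf_le1 // ler1n.
have [|l hl] := hV u.
  move=> e e0; have [N hN] := small _ (divr_gt0 e0 (ltr0n R 2)).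
  exists N => n m Nn Nm.
  have [z [/ball_rnormP zn /ball_rnormP zm]] := filter_ex (filterI (hu n) (hu m)).
  apply: le_lt_trans (rnorm_dist _ z _) _; rewrite (rnormB z).
  by have := anti _ _ Nn; have := anti _ _ Nm; lra.
apply/cvg_ex; exists l => B /nbhs_rnormP[e e0 hB].
have e2 : 0 < e / 2 by rewrite divr_gt0.
have [N hN] := small _ e2; have [M hM] := hl _ e2.
apply: filterS (hu (maxn N M)) => z /ball_rnormP hz; apply: hB.
apply: le_lt_trans (rnorm_dist _ (u (maxn N M)) _) _; rewrite (rnormB l).
by have := anti _ _ (leq_maxl N M); have := hM _ (leq_maxr N M); lra.
Qed.

End SequentialCompleteness.

Section QuotientAlgebra.
Variables (R : realType) (A : cstar_algebra R) (S : set A) (q : A -> R).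
Hypothesis (h : cstar_seminorm S q).
Local Notation Q := (sep_quotient h).
Local Notation C := R[i].

HB.instance Definition _ := Uniform_isComplete.Build Q
  (@seq_complete_cvg R Q (@separated_seq_complete R A S q h)).

End QuotientAlgebra.

(** * C*-algebras as constant precategories *)

Section ConstantCategory.
Variables (R : realType) (B : cstar_algebra R).

(* Makes the lemmas on precategories available for C*-algebras. *)
Definition const_cat : cstar_precategory R :=
  @CstarPrecategory R (fun _ _ => ca_sort B) (fun _ _ _ => @ca_mul R B)
    (fun _ _ => @ca_star R B) (fun _ _ _ => @ca_mulDZl R B)
    (fun _ _ _ => @ca_mulDZr R B) (fun _ _ _ _ => @ca_mulA R B)
    (fun _ _ => @ca_starDZ R B) (fun _ _ => @ca_starK R B)
    (fun _ _ _ => @ca_starM R B) (fun _ _ _ => @ca_normM R B)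
    (fun _ _ => @ca_normC R B).

Lemma ca_mulDl (a b d : B) : ca_mul (a + b) d = ca_mul a d + ca_mul b d.
Proof. exact: (@compDl R const_cat 0 0 0). Qed.
Lemma ca_mulDr (d a b : B) : ca_mul d (a + b) = ca_mul d a + ca_mul d b.
Proof. exact: (@compDr R const_cat 0 0 0). Qed.
Lemma ca_mulZl c (a d : B) : ca_mul (c *: a) d = c *: ca_mul a d.
Proof. exact: (@compZl R const_cat 0 0 0). Qed.
Lemma ca_mulZr c (d a : B) : ca_mul d (c *: a) = c *: ca_mul d a.
Proof. exact: (@compZr R const_cat 0 0 0). Qed.
Lemma ca_mulNl (a d : B) : ca_mul (- a) d = - ca_mul a d.
Proof. exact: (@compNl R const_cat 0 0 0). Qed.
Lemma ca_mulNr (d a : B) : ca_mul d (- a) = - ca_mul d a.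
Proof. exact: (@compNr R const_cat 0 0 0). Qed.
Lemma ca_mul0l (d : B) : ca_mul 0 d = 0.
Proof. exact: (@comp0l R const_cat 0 0 0). Qed.
Lemma ca_mul0r (d : B) : ca_mul d 0 = 0.
Proof. exact: (@comp0r R const_cat 0 0 0). Qed.
Lemma ca_starD (a b : B) : ca_star (a + b) = ca_star a + ca_star b.
Proof. exact: (@starD R const_cat 0 0). Qed.
Lemma ca_starZ c (a : B) : ca_star (c *: a) = conjc c *: ca_star a.
Proof. exact: (@starZ R const_cat 0 0). Qed.
Lemma ca_starN (a : B) : ca_star (- a) = - ca_star a.
Proof. exact: (@starN R const_cat 0 0). Qed.
Lemma ca_star0 : ca_star (0 : B) = 0.
Proof. exact: (@star0 R const_cat 0 0). Qed.
Lemma rnorm_mul (a b : B) : rnorm (ca_mul a b) <= rnorm a * rnorm b.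
Proof. exact: (@rnorm_comp R const_cat 0 0 0). Qed.
Lemma rnorm_ca_cstar (a : B) : rnorm (ca_mul (ca_star a) a) = rnorm a ^+ 2.
Proof. exact: (@rnorm_cstar R const_cat 0 0). Qed.
Definition caE := (ca_mulDl, ca_mulDr, ca_mulZl, ca_mulZr, ca_mulNl, ca_mulNr,
  ca_mul0l, ca_mul0r, ca_starD, ca_starZ, ca_starN, ca_star0, @ca_starM, @ca_starK).

Definition const_family (P : set B) : hom_family const_cat := fun _ _ => P.

Lemma const_ideal (P : set B) : is_alg_ideal P -> is_ideal (const_family P).
Proof. by case=> *; split=> n m; auto; move=> l a b; auto. Qed.

End ConstantCategory.

Section QuotientOperations.
Variables (R : realType) (A : cstar_algebra R) (S : set A) (q : A -> R).
Hypothesis (h : cstar_seminorm S q).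
Local Notation Q := (sep_quotient h).
Local Notation C := R[i].
Local Notation p := (scls h).

Let SM a b : S a -> S b -> S (ca_mul a b). Proof. exact: (csn_mul h). Qed.
Let SS a : S a -> S (ca_star a). Proof. exact: (csn_star h). Qed.
Let SD a b : S a -> S b -> S (a + b). Proof. exact: (lin_subspaceD (csn_lin h)). Qed.
Let SZ c a : S a -> S (c *: a). Proof. exact: (lin_subspaceZ (csn_lin h)). Qed.
Lemma csn_starE a : q (ca_star a) = q a.
Proof.
have H b : q b <= q (ca_star b).
  have [->|b0] := eqVneq (q b) 0; first exact: (csn_ge0 h).
  have b1 : 0 < q b by rewrite lt_neqAle eq_sym b0 (csn_ge0 h).
  by rewrite -(ler_pM2r b1) -expr2 -(csn_C h) (csn_M h).
by apply/le_anti; rewrite H -{2}(ca_starK a) H.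
Qed.

Lemma scls_lin c x y : S x -> S y -> p (c *: x + y) = c *: p x + p y.
Proof. by move=> Sx Sy; rewrite scls_D ?scls_Z //; apply: SZ. Qed.

Lemma scls_M x y : S x -> S y -> p (ca_mul x y) = smul (p x) (p y).
Proof.
move=> Sx Sy; apply/scls_eqP; try by apply: SM => //; exact: srepr_mem.
rewrite (csn_B h); set x' := srepr (p x); set y' := srepr (p y).
have -> : ca_mul x' y' - ca_mul x y = ca_mul (x' - x) y' + ca_mul x (y' - y).
  by rewrite !caE; lmod R.
apply/le_anti; rewrite (csn_ge0 h) andbT.
apply: le_trans (csn_D h _ _) _.
apply: le_trans (lerD (csn_M h _ _) (csn_M h _ _)) _.
by rewrite !srepr_scls // mul0r mulr0 addr0.
Qed.

Lemma scls_S x : S x -> p (ca_star x) = sstar (p x).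
Proof.
move=> Sx; apply/scls_eqP; try by apply: SS => //; exact: srepr_mem.
by rewrite (csn_B h) -ca_starN -ca_starD csn_starE srepr_scls.
Qed.

Let elim3 (P : Q -> Q -> Q -> Prop) :
  (forall x y z, S x -> S y -> S z -> P (p x) (p y) (p z)) ->
  forall u v w, P u v w.
Proof.
move=> H u v w; have := H _ _ _ (srepr_mem u) (srepr_mem v) (srepr_mem w).
by rewrite !sreprK.
Qed.

Let mDl c (u v w : Q) : smul (c *: u + v) w = c *: smul u w + smul v w.
Proof.
move: u v w; apply: elim3 => x y z Sx Sy Sz.
rewrite -scls_lin // -!scls_M //; last by apply: SD => //; apply: SZ.
by rewrite -scls_lin ?ca_mulDZl //; apply: SM.
Qed.
Let mDr c (u v w : Q) : smul u (c *: v + w) = c *: smul u v + smul u w.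
Proof.
move: u v w; apply: elim3 => x y z Sx Sy Sz.
rewrite -scls_lin // -!scls_M //; last by apply: SD => //; apply: SZ.
by rewrite -scls_lin ?ca_mulDZr //; apply: SM.
Qed.
Let mA (u v w : Q) : smul u (smul v w) = smul (smul u v) w.
Proof.
move: u v w; apply: elim3 => x y z Sx Sy Sz.
by rewrite -!scls_M ?ca_mulA //; apply: SM.
Qed.
Let sD c (u v : Q) : sstar (c *: u + v) = conjc c *: sstar u + sstar v.
Proof.
have := @elim3 (fun u v _ => sstar (c *: u + v) = conjc c *: sstar u + sstar v) _ u v u.
apply=> x y _ Sx Sy _.
rewrite -scls_lin // -!scls_S //; last by apply: SD => //; apply: SZ.
by rewrite -scls_lin ?ca_starDZ //; apply: SS.
Qed.
Let sK (u : Q) : sstar (sstar u) = u.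
Proof.
by have [x Sx ->] := separated_surj u; rewrite -!scls_S ?ca_starK //; apply: SS.
Qed.
Let sM (u v : Q) : sstar (smul u v) = smul (sstar v) (sstar u).
Proof.
have [x Sx ->] := separated_surj u; have [y Sy ->] := separated_surj v.
rewrite -scls_M // -!scls_S //; last exact: SM.
by rewrite -scls_M ?ca_starM //; apply: SS.
Qed.
Let nM (u v : Q) : `|smul u v| <= `|u| * `|v|.
Proof.
have [x Sx ->] := separated_surj u; have [y Sy ->] := separated_surj v.
rewrite -scls_M // !normE -rmorphM /= lecR !rnorm_scls //; first exact: (csn_M h).
exact: SM.
Qed.
Let nC (u : Q) : `|smul (sstar u) u| = `|u| ^+ 2.
Proof.
have [x Sx ->] := separated_surj u.
rewrite -scls_S // -scls_M //; last exact: SS.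
rewrite !normE -rmorphXn /= !rnorm_scls ?(csn_C h) //.
by apply: SM => //; apply: SS.
Qed.

Definition separated_algebra : cstar_algebra R :=
  @CstarAlgebra R Q (@smul R A S q h) (@sstar R A S q h) mDl mDr mA sD sK sM nM nC.

(** From here on only these properties are used, never the representatives. *)
Lemma exists_separated : exists (E : cstar_algebra R) (pr : A -> E),
  [/\ (forall c a b, S a -> S b -> pr (c *: a + b) = c *: pr a + pr b),
      (forall a b, S a -> S b -> pr (ca_mul a b) = ca_mul (pr a) (pr b)),
      (forall a, S a -> pr (ca_star a) = ca_star (pr a)),
      (forall a, S a -> rnorm (pr a) = q a)
    & (forall u, exists2 x, S x & u = pr x)].
Proof.
exists separated_algebra, p; split.
- exact: scls_lin.
- exact: scls_M.
- exact: scls_S.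
- exact: rnorm_scls.
- exact: separated_surj.
Qed.

End QuotientOperations.

Section IdealAlgebras.
Variables (R : realType) (A : cstar_algebra R) (P : set A).
Hypothesis (iP : is_alg_ideal P).

Let Pl : lin_subspace P := alg_ideal_subspace iP.
Let iPc := const_ideal iP.

Lemma alg_ideal_star a : P a -> P (ca_star a).
Proof. exact: (@ideal_star R (const_cat A) (const_family P) iPc 0 0). Qed.

(** A subsequence v that converges fast modulo P is corrected by elements of P into a sequence w
    that is Cauchy in norm; its limit is also a limit of u modulo P. *)
Lemma quotient_complete (u : nat -> A) :
  (forall e, 0 < e -> exists N, forall n m, (N <= n)%N -> (N <= m)%N ->
    quotient_norm P (u n - u m) < e) ->
  exists l, forall e, 0 < e -> exists N, forall n, (N <= n)%N ->
    quotient_norm P (u n - l) < e.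
Proof.
move=> cu.
have p0 k : 0 < 2^-1 ^+ k :> R by rewrite exprn_gt0 // invr_gt0.
have /boolp.choice[N hN] k := cu _ (p0 k).
(* The running maximum puts both M k and M k.+1 beyond N k, so that consecutive terms of v are at
   distance less than 2^-k. *)
pose M k := (\max_(j < k.+1) N j)%N.
have NM k : (N k <= M k)%N by rewrite /M (leq_bigmax (ord_max : 'I_k.+1)).
have NMS k : (N k <= M k.+1)%N.
  by rewrite /M (leq_bigmax (widen_ord (leqnSn _) (ord_max : 'I_k.+1))).
pose v k := u (M k).
have /boolp.choice[r hr] k : exists r, P r /\ rnorm (v k.+1 - v k - r) < 2^-1 ^+ k.
  by have [r Pr hr] := qnorm_lt Pl (hN k _ _ (NMS k) (NM k)); exists r.
pose fix w k := if k is k'.+1 then w k' + (v k'.+1 - v k' - r k') else v 0%N.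
have wv k : P (v k - w k).
  elim: k => [|k IHk] /=; first by rewrite subrr; exact: Pl.1.
  have -> : v k.+1 - (w k + (v k.+1 - v k - r k)) = (v k - w k) + r k by lmod R.
  by apply: lin_subspaceD => //; case: (hr k).
have [||||l wl _] := @geometric_limit R A w 1 2^-1; rewrite ?invr_ge0 ?ler01 //.
- by rewrite invf_lt1 // ltr1n.
- move=> k /=; rewrite mul1r (_ : _ - w k = v k.+1 - v k - r k); last by lmod R.
  by case: (hr k) => _ /ltW.
exists l => e e0; have e2 : 0 < e / 2 by rewrite divr_gt0.
have [k1 hk1] := wl _ e2.
have [k2 hk2] : exists k, 1 * 2^-1 ^+ k < e / 2.
  by apply: exists_small_expr; rewrite ?invr_ge0 // invf_lt1 // ltr1n.
pose k := maxn k1 k2.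
have hk : 2^-1 ^+ k <= 2^-1 ^+ k2 :> R.
  by apply: ler_wiXn2l; rewrite ?leq_maxr ?invr_ge0 // invf_le1 // ler1n.
exists (N k) => n Nn.
have -> : u n - l = (u n - v k) + ((v k - w k) + (w k - l)) by lmod R.
apply: le_lt_trans (qnormD Pl _ _) _.
have h1 := hN k _ _ Nn (NM k); have h2 := hk1 k (leq_maxl _ _).
have h3 := qnormD Pl (v k - w k) (w k - l).
have h4 := qnorm_le_rnorm Pl (w k - l).
rewrite (qnorm_mem Pl (wv k)) in h3; rewrite -/(v k) in h1; lra.
Qed.

Lemma quotient_algebra : exists (E : cstar_algebra R) (pr : A -> E),
  [/\ star_hom pr, (forall a, rnorm (pr a) = quotient_norm P a)
    & forall u, exists a, u = pr a].
Proof.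
have hs : cstar_seminorm setT (quotient_norm P).
  split => //.
  - exact: qnormD.
  - exact: qnormZ.
  - exact: (@qnorm_comp R (const_cat A) (const_family P) iPc 0 0 0).
  - exact: (@qnorm_cstar R (const_cat A) (const_family P) iPc 0 0).
  - by move=> u _ /quotient_complete[l hl]; exists l.
have [E [pr [h1 h2 h3 h4 h5]]] := exists_separated hs.
exists E, pr; split; first by split=> [c a b|a b|a]; [apply: h1|apply: h2|apply: h3].
  by move=> a; apply: h4.
by move=> u; have [a _ ->] := h5 u; exists a.
Qed.

(** Applied to O(N), this supplies the algebra that carries DR(N). *)
Lemma ideal_algebra : exists (E : cstar_algebra R) (j : E -> A),
  [/\ star_hom j, (forall u, rnorm (j u) = rnorm u) & range j = P].
Proof.
have hs : cstar_seminorm P (@rnorm R A).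
  split => //.
  - by move=> a b _ Pb; apply: (alg_ideal_mull iP).
  - exact: alg_ideal_star.
  - exact: rnormD.
  - exact: rnormZ.
  - exact: rnorm_mul.
  - exact: rnorm_ca_cstar.
  - move=> u Pu /rlim_complete[l hl]; exists l => //.
    exact: closed_rlim (alg_ideal_closed iP) Pu hl.
have [E [pr [h1 h2 h3 h4 h5]]] := exists_separated hs.
have /boolp.choice[j hj] u : exists a, P a /\ u = pr a.
  by have [a Pa ->] := h5 u; exists a.
have pr_inj a b : P a -> P b -> pr a = pr b -> a = b.
  move=> Pa Pb e; apply/eqP; rewrite -subr_eq0; apply/eqP/rnorm_eq0.
  have e1 : a - b = (-1) *: b + a by rewrite scaleN1r addrC.
  rewrite -h4; last by rewrite e1; apply: Pl.2.
  by rewrite e1 h1 // e scaleN1r addNr rnorm0.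
have Pj u : P (j u) by case: (hj u).
have jK u : pr (j u) = u by case: (hj u).
exists E, j; split.
- split.
  + by move=> c a b; apply: pr_inj; rewrite ?h1 ?jK //; apply: Pl.2.
  + by move=> a b; apply: pr_inj; rewrite ?h2 ?jK //; apply: (alg_ideal_mull iP).
  + by move=> a; apply: pr_inj; rewrite ?h3 ?jK //; apply: alg_ideal_star.
- by move=> u; rewrite -h4 ?jK.
- apply/seteqP; split=> [_ [u _ <-] //|a Pa]; exists (pr a) => //.
  by apply: pr_inj; rewrite ?jK.
Qed.

End IdealAlgebras.

(** * Graded representations and their integration *)

Section RootsOfUnity.
Variables (R : realType).
Local Notation C := R[i].

(** X^n - 1 splits over [R[i]] and is separable, and n distinct n-th roots of unity include a
    primitive one. *)
Lemma complex_prim_root n : (0 < n)%N -> exists w : C, n.-primitive_root w.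
Proof.
move=> n0; have [rs] := closed_field_poly_normal ('X^n - 1 : {poly C}).
rewrite (monicP _) ?monicXnsubC // scale1r => rsE.
have roots : all n.-unity_root rs by apply/allP => x; rewrite -root_prod_XsubC -rsE.
have n_size : (n < (size rs).+1)%N by rewrite -(size_prod_XsubC rs id) -rsE size_XnsubC.
have [|w _ hw] := hasP (cyclic.has_prim_root n0 roots _ n_size); last by exists w.
rewrite -separable.separable_prod_XsubC -rsE cyclotomic.separable_Xn_sub_1 //.
by rewrite pnatr_eq0 -lt0n.
Qed.

Lemma cabsX (c : C) k : cabs (c ^+ k) = cabs c ^+ k.
Proof. by apply: (@complexI R); rewrite rmorphXn /= -!cabsE normrX. Qed.

Lemma circleE (z : C) : circle z <-> cabs z = 1.
Proof.
rewrite /circle /= cabsE; split=> [|->//].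
by move=> /(congr1 (@complex.Re R)).
Qed.

Lemma circle_exprz (z : C) (k : int) : circle z -> circle (z ^ k).
Proof. by rewrite /circle /= => z1; case: k => k; rewrite /exprz ?normfV normrX z1 expr1n ?invr1. Qed.

Lemma circle_unit (z : C) : circle z -> z != 0.
Proof. by rewrite /circle /= => z1; rewrite -normr_gt0 z1. Qed.

Lemma prim_root_circle n (w : C) : (0 < n)%N -> n.-primitive_root w -> circle w.
Proof.
move=> n0 /prim_expr_order wn; apply/circleE.
have : cabs w ^+ n = 1 by rewrite -cabsX wn /cabs normr1.
by move/eqP; rewrite pexpr_eq1 ?cabs_ge0 // => /eqP.
Qed.

Lemma prim_root_sum n (w : C) (l : int) : n.-primitive_root w -> l != 0 ->
  (`|l| < n)%N -> \sum_(j < n) (w ^ l) ^+ j = 0.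
Proof.
move=> pw l0 ln; have n0 := prim_order_gt0 pw.
have w0 : w != 0 := circle_unit (prim_root_circle n0 pw).
have wl : w ^ l != 1.
  have h m : (0 < m < n)%N -> w ^+ m != 1.
    move=> /andP[m0 mn]; rewrite -(prim_order_dvd pw).
    by apply/negP => /(dvdn_leq m0); rewrite leqNgt mn.
  case: l l0 ln => m l0 ln; first by apply: h; rewrite lt0n l0.
  rewrite /exprz; apply/eqP => e; have := h m.+1 ln.
  by rewrite -[w ^+ _]invrK e invr1 eqxx.
apply: (mulfI (_ : w ^ l - 1 != 0)); first by rewrite subr_eq0.
by rewrite mulr0 -subrX1 exprnP exprzAC -exprnP (prim_expr_order pw) exp1rz subrr.
Qed.

End RootsOfUnity.

Section Single.
Variables (R : realType) (T : cstar_precategory R).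

Lemma single_diag n m (a : T n m) : single a n m = a.
Proof.
rewrite /single; case: eqP => // e; case: eqP => // f.
by rewrite (eq_irrelevance e erefl) (eq_irrelevance f erefl).
Qed.

Lemma single_off n m (a : T n m) i j : (n, m) <> (i, j) -> single a i j = 0.
Proof.
rewrite /single => h; case: eqP => // e; case: eqP => // f.
by case: h; rewrite e f.
Qed.

Lemma single_mem (N : hom_family T) n m (a : T n m) : (forall i j, N i j 0) ->
  N n m a -> forall i j, N i j (single a i j).
Proof.
move=> N0 Na i j; have [[e f]|h] := pselect ((n, m) = (i, j)); last by rewrite single_off.
by rewrite -e -f single_diag.
Qed.

End Single.

Section GradedRepresentations.
Variables (R : realType) (L : rt_precategory R) (N : hom_family L).
Hypothesis (iN : is_ideal N) (tN : tens_invariant N).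
Arguments N : clear implicits.
Local Notation C := R[i].

Let lN n m : lin_subspace (N n m). Proof. exact: (ideal_subspace iN). Qed.

Lemma tens_mem k n m (a : L n m) : N n m a -> N (k + n)%N (k + m)%N (tens k a).
Proof. by move=> Na; elim: k => [|k IHk] //=; apply: tN. Qed.

Section OneRepresentation.
Variables (E : cstar_algebra R) (kappa : forall n m, L n m -> E).
Hypothesis (rk : is_rtrep N kappa) (ck : coisometric_on N kappa).
Arguments kappa : clear implicits.

Lemma rep_tens k n m (a : L n m) : N n m a ->
  kappa (k + n)%N (k + m)%N (tens k a) = kappa n m a.
Proof.
move=> Na; elim: k => [|k IHk] //=.
by rewrite -IHk; symmetry; apply: (ck (tens_mem k Na)).
Qed.

Lemma rep0 n m : kappa n m 0 = 0.
Proof.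
have N0 : N n m 0 := (lN n m).1.
have := rtrepDZ rk 1 N0 N0; rewrite !scale1r addr0 => e.
by apply: (addrI (kappa n m 0)); rewrite addr0 -e.
Qed.

Lemma repD n m a b : N n m a -> N n m b -> kappa n m (a + b) = kappa n m a + kappa n m b.
Proof. by move=> Na Nb; have := rtrepDZ rk 1 Na Nb; rewrite !scale1r. Qed.

Lemma repB n m a b : N n m a -> N n m b -> kappa n m (a - b) = kappa n m a - kappa n m b.
Proof.
move=> Na Nb; rewrite -[a - b]addrC -scaleN1r (rtrepDZ rk _ Nb Na) scaleN1r.
exact: addrC.
Qed.

Lemma rep_sum n m I (r : seq I) (F : I -> L n m) : (forall i, N n m (F i)) ->
  kappa n m (\sum_(i <- r) F i) = \sum_(i <- r) kappa n m (F i).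
Proof.
move=> NF; elim: r => [|i r IHr]; first by rewrite !big_nil rep0.
by rewrite !big_cons repD ?IHr //; apply: lin_subspace_sum.
Qed.

Lemma rep_comp n m p (a : L n m) (b : L m p) : N n m a -> N m p b ->
  ca_mul (kappa n m a) (kappa m p b) = kappa n p (a ** b).
Proof. by move=> Na Nb; exact: (rtrepM rk (k := 0) Na Nb). Qed.

Lemma rep_functor : @star_functor R L (const_cat E) N id kappa.
Proof.
split.
- by move=> *; apply: (rtrepDZ rk).
- by move=> * /=; rewrite -rep_comp.
- by move=> * /=; rewrite -(rtrepS rk).
Qed.

Lemma rep_contractive n m (a : L n m) : N n m a -> rnorm (kappa n m a) <= rnorm a.
Proof.
exact: (star_functor_contractive iN (@ideal_star _ _ _ iN) rep_functor).
Qed.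

Definition homogeneous (k : int) (x : E) : Prop :=
  exists n m (a : L n m), [/\ N n m a, n%:Z - m%:Z = k & x = kappa n m a].

(** The clause [DR_circle] in isolation, since it is also needed for the images of [iota] in
    quotients of O. *)
Definition circle_isometric : Prop := forall z, circle z ->
  forall (k : nat) (a : forall n m, L n m), (forall n m, N n m (a n m)) ->
    `|\sum_(n < k) \sum_(m < k) z ^ (n%:Z - m%:Z) *: kappa n m (a n m)| =
      `|\sum_(n < k) \sum_(m < k) kappa n m (a n m)|.

Hypothesis (circ : circle_isometric).

(** Several of the x i may come from the same entry; [a] collects them by position, which brings an
    arbitrary finite family to the form required by [circle_isometric]. *)
Lemma circle_homogeneous q (k : 'I_q -> int) (x : 'I_q -> E) :
  (forall i, homogeneous (k i) (x i)) -> forall z, circle z ->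
  rnorm (\sum_i z ^ k i *: x i) = rnorm (\sum_i x i).
Proof.
move=> hx z z1.
have /boolp.choice[t ht] i : exists t : {p : nat * nat & L p.1 p.2},
    [/\ N _ _ (tagged t), (tag t).1%:Z - (tag t).2%:Z = k i
      & x i = kappa _ _ (tagged t)].
  by have [n [m [a ha]]] := hx i; exists (Tagged (fun p => L p.1 p.2) (a : L (n, m).1 (n, m).2)).
pose K := (\max_(i < q) maxn (tag (t i)).1 (tag (t i)).2).+1.
pose a n m := \sum_(i < q) single (tagged (t i)) n m.
have Ns i n m : N n m (single (tagged (t i)) n m).
  by apply: single_mem; [move=> ? ?; exact: (lN _ _).1|case: (ht i)].
have Na n m : N n m (a n m) by apply: lin_subspace_sum.
(* For a general weight f, to be used with both z^k and the constant 1. *)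
have e (f : int -> C) : \sum_(n < K) \sum_(m < K) f (n%:Z - m%:Z) *: kappa n m (a n m) =
    \sum_i f (k i) *: x i.
  transitivity (\sum_(i < q) \sum_(n < K) \sum_(m < K)
      f (n%:Z - m%:Z) *: kappa n m (single (tagged (t i)) n m)).
    rewrite [RHS]exchange_big /=; apply: eq_bigr => n _; rewrite [RHS]exchange_big /=.
    by apply: eq_bigr => m _; rewrite rep_sum // scaler_sumr.
  apply: eq_bigr => i _; have [_ ki ->] := ht i.
  have tK : (maxn (tag (t i)).1 (tag (t i)).2 < K)%N by rewrite ltnS leq_bigmax.
  have n_lt : ((tag (t i)).1 < K)%N by apply: leq_ltn_trans tK; apply: leq_maxl.
  have m_lt : ((tag (t i)).2 < K)%N by apply: leq_ltn_trans tK; apply: leq_maxr.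
  rewrite (bigD1 (Ordinal n_lt)) //= (bigD1 (Ordinal m_lt)) //= single_diag ki.
  rewrite !big1 ?addr0 // => j /eqP jne; first rewrite big1 // => j' _.
    by rewrite single_off ?rep0 ?scaler0 // => -[e1 _]; apply: jne; apply/val_inj.
  by rewrite single_off ?rep0 ?scaler0 // => -[e1]; apply: jne; apply/val_inj.
have := circ z1 K Na; rewrite (e (fun j => z ^ j)) => h1.
have h2 : \sum_(n < K) \sum_(m < K) kappa n m (a n m) = \sum_i x i.
  have := e (fun=> 1); under [X in _ = X -> _]eq_bigr do rewrite scale1r.
  by move=> <-; apply: eq_bigr => n _; apply: eq_bigr => m _; rewrite scale1r.
by rewrite /rnorm h1 h2.
Qed.

(* Fourier coefficients are averages over the roots of unity of a large order. *)
Lemma component_bound q (k : 'I_q -> int) (x : 'I_q -> E) K :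
  (forall i, homogeneous (k i) (x i)) ->
  rnorm (\sum_(i | k i == K) x i) <= rnorm (\sum_i x i).
Proof.
(* As the order exceeds every |k i - K|, averaging annihilates all terms whose degree is not K. *)
move=> hx; pose M := (\max_(i < q) `|k i - K|%N).+1.
have kM i : (`|k i - K| < M)%N by rewrite ltnS (leq_bigmax i).
have M0 : (0 < M)%N by [].
have [w pw] := complex_prim_root R M0.
have w1 := prim_root_circle M0 pw; have w0 := circle_unit w1.
have avg : \sum_(j < M) (w ^ (- K)) ^+ j *: \sum_i (w ^+ j) ^ k i *: x i =
    M%:R *: \sum_(i | k i == K) x i.
  transitivity (\sum_i (\sum_(j < M) (w ^ (k i - K)) ^+ j) *: x i).
    under eq_bigr do rewrite scaler_sumr; rewrite exchange_big /=.
    apply: eq_bigr => i _; rewrite scaler_suml; apply: eq_bigr => j _.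
    rewrite scalerA; congr (_ *: _).
    by rewrite !exprnP !exprz_exp -exprzDr ?unitfE //; congr (_ ^ _); ring.
  rewrite scaler_sumr (bigID (fun i => k i == K)) /= addrC big1 ?add0r.
    apply: eq_bigr => i /eqP ->; rewrite subrr expr0z.
    by under eq_bigr do rewrite expr1n; rewrite sumr_const card_ord.
  by move=> i kK; rewrite (prim_root_sum pw) ?scale0r ?subr_eq0.
have cM : cabs (M%:R : C) = M%:R.
  by rewrite -(rmorph_nat (real_complex R)) cabs_real.
have M0' : 0 < M%:R :> R by rewrite ltr0n.
rewrite -(ler_pM2l M0') -cM -rnormZ -avg; apply: le_trans (rnorm_sum _ _ _) _.
rewrite cM mulr_natl -[leRHS](_ : \sum_(j < M) rnorm (\sum_i x i) = _); last first.
  by rewrite sumr_const card_ord.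
apply: ler_sum => j _; rewrite rnormZ circle_homogeneous //.
  have /circleE : circle ((w ^ (- K)) ^+ j) by rewrite exprnP; do 2!apply: circle_exprz.
  by move=> ->; rewrite mul1r.
by rewrite exprnP; apply: circle_exprz.
Qed.

End OneRepresentation.
End GradedRepresentations.

(** If u > v, Bernoulli's inequality makes (u / v)^(2^j) grow at least linearly in 2^j; its square
    then grows quadratically and outruns the linear factor. *)
Lemma power_growth (R : realType) (u v A : R) : 0 <= u -> 0 <= v ->
  (forall j, u ^+ (2 ^ j.+1) <= A * (2 ^ j.+1)%:R * v ^+ (2 ^ j.+1)) -> u <= v.
Proof.
move=> u0 v0 h; rewrite leNgt; apply/negP => vu.
have up : 0 < u := le_lt_trans v0 vu.
have A0 : 0 <= A.
  rewrite leNgt; apply/negP => A0; have := h 0%N.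
  rewrite leNgt => /negP; apply; apply: le_lt_trans (_ : 0 < _); last by rewrite exprn_gt0.
  by rewrite mulr_le0_ge0 ?exprn_ge0 // mulr_le0_ge0 ?ler0n // ltW.
have [v00|vn0] := eqVneq v 0.
  by have := h 0%N; rewrite v00 expr0n mulr0 leNgt exprn_gt0.
have vp : 0 < v by rewrite lt_neqAle eq_sym vn0.
pose e := u / v - 1.
have e0 : 0 < e by rewrite subr_gt0 ltr_pdivlMr // mul1r.
have bern k : 1 + k%:R * e <= (u / v) ^+ k.
  have -> : u / v = 1 + e by rewrite /e addrC subrK.
  elim: k => [|k IHk]; first by rewrite mul0r addr0 expr0.
  have k0 : 0 <= k%:R * e * e by rewrite !mulr_ge0 ?ler0n // ltW.
  rewrite exprS -natr1; apply: le_trans (ler_wpM2l _ IHk); lra.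
(* With P = 2^n the comparison reads P^2 e^2 <= 2 A P, which fails once P > 2 A / e^2. *)
have [n _ hn] := exists_large_nat (2 * A / e ^+ 2).
have := h n; rewrite -ler_pdivrMr ?exprn_gt0 // -expr_div_n.
set P : R := (2 ^ n)%:R => hP.
have P0 : 0 < P by rewrite ltr0n expn_gt0.
have nP : n%:R <= P by rewrite ler_nat ltnW // ltn_expl.
have h2 : (1 + P * e) ^+ 2 <= (u / v) ^+ (2 ^ n.+1).
  rewrite expnSr exprM ler_pXn2r ?nnegrE ?exprn_ge0 ?divr_ge0 //; first exact: bern.
  by rewrite addr_ge0 // mulr_ge0 // ltW.
have h3 : P * (P * e ^+ 2) <= P * (2 * A).
  rewrite (_ : P * (2 * A) = A * (2 ^ n.+1)%:R); last by rewrite expnS natrM -/P; ring.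
  apply: le_trans hP; apply: le_trans h2.
  have : 0 <= P * e by rewrite mulr_ge0 // ltW.
  rewrite (_ : (1 + P * e) ^+ 2 = 1 + 2 * (P * e) + P * (P * e ^+ 2)); [lra | ring].
rewrite ler_pM2l // in h3.
have := lt_le_trans hn nP; rewrite ltr_pdivrMr ?exprn_gt0 //; lra.
Qed.

(** * Pairs of coisometric representations and their graph *)

Section GraphOfRepresentations.
Variables (R : realType) (L : rt_precategory R) (N : hom_family L).
Hypothesis (iN : is_ideal N) (tN : tens_invariant N).
Arguments N : clear implicits.
Variables (E B : cstar_algebra R).
Variables (kappa : forall n m, L n m -> E) (pi : forall n m, L n m -> B).
Hypothesis (rk : is_rtrep N kappa) (ck : coisometric_on N kappa).
Hypothesis (rp : is_rtrep N pi) (cp : coisometric_on N pi).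
Arguments kappa : clear implicits.
Arguments pi : clear implicits.
Local Notation C := R[i].

Let lN n m : lin_subspace (N n m). Proof. exact: (ideal_subspace iN). Qed.

(** A relation and not a map, because nothing shows yet that [pi] vanishes where [kappa] does. *)
Definition bihom (k : int) (x : E) (y : B) : Prop :=
  exists n m (a : L n m), [/\ N n m a, n%:Z - m%:Z = k, x = kappa n m a & y = pi n m a].

(** Coisometry lets a pair be tensored up without changing it, so pairs of equal degree can be
    represented in a common hom space and added there. *)
Lemma bihom_raise n m x y : bihom (n%:Z - m%:Z) x y -> exists s0, forall s, (s0 <= s)%N ->
  exists a : L (s + n)%N (s + m)%N, [/\ N _ _ a, x = kappa _ _ a & y = pi _ _ a].
Proof.
move=> [n' [m' [a [Na e -> ->]]]]; exists m' => s sm.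
(* The bound m' <= s keeps the truncated subtraction exact, and equality of degrees then makes both
   indices agree. *)
pose t := (s - m' + m)%N.
have e1 : (t + n' = s + n)%N by rewrite /t; lia.
have e2 : (t + m' = s + m)%N by rewrite /t; lia.
rewrite -e1 -e2; exists (tens t a); split; first exact: tens_mem.
- by rewrite (rep_tens tN ck).
- by rewrite (rep_tens tN cp).
Qed.

Lemma bihom0 k : bihom k 0 0.
Proof.
have [n [m <-]] : exists n m, n%:Z - m%:Z = k.
  by exists `|Num.max k 0|%N, `|Num.max (- k) 0|%N; lia.
by exists n, m, 0; rewrite !(rep0 iN) //; split => //; exact: (lN _ _).1.
Qed.

Lemma bihomDZ k c x y x' y' : bihom k x y -> bihom k x' y' ->
  bihom k (c *: x + x') (c *: y + y').
Proof.
move=> [n [m [a [Na e -> ->]]]]; rewrite -e => /bihom_raise[s /(_ s (leqnn _))].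
move=> [b [Nb -> ->]]; have Nt := tens_mem tN s Na.
exists (s + n)%N, (s + m)%N, (c *: tens s a + b); split; first exact: (lN _ _).2.
- by lia.
- by rewrite (rtrepDZ rk) // (rep_tens tN ck).
- by rewrite (rtrepDZ rp) // (rep_tens tN cp).
Qed.

(** To compose elements of (n, m) and (p, q), the first is tensored p times and the second m times;
    the middle objects p + m and m + p agree only up to commutativity. *)
Lemma bihomM k l x y x' y' : bihom k x y -> bihom l x' y' ->
  bihom (k + l) (ca_mul x x') (ca_mul y y').
Proof.
move=> [n [m [a [Na <- -> ->]]]] [p [q [b [Nb <- -> ->]]]].
have Na' := tens_mem tN p Na; have Nb' := tens_mem tN m Nb.
rewrite -(rep_tens tN ck p Na) -(rep_tens tN cp p Na).
rewrite -(rep_tens tN ck m Nb) -(rep_tens tN cp m Nb).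
move: (tens p a) (tens m b) Na' Nb' => {Na Nb} {}a {}b Na Nb.
have e : (m + p = p + m)%N by rewrite addnC.
move: b Nb; rewrite e => b Nb.
exists (p + n)%N, (m + q)%N, (a ** b); split; first exact: (ideal_compl iN).
- by lia.
- by rewrite (rep_comp rk).
- by rewrite (rep_comp rp).
Qed.

Lemma bihomS k x y : bihom k x y -> bihom (- k) (ca_star x) (ca_star y).
Proof.
move=> [n [m [a [Na <- -> ->]]]]; exists m, n, a^s; split.
- exact: (ideal_star iN).
- by lia.
- exact: (rtrepS rk).
- exact: (rtrepS rp).
Qed.

(** Degrees from -d to d, shifted to start at 0. Their number 2 d + 1 is the linear factor that the
    passage to powers has to beat. *)
Definition bideg (d : nat) (x : E) (y : B) : Prop :=
  exists p : nat -> E * B, [/\ forall i, bihom (i%:Z - d%:Z) (p i).1 (p i).2,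
    x = \sum_(i < (2 * d).+1) (p i).1 & y = \sum_(i < (2 * d).+1) (p i).2].

Lemma bidegDZ d c x y x' y' : bideg d x y -> bideg d x' y' ->
  bideg d (c *: x + x') (c *: y + y').
Proof.
move=> [p [hp -> ->]] [p' [hp' -> ->]].
exists (fun i => (c *: (p i).1 + (p' i).1, c *: (p i).2 + (p' i).2)); split => /=.
- by move=> i; apply: bihomDZ.
- by rewrite big_split /= scaler_sumr.
- by rewrite big_split /= scaler_sumr.
Qed.

Lemma bideg_bihom d k x y : (`|k| <= d)%N -> bihom k x y -> bideg d x y.
Proof.
move=> kd h; pose j := absz (k + d%:Z); have ej : j%:Z = k + d%:Z by lia.
have jlt : (j < (2 * d).+1)%N by lia.
exists (fun i => if i == j then (x, y) else (0, 0)); split.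
- move=> i; case: eqP => [->|_] /=; last exact: bihom0.
  by rewrite ej addrK.
- rewrite (bigD1 (Ordinal jlt)) //= eqxx big1 ?addr0 // => i.
  by rewrite -val_eqE /= => /negbTE ->.
- rewrite (bigD1 (Ordinal jlt)) //= eqxx big1 ?addr0 // => i.
  by rewrite -val_eqE /= => /negbTE ->.
Qed.

Lemma bideg0 d : bideg d 0 0.
Proof. by apply: (@bideg_bihom d 0) => //; apply: bihom0. Qed.

Lemma bideg_sum d I (r : seq I) (F : I -> E) (G : I -> B) :
  (forall i, bideg d (F i) (G i)) -> bideg d (\sum_(i <- r) F i) (\sum_(i <- r) G i).
Proof.
move=> h; elim/big_rec2: _ => [|i x y _ IH]; first exact: bideg0.
by have := bidegDZ 1 (h i) IH; rewrite !scale1r.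
Qed.

Lemma ca_mul_sum (D : cstar_algebra R) q r (F : 'I_q -> D) (G : 'I_r -> D) :
  ca_mul (\sum_i F i) (\sum_j G j) = \sum_i \sum_j ca_mul (F i) (G j).
Proof.
rewrite (big_morph (fun z => ca_mul z _) (fun a b => ca_mulDl a b _) (ca_mul0l _)).
apply: eq_bigr => i _.
exact: (big_morph (fun z => ca_mul _ z) (fun a b => ca_mulDr _ a b) (ca_mul0r _)).
Qed.

Lemma bidegM d d' x y x' y' : bideg d x y -> bideg d' x' y' ->
  bideg (d + d') (ca_mul x x') (ca_mul y y').
Proof.
move=> [p [hp -> ->]] [p' [hp' -> ->]]; rewrite !ca_mul_sum.
apply: bideg_sum => i; apply: bideg_sum => j.
apply: bideg_bihom; last by apply: bihomM; [exact: hp|exact: hp'].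
by have := ltn_ord i; have := ltn_ord j; lia.
Qed.

Lemma bidegS d x y : bideg d x y -> bideg d (ca_star x) (ca_star y).
Proof.
move=> [p [hp -> ->]].
have e (D : cstar_algebra R) q (F : 'I_q -> D) :
    ca_star (\sum_i F i) = \sum_i ca_star (F i).
  exact: (big_morph _ (@ca_starD R D) (ca_star0 D)).
rewrite !e; apply: bideg_sum => i; apply: bideg_bihom; last exact: bihomS.
by have := ltn_ord i; lia.
Qed.

Hypothesis (circ : circle_isometric N kappa).
Variable (M : R).
Hypothesis (bound : forall n m (a : L n m), N n m a ->
  rnorm (pi n m a) <= M * rnorm (kappa n m a)).

(** Each component of y is at most |M| times the corresponding component of x, which
    [component_bound] compares with x itself. *)
Lemma bideg_bound d x y : bideg d x y -> rnorm y <= ((2 * d).+1)%:R * (`|M| * rnorm x).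
Proof.
move=> [p [hp -> ->]]; apply: le_trans (rnorm_sum _ _ _) _.
rewrite mulr_natl -[leRHS](_ : \sum_(j < (2 * d).+1) (`|M| * rnorm (\sum_(i < (2 * d).+1) (p i).1)) = _);
  last by rewrite sumr_const card_ord.
apply: ler_sum => j _.
have hh (i : 'I_(2 * d).+1) : homogeneous N kappa (i%:Z - d%:Z) (p i).1.
  by have [n [m [a [Na e h1 h2]]]] := hp i; exists n, m, a.
have := component_bound iN rk circ (j%:Z - d%:Z) hh.
rewrite (big_pred1 j) => [hj|i]; last first.
  by rewrite /= (inj_eq (addIr _)) eqz_nat.
apply: le_trans (ler_wpM2l (normr_ge0 _) hj).
have [n [m [a [Na e -> ->]]]] := hp j.
by apply: le_trans (bound Na) _; rewrite ler_wpM2r ?rnorm_ge0 // ler_norm.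
Qed.

End GraphOfRepresentations.

Section PowerTrick.
Variables (R : realType) (L : rt_precategory R) (N : hom_family L).
Hypothesis (iN : is_ideal N) (tN : tens_invariant N).
Arguments N : clear implicits.
Variables (E B : cstar_algebra R).
Variables (kappa : forall n m, L n m -> E) (pi : forall n m, L n m -> B).
Hypothesis (rk : is_rtrep N kappa) (ck : coisometric_on N kappa).
Hypothesis (rp : is_rtrep N pi) (cp : coisometric_on N pi).
Arguments kappa : clear implicits.
Arguments pi : clear implicits.

Local Notation bideg := (bideg N kappa pi).

Section Bound.
Hypothesis (circ : circle_isometric N kappa).
Variable (M : R).
Hypothesis (bound : forall n m (a : L n m), N n m a ->
  rnorm (pi n m a) <= M * rnorm (kappa n m a)).

(* The powers [(x^* x)^(2^j)] have norm [|x|^(2^(j+1))], while the constant in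
   [bideg_bound] only grows linearly with [2^j]. *)
Lemma bideg_contractive d x y : bideg d x y -> rnorm y <= rnorm x.
Proof.
move=> h.
have pow j : exists X Y, [/\ bideg (2 * d * 2 ^ j) X Y, ca_star X = X, ca_star Y = Y,
    rnorm X = rnorm x ^+ (2 ^ j.+1) & rnorm Y = rnorm y ^+ (2 ^ j.+1)].
  elim: j => [|j [X [Y [hXY Xs Ys nX nY]]]].
    exists (ca_mul (ca_star x) x), (ca_mul (ca_star y) y); split.
    - rewrite expn0 muln1 mul2n -addnn; apply: bidegM => //; exact: bidegS.
    - by rewrite !caE.
    - by rewrite !caE.
    - by rewrite rnorm_ca_cstar expn1.
    - by rewrite rnorm_ca_cstar expn1.
  exists (ca_mul X X), (ca_mul Y Y); split.
  - rewrite expnS mulnCA mul2n -addnn; exact: bidegM.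
  - by rewrite !caE Xs.
  - by rewrite !caE Ys.
  - by rewrite -{1}Xs rnorm_ca_cstar nX -exprM -expnSr.
  - by rewrite -{1}Ys rnorm_ca_cstar nY -exprM -expnSr.
(* The pair X, Y has 4 d 2^j + 1 degrees, at most (4 d + 1) 2^(j+1). *)
apply: (@power_growth R _ _ ((4 * d + 1)%:R * `|M|)); try exact: rnorm_ge0.
move=> j; have [X [Y [hXY _ _ <- <-]]] := pow j.
apply: le_trans (bideg_bound iN rk circ bound hXY) _.
rewrite mulrA ler_wpM2r ?rnorm_ge0 // mulrAC ler_wpM2r // -natrM ler_nat.
have : (0 < 2 ^ j)%N by rewrite expn_gt0.
rewrite expnS; move: (2 ^ j)%N => q q0; nia.
Qed.

End Bound.

Definition graph (x : E) (y : B) : Prop := exists d, bideg d x y.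

Lemma bideg_le d d' x y : (d <= d')%N -> bideg d x y -> bideg d' x y.
Proof.
move=> dd [p [hp -> ->]]; apply: bideg_sum => // i; apply: bideg_bihom => //.
by have := ltn_ord i; lia.
Qed.

Lemma graphDZ c x y x' y' : graph x y -> graph x' y' ->
  graph (c *: x + x') (c *: y + y').
Proof.
move=> [d h] [d' h']; exists (maxn d d').
by apply: bidegDZ => //; [apply: bideg_le h; rewrite leq_maxl|apply: bideg_le h'; rewrite leq_maxr].
Qed.

Lemma graphM x y x' y' : graph x y -> graph x' y' -> graph (ca_mul x x') (ca_mul y y').
Proof. by move=> [d h] [d' h']; exists (d + d')%N; apply: bidegM. Qed.

Lemma graphS x y : graph x y -> graph (ca_star x) (ca_star y).
Proof. by move=> [d h]; exists d; apply: bidegS. Qed.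

Lemma graph_rep n m (a : L n m) : N n m a -> graph (kappa n m a) (pi n m a).
Proof.
move=> Na; exists `|n%:Z - m%:Z|%N; apply: bideg_bihom => //.
by exists n, m, a.
Qed.

Lemma graph0 : graph 0 0.
Proof. by exists 0%N; apply: bideg0. Qed.

Lemma lin_subspace_fst : lin_subspace [set x | exists y, graph x y].
Proof.
split; first by exists 0; exact: graph0.
by move=> c x x' [y h] [y' h']; exists (c *: y + y'); apply: graphDZ.
Qed.

Lemma closed_span_approx (V : normedModType R[i]) (A S : set V) : lin_subspace S ->
  A `<=` S -> forall x, closed_span A x ->
  forall e : R, 0 < e -> exists2 y, S y & rnorm (x - y) < e.
Proof.
move=> Sl AS x /closureP h e /h[y hy yx]; exists y => //.
exact: (smallest_sub Sl AS).
Qed.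

Lemma graph_fst_dense x : closed_span (rep_image N kappa) x -> forall e : R, 0 < e ->
  exists x' y', graph x' y' /\ rnorm (x - x') < e.
Proof.
move=> hx e e0.
have [|x' [y' h] hx'] := closed_span_approx lin_subspace_fst _ hx e0.
  by move=> _ [n [m [a [Na ->]]]]; exists (pi n m a); apply: graph_rep.
by exists x', y'.
Qed.

Lemma graph_span x y : graph x y -> closed_span (rep_image N pi) y.
Proof.
move=> [d [p [hp _ ->]]]; apply: subset_closure => S [Sl hS].
apply: (lin_subspace_sum Sl) => i _; apply: hS.
by have [n [m [a [Na _ _ ->]]]] := hp i; exists n, m, a.
Qed.

(** The extension is built as a relation: contractivity makes it single-valued, density and
    completeness make it total. No map on the dense subalgebra has to be chosen. *)
Definition closed_graph (x : E) (y : B) : Prop := exists (u : nat -> E) (v : nat -> B),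
  [/\ forall n, graph (u n) (v n), rlim u x & rlim v y].

Lemma rlim_mul (D : cstar_algebra R) (u v : nat -> D) x y : rlim u x -> rlim v y ->
  rlim (fun n => ca_mul (u n) (v n)) (ca_mul x y).
Proof.
move=> hu hv.
have h1 : rlim (fun n => ca_mul (u n - x) (v n)) 0.
  move=> e e0; have y1 : 0 < rnorm y + 1 by rewrite ltr_wpDl ?rnorm_ge0.
  have [n1 h1] := hu _ (divr_gt0 e0 y1); have [n2 h2] := hv _ (ltr01).
  exists (maxn n1 n2) => n; rewrite geq_max => /andP[/h1 hun /h2 hvn].
  rewrite subr0; apply: le_lt_trans (rnorm_mul _ _) _.
  rewrite ltr_pdivlMr // in hun; apply: le_lt_trans hun.
  apply: ler_wpM2l; first exact: rnorm_ge0.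
  by have := rnormD (v n - y) y; rewrite subrK; lra.
have h2 : rlim (fun n => ca_mul x (v n)) (ca_mul x y).
  exact: (@rlim_compr R (const_cat D) 0 0 0).
have := rlimD h1 h2; rewrite add0r; congr (rlim _ _); apply: funext => n.
by rewrite -ca_mulDl subrK.
Qed.

Lemma closed_graphDZ c x y x' y' : closed_graph x y -> closed_graph x' y' ->
  closed_graph (c *: x + x') (c *: y + y').
Proof.
move=> [u [v [h hu hv]]] [u' [v' [h' hu' hv']]].
exists (fun n => c *: u n + u' n), (fun n => c *: v n + v' n); split.
- by move=> n; apply: graphDZ.
- by apply: rlimD => //; apply: rlimZ.
- by apply: rlimD => //; apply: rlimZ.
Qed.

Lemma closed_graphM x y x' y' : closed_graph x y -> closed_graph x' y' ->
  closed_graph (ca_mul x x') (ca_mul y y').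
Proof.
move=> [u [v [h hu hv]]] [u' [v' [h' hu' hv']]].
exists (fun n => ca_mul (u n) (u' n)), (fun n => ca_mul (v n) (v' n)); split.
- by move=> n; apply: graphM.
- exact: rlim_mul.
- exact: rlim_mul.
Qed.

Lemma closed_graphS x y : closed_graph x y -> closed_graph (ca_star x) (ca_star y).
Proof.
move=> [u [v [h hu hv]]]; exists (fun n => ca_star (u n)), (fun n => ca_star (v n)); split.
- by move=> n; apply: graphS.
- exact: (@rlim_star R (const_cat E) 0 0).
- exact: (@rlim_star R (const_cat B) 0 0).
Qed.

Lemma closed_graph_sub x y : graph x y -> closed_graph x y.
Proof. by move=> h; exists (fun=> x), (fun=> y); split => //; apply: rlim_cst. Qed.

Lemma rlim_norm_le (V W : normedModType R[i]) (u : nat -> V) (v : nat -> W) x y :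
  rlim u x -> rlim v y -> (forall n, rnorm (v n) <= rnorm (u n)) -> rnorm y <= rnorm x.
Proof.
move=> hu hv h; apply/ler_addgt0Pr => e e0; have e2 : 0 < e / 2 by rewrite divr_gt0.
have [n1 h1] := hu _ e2; have [n2 h2] := hv _ e2; pose n := maxn n1 n2.
have := h1 n (leq_maxl _ _); have := h2 n (leq_maxr _ _); have := h n.
have := rnormD (y - v n) (v n); rewrite subrK (rnormB y).
have := rnormD (u n - x) x; rewrite subrK; lra.
Qed.

Section Extension.
Hypothesis (contr : forall x y, graph x y -> rnorm y <= rnorm x).

Lemma closed_graph_contr x y : closed_graph x y -> rnorm y <= rnorm x.
Proof. by move=> [u [v [h hu hv]]]; apply: rlim_norm_le hu hv _ => n; apply: contr. Qed.

Lemma closed_graph_functional x y y' : closed_graph x y -> closed_graph x y' -> y = y'.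
Proof.
move=> h h'; have := closed_graphDZ (-1) h' h; rewrite !scaleN1r addNr.
move=> /closed_graph_contr; rewrite rnorm0 addrC => h0.
apply/eqP; rewrite -subr_eq0; apply/eqP/rnorm_eq0/le_anti.
by rewrite h0 rnorm_ge0.
Qed.

Lemma closed_graph_total x : closed_span (rep_image N kappa) x ->
  exists y, closed_graph x y.
Proof.
move=> hx.
have p0 k : 0 < 2^-1 ^+ k :> R by rewrite exprn_gt0 // invr_gt0.
have /boolp.choice[uv huv] k : exists p : E * B, graph p.1 p.2 /\ rnorm (x - p.1) < 2^-1 ^+ k.
  by have [x' [y' h]] := graph_fst_dense hx (p0 k); exists (x', y').
have ul : rlim (fun k => (uv k).1) x.
  move=> e e0; have [|||k hk] := @exists_small_expr R 1 2^-1 e; rewrite ?invr_ge0 //.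
    by rewrite invf_lt1 // ltr1n.
  exists k => n kn; rewrite rnormB; apply: lt_trans (huv n).2 _.
  apply: le_lt_trans hk; rewrite mul1r.
  by apply: ler_wiXn2l; rewrite ?invr_ge0 // invf_le1 // ler1n.
have [e e0|y vl] := @rlim_complete R B (fun k => (uv k).2).
  have e2 : 0 < e / 2 by rewrite divr_gt0.
  have [n0 hn0] := ul _ e2; exists n0 => n m /hn0 hn /hn0 hm.
  have hg := graphDZ (-1) (huv m).1 (huv n).1; rewrite !scaleN1r ![- _ + _]addrC in hg.
  apply: le_lt_trans (contr hg) _.
  by have := rnorm_dist (uv n).1 x (uv m).1; rewrite (rnormB x); lra.
by exists y, (fun k => (uv k).1), (fun k => (uv k).2); split => // n; case: (huv n).
Qed.

Lemma exists_extension : closed_span (rep_image N kappa) = setT ->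
  exists Psi : E -> B, [/\ star_hom Psi,
  forall x, closed_graph x (Psi x) & forall n m (a : L n m), N n m a ->
    Psi (kappa n m a) = pi n m a].
Proof.
move=> dense.
have /boolp.choice[Psi hPsi] x : exists y, closed_graph x y.
  by apply: closed_graph_total; rewrite dense.
exists Psi; split => //.
  split=> *.
  - by apply: closed_graph_functional (hPsi _) _; apply: closed_graphDZ.
  - by apply: closed_graph_functional (hPsi _) _; apply: closed_graphM.
  - by apply: closed_graph_functional (hPsi _) _; apply: closed_graphS.
move=> n m a Na; apply: closed_graph_functional (hPsi _) _.
by apply: closed_graph_sub; apply: graph_rep.
Qed.

End Extension.
End PowerTrick.

(** * Integration of coisometric representations *)

Section Integration.
Variables (R : realType) (L : rt_precategory R) (N : hom_family L).
Hypothesis (iN : is_ideal N) (tN : tens_invariant N).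
Arguments N : clear implicits.
Variables (E B : cstar_algebra R).
Variables (kappa : forall n m, L n m -> E) (pi : forall n m, L n m -> B).
Arguments kappa : clear implicits.
Arguments pi : clear implicits.
Hypothesis (hk : is_DR N kappa).

Lemma DR_norm_small n m (a : L n m) (e : R) : N n m a -> rnorm (kappa n m a) < e ->
  exists s, rnorm (tens s a) < e.
Proof.
move=> Na ae; have d0 : 0 < e - rnorm (kappa n m a) by rewrite subr_gt0.
have /cvgrPdist_lt/(_ _ d0)[s _ /(_ s (leqnn s))] := DR_norm hk Na.
rewrite /= => hs; exists s; have := ler_norm (rnorm (tens s a) - rnorm (kappa n m a)).
rewrite distrC; lra.
Qed.

Lemma DR_norm_le n m (a : L n m) (r : R) : N n m a -> (forall s, r <= rnorm (tens s a)) ->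
  r <= rnorm (kappa n m a).
Proof.
move=> Na h; rewrite leNgt; apply/negP => /(DR_norm_small Na)[s].
by rewrite ltNge h.
Qed.

Section Representation.
Hypothesis (rp : is_rtrep N pi) (cp : coisometric_on N pi).

(** By coisometry [pi] takes the same value at every [tens s a], so it is bounded by each of their
    norms and hence by the limit. *)
Lemma rep_le_DR n m (a : L n m) : N n m a -> rnorm (pi n m a) <= rnorm (kappa n m a).
Proof.
move=> Na; apply: DR_norm_le => // s; rewrite -(rep_tens tN cp s Na).
by apply: (rep_contractive iN rp); apply: tens_mem.
Qed.

Lemma integration : exists Psi : E -> B, [/\ star_hom Psi,
  forall x, closed_graph N kappa pi x (Psi x),
  (forall n m (a : L n m), N n m a -> Psi (kappa n m a) = pi n m a) &
  forall x, rnorm (Psi x) <= rnorm x].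
Proof.
have contr x y : graph N kappa pi x y -> rnorm y <= rnorm x.
  move=> [d]; apply: (@bideg_contractive _ _ _ iN tN _ _ _ _ (DR_rep hk)
    (DR_coisometric hk) rp cp (DR_circle hk) 1).
  by move=> n m a Na; rewrite mul1r; apply: rep_le_DR.
have [Psi [h1 h2 h3]] := exists_extension iN tN (DR_rep hk) (DR_coisometric hk) rp cp contr
  (DR_dense hk).
by exists Psi; split => // x; apply: (closed_graph_contr contr (h2 x)).
Qed.

End Representation.
End Integration.

(** * Gauge invariant ideals *)

Section StarHomomorphisms.
Variables (R : realType).

Lemma star_hom_contractive (A B : cstar_algebra R) (f : A -> B) : star_hom f ->
  forall x, rnorm (f x) <= rnorm x.
Proof.
move=> hf x; have sf : @star_functor R (const_cat A) (const_cat B) (fam_full _) id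
    (fun _ _ => f).
  by split=> *; [apply: (star_homDZ hf)|apply: (star_homM hf)|apply: (star_homS hf)].
exact: (functor_contractive sf (n := 0) (m := 0)).
Qed.

Lemma star_homB (A B : cstar_algebra R) (f : A -> B) : star_hom f ->
  forall x y, f (x - y) = f x - f y.
Proof. by move=> hf x y; rewrite addrC -scaleN1r (star_homDZ hf) scaleN1r addrC. Qed.

Lemma star_hom0 (A B : cstar_algebra R) (f : A -> B) : star_hom f -> f 0 = 0.
Proof. by move=> hf; rewrite -(subrr 0) (star_homB hf) subrr. Qed.

Lemma star_homZ (A B : cstar_algebra R) (f : A -> B) : star_hom f ->
  forall c x, f (c *: x) = c *: f x.
Proof. by move=> hf c x; rewrite -[c *: x]addr0 (star_homDZ hf) (star_hom0 hf) addr0. Qed.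

Lemma star_homD (A B : cstar_algebra R) (f : A -> B) : star_hom f ->
  forall x y, f (x + y) = f x + f y.
Proof. by move=> hf x y; rewrite -[x]scale1r (star_homDZ hf) !scale1r. Qed.

Lemma star_hom_sum (A B : cstar_algebra R) (f : A -> B) : star_hom f ->
  forall I (r : seq I) (F : I -> A), f (\sum_(i <- r) F i) = \sum_(i <- r) f (F i).
Proof. by move=> hf I r F; apply: (big_morph f (star_homD hf) (star_hom0 hf)). Qed.

Lemma star_hom_comp (A B D : cstar_algebra R) (f : A -> B) (g : B -> D) :
  star_hom f -> star_hom g -> star_hom (g \o f).
Proof.
by move=> [f1 f2 f3] [g1 g2 g3]; split=> * /=; rewrite ?f1 ?f2 ?f3 ?g1 ?g2 ?g3.
Qed.

Lemma star_hom_eq (A B : cstar_algebra R) (S : set A) (f g : A -> B) :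
  closed_span S = setT -> star_hom f -> star_hom g -> (forall x, S x -> f x = g x) ->
  f = g.
Proof.
move=> dS hf hg fg; apply: funext => x.
apply/eqP; rewrite -subr_eq0; apply/eqP/rnorm_eq0/le_anti.
rewrite rnorm_ge0 andbT; apply/ler_addgt0Pr => e e0; rewrite add0r.
have e2 : 0 < e / 2 by rewrite divr_gt0.
have Sl : lin_subspace [set y | f y = g y].
  split; first by rewrite /= (star_hom0 hf) (star_hom0 hg).
  by move=> c y z /= hy hz; rewrite (star_homDZ hf) (star_homDZ hg) hy hz.
have [|y /= hy xy] := closed_span_approx Sl fg (x := x) _ e2; first by rewrite dS.
have -> : f x - g x = f (x - y) - g (x - y).
  by rewrite (star_homB hf) (star_homB hg) hy; lmod R.
apply: le_trans (rnormD _ _) _; rewrite rnormN.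
have := star_hom_contractive hf (x - y); have := star_hom_contractive hg (x - y); lra.
Qed.

Lemma alg_ker_ideal (A B : cstar_algebra R) (f : A -> B) : star_hom f ->
  is_alg_ideal (alg_ker f).
Proof.
move=> hf; split.
- split; first exact: star_hom0.
  by move=> c x y /= hx hy; rewrite /alg_ker /= (star_homDZ hf) hx hy scaler0 addr0.
- apply: closed_of_approx => x hx; apply: rnorm_eq0; apply/le_anti; rewrite rnorm_ge0 andbT.
  apply/ler_addgt0Pr => e /hx[y fy xy]; rewrite add0r.
  have -> : f x = f (x - y) by rewrite (star_homB hf) fy subr0.
  by apply: le_trans (star_hom_contractive hf _) (ltW xy).
- by move=> a b hb; rewrite /alg_ker /= (star_homM hf) hb ca_mul0r.
- by move=> a b ha; rewrite /alg_ker /= (star_homM hf) ha ca_mul0l.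
Qed.

End StarHomomorphisms.

Section Tensoring.
Variables (R : realType) (L : rt_precategory R).

Lemma tensDZ k n m c (a b : L n m) : tens k (c *: a + b) = c *: tens k a + tens k b.
Proof. by elim: k => [|k IHk] //=; rewrite IHk tens1DZ. Qed.
Lemma tensM k n m l (a : L n m) (b : L m l) : tens k (a ** b) = tens k a ** tens k b.
Proof. by elim: k => [|k IHk] //=; rewrite IHk tens1M. Qed.
Lemma tensS k n m (a : L n m) : tens k a^s = (tens k a)^s.
Proof. by elim: k => [|k IHk] //=; rewrite IHk tens1S. Qed.
Lemma tensB k n m (a b : L n m) : tens k (a - b) = tens k a - tens k b.
Proof. by rewrite addrC -scaleN1r tensDZ scaleN1r addrC. Qed.

(** Two tensorings in succession, as needed later: s reaches a common hom space, t brings the norm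
    near its limit. The index t + (s + n) avoids a transport along associativity. *)
Lemma tens_functor s t : @star_functor R L L (fam_full L) (fun n => t + (s + n))%N
  (fun n m a => tens t (tens s a)).
Proof. by split=> *; rewrite ?tensDZ ?tensM ?tensS. Qed.

Lemma tens_reflect (N : hom_family L) k n m (a : L n m) : tens_saturated N ->
  N (k + n)%N (k + m)%N (tens k a) -> N n m a.
Proof. by move=> sN; elim: k => [|k IHk] //= /sN. Qed.

Lemma full_invariant : tens_invariant (fam_full L).
Proof. by []. Qed.

End Tensoring.

Section GaugeIdeals.
Variables (R : realType) (L : rt_precategory R) (O : cstar_algebra R).
Variables (iota : forall n m, L n m -> O).
Arguments iota : clear implicits.
Hypothesis (hiota : is_DR (fam_full L) iota).
Local Notation C := R[i].
Local Notation full := (fam_full L).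

Let ri := DR_rep hiota.
Let ci := DR_coisometric hiota.
Let full_i : is_ideal full := full_ideal L.

Let iotaDZ n m c a b : iota n m (c *: a + b) = c *: iota n m a + iota n m b.
Proof. exact: (rtrepDZ ri). Qed.
Let iotaB n m a b : iota n m (a - b) = iota n m a - iota n m b.
Proof. by rewrite (repB ri). Qed.
Let iotaM n m l (a : L n m) (b : L m l) :
  iota n l (a ** b) = ca_mul (iota n m a) (iota m l b).
Proof. by rewrite (rep_comp ri). Qed.
Let iota_le n m a : rnorm (iota n m a) <= rnorm a.
Proof. exact: (rep_contractive full_i ri). Qed.

(** Invariance and saturation are the two readings of the coisometry equation. *)
Lemma kernel_inv_sat (B : cstar_algebra R) (pi : forall n m, L n m -> B) :
  is_rtrep full pi -> coisometric_on full pi -> inv_sat_ideals L (rep_ker full pi).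
Proof.
move=> rp cp.
have piDZ n m c (a b : L n m) : pi n m (c *: a + b) = c *: pi n m a + pi n m b.
  exact: (rtrepDZ rp).
split.
- split=> n m.
  + split; first by split => //; rewrite (rep0 full_i rp).
    by move=> c a b [_ ha] [_ hb]; split => //; rewrite piDZ ha hb scaler0 addr0.
  + apply: closed_of_approx => a ha; split => //; apply: rnorm_eq0; apply/le_anti.
    rewrite rnorm_ge0 andbT; apply/ler_addgt0Pr => e /ha[b [_ pb] ab]; rewrite add0r.
    have -> : pi n m a = pi n m (a - b) by rewrite (repB rp) // pb subr0.
    exact: le_trans (rep_contractive full_i rp _) (ltW ab).
  + by move=> l a b [_ hb]; split => //; rewrite -(rep_comp rp) // hb ca_mul0r.
  + by move=> l a b [_ hb]; split => //; rewrite -(rep_comp rp) // hb ca_mul0l.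
- by move=> n m a [_ ha]; split => //; rewrite -cp.
- by move=> n m a [_ ha]; split => //; rewrite cp.
Qed.

Lemma iota_inv_inv_sat (P : set O) : is_alg_ideal P -> inv_sat_ideals L (iota_inv iota P).
Proof.
move=> iP; have Pl := alg_ideal_subspace iP; split.
- split=> n m.
  + split; first by rewrite /iota_inv /= (rep0 full_i ri); exact: Pl.1.
    by move=> c a b ha hb; rewrite /iota_inv /= iotaDZ; apply: Pl.2.
  + apply: closed_of_approx => a ha; apply: (closed_approx (alg_ideal_closed iP)) => e /ha[b Pb ab].
    by exists (iota n m b) => //; rewrite -iotaB; apply: le_lt_trans (iota_le _) ab.
  + by move=> l a b hb; rewrite /iota_inv /= iotaM; apply: (alg_ideal_mull iP).
  + by move=> l a b hb; rewrite /iota_inv /= iotaM; apply: (alg_ideal_mulr iP).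
- by move=> n m a ha; rewrite /iota_inv /= -ci.
- by move=> n m a ha; rewrite /iota_inv /= ci.
Qed.

Lemma closed_span_lin (V : normedModType C) (A : set V) : lin_subspace (closed_span A).
Proof.
have Sl : lin_subspace (smallest (@lin_subspace R V) A).
  split; first by move=> S [Sl _]; exact: Sl.1.
  by move=> c x y hx hy S [Sl AS]; apply: Sl.2; [apply: hx|apply: hy].
split; first by apply: subset_closure; exact: Sl.1.
move=> c x y /closureP hx /closureP hy; apply/closureP => e e0.
have e2 : 0 < e / 2 by rewrite divr_gt0.
have c1 : 0 < cabs c + 1 by rewrite ltr_wpDl ?cabs_ge0.
have [x' Sx' hx'] := hx _ (divr_gt0 e2 c1); have [y' Sy' hy'] := hy _ e2.
exists (c *: x' + y'); first exact: Sl.2.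
have -> : c *: x + y - (c *: x' + y') = c *: (x - x') + (y - y') by lmod R.
apply: le_lt_trans (rnormD _ _) _; rewrite rnormZ.
rewrite ltr_pdivlMr // in hx'.
have : cabs c * rnorm (x - x') <= rnorm (x - x') * (cabs c + 1).
  by rewrite mulrDr mulr1 mulrC lerDl rnorm_ge0.
lra.
Qed.

Lemma closed_span_sub (V : normedModType C) (A S : set V) : lin_subspace S -> closed S ->
  A `<=` S -> closed_span A `<=` S.
Proof.
move=> Sl Sc AS x hx; apply: (closed_approx Sc) => e e0.
exact (closed_span_approx Sl AS hx e0).
Qed.

Lemma closed_span_closed (V : normedModType C) (A : set V) : closed (closed_span A).
Proof. exact: closed_closure. Qed.

Lemma closed_span_gen (V : normedModType C) (A : set V) : A `<=` closed_span A.
Proof. by move=> x Ax; apply: subset_closure => S [_]; apply. Qed.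

Lemma O_of_ideal (N : hom_family L) : is_ideal N -> tens_invariant N ->
  is_alg_ideal (O_of iota N).
Proof.
move=> iN tN; have Ol := closed_span_lin (rep_image N iota).
have Oc := @closed_span_closed _ (rep_image N iota).
(* Products of generators only; the passage to closed spans is made below in one variable at a
   time. *)
have step n m p q (a : L n m) (b : L p q) :
    (N n m a \/ N p q b) -> O_of iota N (ca_mul (iota n m a) (iota p q b)).
  move=> h; rewrite -(rep_tens (@full_invariant _ L) ci p (a := a)) //.
  rewrite -(rep_tens (@full_invariant _ L) ci m (a := b)) //.
  have h' : N _ _ (tens p a) \/ N _ _ (tens m b).
    by case: h => h; [left|right]; apply: tens_mem.
  move: (tens p a) (tens m b) h' => {}a {}b {}h.
  have e : (m + p = p + m)%N by rewrite addnC.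
  move: b h; rewrite e => b h; rewrite -iotaM; apply: closed_span_gen.
  exists (p + n)%N, (m + q)%N, (a ** b); split => //.
  by case: h => h; [apply: (ideal_compr iN)|apply: (ideal_compl iN)].
have closedl x : closed [set y | O_of iota N (ca_mul x y)].
  apply: closed_of_approx => y hy; apply: (closed_approx Oc) => e e0.
  have x1 : 0 < rnorm x + 1 by rewrite ltr_wpDl ?rnorm_ge0.
  have [y' Oy' hy'] := hy _ (divr_gt0 e0 x1); exists (ca_mul x y') => //.
  rewrite -ca_mulNr -ca_mulDr; apply: le_lt_trans (rnorm_mul _ _) _.
  rewrite ltr_pdivlMr // in hy'; apply: le_lt_trans hy'.
  by rewrite mulrC ler_wpM2l ?rnorm_ge0 // lerDl.
have closedr y : closed [set x | O_of iota N (ca_mul x y)].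
  apply: closed_of_approx => x hx; apply: (closed_approx Oc) => e e0.
  have y1 : 0 < rnorm y + 1 by rewrite ltr_wpDl ?rnorm_ge0.
  have [x' Ox' hx'] := hx _ (divr_gt0 e0 y1); exists (ca_mul x' y) => //.
  rewrite -ca_mulNl -ca_mulDl; apply: le_lt_trans (rnorm_mul _ _) _.
  rewrite ltr_pdivlMr // in hx'; apply: le_lt_trans hx'.
  by rewrite ler_wpM2l ?rnorm_ge0 // lerDl.
have linl x : lin_subspace [set y | O_of iota N (ca_mul x y)].
  split; first by rewrite /= ca_mul0r; exact: Ol.1.
  by move=> c y z hy hz; rewrite /= ca_mulDr ca_mulZr; apply: Ol.2.
have linr y : lin_subspace [set x | O_of iota N (ca_mul x y)].
  split; first by rewrite /= ca_mul0l; exact: Ol.1.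
  by move=> c x z hx hz; rewrite /= ca_mulDl ca_mulZl; apply: Ol.2.
have total x : closed_span (rep_image full iota) x by rewrite (DR_dense hiota).
split => //.
- move=> x y hy; apply: (closed_span_sub (linr y) (closedr y)) (total x).
  move=> _ [n [m [a [_ ->]]]] /=.
  apply: (closed_span_sub (linl _) (closedl _)) hy => _ [p [q [b [Nb ->]]]] /=.
  by apply: step; right.
- move=> x y hx; apply: (closed_span_sub (linl x) (closedl x)) (total y).
  move=> _ [n [m [a [_ ->]]]] /=.
  apply: (closed_span_sub (linr _) (closedr _)) hx => _ [p [q [b [Nb ->]]]] /=.
  by apply: step; left.
Qed.

Lemma O_of_mono (N1 N2 : hom_family L) : fam_sub N1 N2 -> O_of iota N1 `<=` O_of iota N2.
Proof.
move=> h; apply: closed_span_sub; [exact: closed_span_lin|exact: closed_span_closed|].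
move=> _ [n [m [a [Na ->]]]]; apply: closed_span_gen; exists n, m, a; split => //.
exact: h.
Qed.

Lemma iota_inv_mono (P Q : set O) : P `<=` Q -> fam_sub (iota_inv iota P) (iota_inv iota Q).
Proof. by move=> PQ n m a; apply: PQ. Qed.

Lemma iota_inv_O_of (N : hom_family L) : inv_sat_ideals L N ->
  iota_inv iota (O_of iota N) = N.
Proof.
move=> [iN tN sN]; apply: functional_extensionality_dep => n; apply: functional_extensionality_dep => m;
 apply/seteqP; split; last first.
  by move=> a Na; apply: closed_span_gen; exists n, m, a.
move=> a; rewrite /iota_inv /= => ha.
apply: (closed_approx (@ideal_closed _ _ _ iN n m)) => e e0.
(* [lift_distance] multiplies by 4, so e / 8 ends as e / 2. *)
have e4 : 0 < e / 8 by rewrite divr_gt0.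
have rN : is_rtrep N iota by case: ri => h1 h2 h3; split=> *; [apply: h1|apply: h2|apply: h3].
have cN : coisometric_on N iota by move=> *; apply: ci.
(* The graph of [iota] against itself describes the algebraic span of the image of N degree by
   degree. *)
have [x [y [[d0 hx0] ax]]] := graph_fst_dense iN tN rN cN rN cN ha e4.
(* Enlarged so that the degree of a occurs among the indices. *)
pose d := maxn d0 `|n%:Z - m%:Z|%N.
have [p [hp xE _]] := bideg_le iN tN rN cN rN cN (leq_maxl d0 `|n%:Z - m%:Z|%N) hx0.
have dle : (`|n%:Z - m%:Z| <= d)%N by rewrite leq_maxr.
rewrite -/d in hp xE.
(* The homogeneous components of iota(a) - x; the one in the degree of a is again of norm less than
   e / 8. *)
pose x' (i : 'I_(2 * d).+1) := (if i%:Z - d%:Z == n%:Z - m%:Z then iota n m a else 0) - (p i).1.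
pose j0 := absz (n%:Z - m%:Z + d%:Z); have ej : j0%:Z = n%:Z - m%:Z + d%:Z by rewrite /j0; lia.
have jlt : (j0 < (2 * d).+1)%N by rewrite /j0; lia.
have degE (i : 'I_(2 * d).+1) : (i%:Z - d%:Z == n%:Z - m%:Z) = (i == Ordinal jlt).
  by rewrite -val_eqE /=; lia.
have hh (i : 'I_(2 * d).+1) : homogeneous full iota (i%:Z - d%:Z) (x' i).
  rewrite /x'; have [r [q [b [Nb e1 -> _]]]] := hp i.
  have [e2|_] := eqVneq; last first.
    exists r, q, (- b); split => //.
    by rewrite -(sub0r b) iotaB (rep0 full_i ri).
  have [g1 [g2 [c [_ hc1 hc2 _]]]] : bihom full iota iota (i%:Z - d%:Z)
      (iota n m a - iota r q b) (iota n m a - iota r q b).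
    rewrite [iota n m a - _]addrC -[- iota r q b]scaleN1r; apply: (bihomDZ full_i (@full_invariant _ L) ri ci ri ci); first by exists r, q, b.
    by exists n, m, a.
  by exists g1, g2, c.
have := component_bound full_i ri (DR_circle hiota) (n%:Z - m%:Z) hh.
rewrite (big_pred1 (Ordinal jlt)) // /x' degE eqxx sumrB -xE.
under eq_bigr do rewrite degE.
rewrite -big_mkcond /= big_pred1_eq => hcomp.
have hw : bihom N iota iota (n%:Z - m%:Z) (p j0).1 (p j0).2.
  by have := hp j0; rewrite ej addrK.
have [s /(_ s (leqnn _))[b [Nb pE _]]] := bihom_raise tN cN cN hw.
have [t ht] : exists t, rnorm (tens t (tens s a - b)) < e / 8.
  apply: (DR_norm_small hiota) => //; rewrite iotaB -pE.
  rewrite (rep_tens (@full_invariant _ L) ci s (a := a)) //.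
  exact: le_lt_trans hcomp ax.
rewrite tensB in ht.
have hq : quotient_norm (N _ _) (tens t (tens s a)) <= e / 8.
  apply: le_trans (qnorm_le _ _) (ltW ht).
  exact: tens_mem.
(* Tensoring may shrink norms, so closeness of the tensored a to N says nothing directly about a.
   The lifting replaces a by a nearby b' whose tensored image lies in N, and saturation then puts b'
   in N. *)
have [b' [Nb' hb']] := lift_distance (tens_functor L s t) iN e4 hq.
exists b'; last by rewrite rnormB; apply: le_lt_trans hb' _; lra.
by apply: (tens_reflect (k := s) sN); apply: (tens_reflect (k := t) sN).
Qed.

(* Both quotients of [O] carry circle invariant C*-norms, which are equivalent
   on each homogeneous component; by the power trick they coincide. *)
Lemma O_of_iota_inv (gamma : C -> O -> O) (P : set O) :
  (forall z, circle z -> star_hom (gamma z)) ->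
  (forall z, circle z -> forall n m (a : L n m),
     gamma z (iota n m a) = z ^ (n%:Z - m%:Z) *: iota n m a) ->
  is_alg_ideal P -> (forall z, circle z -> forall x, P x -> P (gamma z x)) ->
  O_of iota (iota_inv iota P) = P.
Proof.
move=> gh gi iP gP; set N := iota_inv iota P; set P' := O_of iota N.
have Pl := alg_ideal_subspace iP; have Pc := alg_ideal_closed iP.
have sub : P' `<=` P.
  by apply: closed_span_sub => // _ [n [m [a [Na ->]]]].
apply/seteqP; split => //.
have [iN tN sN] := iota_inv_inv_sat iP.
have iP' := O_of_ideal iN tN; have P'l := alg_ideal_subspace iP'.
have [E [p [hp np _]]] := quotient_algebra iP.
have [B [p' [hp' np' _]]] := quotient_algebra iP'.
have rep_hom (D : cstar_algebra R) (f : O -> D) : star_hom f ->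
    is_rtrep full (fun n m a => f (iota n m a)) /\
    coisometric_on full (fun n m a => f (iota n m a)).
  move=> hf; split; last by move=> n m a _; rewrite -ci.
  split.
  - by move=> n m c a b _ _; rewrite iotaDZ (star_homDZ hf).
  - by move=> n m a _; rewrite -(star_homS hf) (rtrepS ri).
  - by move=> n m k l a b _ _; rewrite -(star_homM hf) (rtrepM ri).
have [rE cE] := rep_hom _ _ hp; have [rB cB] := rep_hom _ _ hp'.
(* [gamma] preserves P and is contractive, hence does not increase the distance to P; using both z
   and its inverse gives equality. *)
have circE : circle_isometric full (fun n m a => p (iota n m a)).
  move=> z z1 k a _; rewrite !normE; congr (_ %:C).
  pose X := \sum_(n < k) \sum_(m < k) iota n m (a n m).
  pose Xz w := \sum_(n < k) \sum_(m < k) w ^ (n%:Z - m%:Z) *: iota n m (a n m).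
  have -> : \sum_(n < k) \sum_(m < k) z ^ (n%:Z - m%:Z) *: p (iota n m (a n m)) = p (Xz z).
    rewrite (star_hom_sum hp); apply: eq_bigr => n _.
    by rewrite (star_hom_sum hp); apply: eq_bigr => m _; rewrite (star_homZ hp).
  have -> : \sum_(n < k) \sum_(m < k) p (iota n m (a n m)) = p X.
    rewrite (star_hom_sum hp); apply: eq_bigr => n _.
    by rewrite (star_hom_sum hp).
  have Xzgen w : circle w -> Xz w = gamma w X.
    move=> w1; rewrite (star_hom_sum (gh _ w1)); apply: eq_bigr => n _.
    by rewrite (star_hom_sum (gh _ w1)); apply: eq_bigr => m _; rewrite gi.
  have z0 := circle_unit z1; have z1' : circle z^-1 := circle_exprz (-1) z1.
  have back : gamma z^-1 (Xz z) = X.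
    rewrite (star_hom_sum (gh _ z1')); apply: eq_bigr => n _.
    rewrite (star_hom_sum (gh _ z1')); apply: eq_bigr => m _.
    rewrite (star_homZ (gh _ z1')) gi // scalerA exprz_inv -exprzDr ?unitfE //.
    by rewrite subrr expr0z scale1r.
  have qle w x : circle w -> quotient_norm P (gamma w x) <= quotient_norm P x.
    move=> w1; apply/ler_addgt0Pr => e e0.
    have [|y Py hy] := @qnorm_lt R _ _ Pl x (quotient_norm P x + e); first by rewrite ltrDl.
    apply: le_trans (qnorm_le _ (gP _ w1 _ Py)) _; rewrite -(star_homB (gh _ w1)).
    exact: le_trans (star_hom_contractive (gh _ w1) _) (ltW hy).
  rewrite !np; apply/le_anti; rewrite {1}(Xzgen _ z1) qle //= -{1}back.
  exact: qle.
(* An a whose image is close to P lies within 4 times that distance of some b with iota(b) in P,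
   hence in P'. *)
have bound n m (a : L n m) : full n m a ->
    rnorm (p' (iota n m a)) <= 4 * rnorm (p (iota n m a)).
  move=> _; rewrite np np'; apply/ler_addgt0Pr => e e0.
  pose r := quotient_norm P (iota n m a) + e / 4.
  have r0 : 0 < r by rewrite ltr_wpDl ?divr_gt0 // (qnorm_ge0 Pl).
  have hr : quotient_norm P (iota n m a) <= r by rewrite lerDl divr_ge0 // ltW.
  have [b [Pb hb]] := lift_distance (rep_functor ri) (const_ideal iP) r0 hr.
  have P'b : P' (iota n m b) by apply: closed_span_gen; exists n, m, b.
  apply: le_trans (qnorm_le _ P'b) _; rewrite -iotaB.
  apply: le_trans (iota_le _) _; rewrite rnormB; apply: le_trans hb _.
  by rewrite /r; lra.
have contr x y : graph full (fun n m a => p (iota n m a)) (fun n m a => p' (iota n m a)) x y ->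
    rnorm y <= rnorm x.
  move=> [d]; exact: (@bideg_contractive _ _ _ full_i (@full_invariant _ L) _ _ _ _
    rE cE rB cB circE 4 bound).
move=> x Px; apply: (closed_approx (alg_ideal_closed iP')) => e e0.
have e2 : 0 < e / 2 by rewrite divr_gt0.
have Sl : lin_subspace [set X | graph full (fun n m a => p (iota n m a))
    (fun n m a => p' (iota n m a)) (p X) (p' X)].
  split; first by rewrite /= (star_hom0 hp) (star_hom0 hp'); apply: graph0.
  by move=> c X Y /= hX hY; rewrite (star_homDZ hp) (star_homDZ hp'); apply: graphDZ.
have [||X /= hX xX] := @closed_span_approx R O (rep_image full iota) _ Sl _ x _ _ e2.
- by move=> _ [n [m [a [_ ->]]]]; apply: (@graph_rep _ _ _ full_i _ _ _ _ rE rB n m a).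
- by rewrite (DR_dense hiota).
(* The distance from X to P' is at most its distance to P, which is at most |x - X| because x is in
   P. *)
have h1 := contr _ _ hX; rewrite np np' in h1.
have h2 : quotient_norm P X <= rnorm (x - X).
  by rewrite rnormB; apply: qnorm_le.
have [|w P'w hw] := @qnorm_lt R _ _ P'l X (e / 2); first by lra.
by exists w => //; have := rnorm_dist x X w; lra.
Qed.

End GaugeIdeals.

Section Lattices.

(** Bounds are transported back along the bijection, so the lattice property has to be established
    only among gauge invariant ideals. *)
Lemma order_iso_lattice (X Y : Type) (A : set X) (leA : X -> X -> Prop) (B : set Y)
    (leB : Y -> Y -> Prop) (f : X -> Y) : set_bij A B f ->
  (forall x y, A x -> A y -> (leA x y <-> leB (f x) (f y))) -> is_lattice B leB ->
  lattice_iso A leA B leB f.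
Proof.
move=> fbij fle lB; have [fAB finj fsurj] := fbij.
have fB x : A x -> B (f x) by exact: fAB.
split => //.
- move=> x y Ax Ay; have [[m [Bm mx my hm]] [j [Bj xj yj hj]]] := lB _ _ (fB _ Ax) (fB _ Ay).
  have [a Aa ma] := fsurj _ Bm; have [b Ab jb] := fsurj _ Bj; subst m j.
  split; [exists a|exists b]; split => //; try by apply/fle.
  + by move=> w Aw /fle wx /fle wy; apply/fle => //; apply: hm; auto.
  + by move=> w Aw /fle wx /fle wy; apply/fle => //; apply: hj; auto.
- move=> x y m Ax Ay [Am mx my hm]; split; try by [apply: fB|apply/fle].
  move=> w Bw; have [a Aa <-] := fsurj _ Bw => /fle ax /fle ay.
  by apply/fle => //; apply: hm; auto.
- move=> x y j Ax Ay [Aj xj yj hj]; split; try by [apply: fB|apply/fle].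
  move=> w Bw; have [a Aa <-] := fsurj _ Bw => /fle ax /fle ay.
  by apply/fle => //; apply: hj; auto.
Qed.

End Lattices.

(** * The gauge action in terms of the universal representation of K_J *)

Section GaugeAction.
Variables (R : realType) (T : rt_precategory R) (K J : hom_family T).
Variables (hK : is_ideal K) (L : rt_precategory R) (phi : forall n m, mat T -> L n m).
Hypothesis (hL : is_KJ K J phi).
Variables (O : cstar_algebra R) (i : forall n m, T n m -> O).
Variables (iota : forall n m, L n m -> O) (hiota : is_DR (fam_full L) iota).
Arguments phi : clear implicits.
Arguments iota : clear implicits.
Arguments i : clear implicits.
Arguments K : clear implicits.
Hypothesis (hid : forall n m (a : T n m), K n m a ->
  i n m a = iota n m (phi n m (single a))).
Variables (gamma : R[i] -> O -> O) (hgamma : is_gauge_action K i gamma).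

Let K0 n m : K n m 0. Proof. exact: (ideal_subspace hK _ _).1. Qed.

Lemma Mspace_single k n m (b : T n m) : K n m b ->
  Mspace K (k + n)%N (k + m)%N (single b).
Proof.
move=> Kb; split.
  split; first exact: single_mem.
  apply: (sub_finite_set (B := [set (n, m)])); last exact: finite_set1.
  move=> [i1 j1] /=; have [e|h] := pselect ((n, m) = (i1, j1)); first by rewrite e.
  by rewrite single_off // eqxx.
move=> i1 j1; have [[<- <-]|h] := pselect ((n, m) = (i1, j1)).
  by move=> _; split; [lia|rewrite leq_addl].
by rewrite single_off // eqxx.
Qed.

Lemma tens_phi_single k n m (b : T n m) : K n m b ->
  tens k (phi n m (single b)) = phi (k + n)%N (k + m)%N (single b).
Proof.
move=> Kb; elim: k => [|k IHk] //=; rewrite IHk (KJ_tens hL) //.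
exact: Mspace_single.
Qed.

(** The action is prescribed on the image of K only. An element of K_J is the class of a finitely
    supported matrix whose nonzero entries all have index difference n - m, so they pick up the same
    power of z; induction on a list containing the support reduces to single entries. *)
Lemma gauge_iota z : circle z -> forall n m (x : L n m),
  gamma z (iota n m x) = z ^ (n%:Z - m%:Z) *: iota n m x.
Proof.
move=> z1 n m x; have [a Ma <-] := KJ_surj hL x.
have gh := gauge_hom hgamma z1.
pose zero : mat T := fun _ _ => 0.
have eq_mat (u v : mat T) : (forall p q, u p q = v p q) -> u = v.
  move=> uv; apply: functional_extensionality_dep => p.
  by apply: functional_extensionality_dep => q.
have M0 : Mspace K n m zero.
  split; last by move=> i1 j1; rewrite eqxx.
  split=> [? ?|]; first exact: K0.
  by apply: (sub_finite_set (B := set0)) => // q' /=; rewrite eqxx.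
have phi0 : phi n m zero = 0.
  have := KJ_lin hL 1 M0 M0; rewrite scale1r.
  rewrite (_ : mat_lin 1 zero zero = zero); last first.
    by apply: eq_mat => p q; rewrite /mat_lin scaler0 addr0.
  by move=> e; apply: (addrI (phi n m zero)); rewrite addr0 -e.
have iotaDZ c u v : iota n m (c *: u + v) = c *: iota n m u + iota n m v.
  exact: (rtrepDZ (DR_rep hiota)).
have iota0 : iota n m 0 = 0 by rewrite (rep0 (full_ideal L) (DR_rep hiota)).
have [s hs] : exists s : seq (nat * nat), forall q, a q.1 q.2 != 0 -> q \in s.
  have [[_ /finite_seqP[s sE]] _] := Ma; exists s => q hq.
  by have : [set` s] q by rewrite -sE.
elim: s a Ma hs => [|[p q] s IHs] a Ma hs.
  have -> : a = zero by apply: eq_mat => p q; apply/eqP/negPn/negP => /(hs (p, q)).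
  by rewrite phi0 iota0 (star_hom0 gh) scaler0.
have [ha ha'] := Ma; have [Ka fa] := ha.
pose a' : mat T := fun i1 j1 => if (i1, j1) == (p, q) then 0 else a i1 j1.
have a'0 i1 j1 : a' i1 j1 != 0 -> (i1, j1) != (p, q) /\ a i1 j1 != 0.
  by rewrite /a'; case: ifP => [|/negbT]; rewrite ?eqxx.
have Ma' : Mspace K n m a'.
  split; last by move=> i1 j1 /a'0[_]; exact: ha'.
  split; first by move=> i1 j1; rewrite /a'; case: ifP.
  by apply: sub_finite_set fa => q' /= /a'0[].
have hs' q' : a' q'.1 q'.2 != 0 -> q' \in s.
  case: q' => i1 j1 /a'0[/negbTE ne /(hs (i1, j1))].
  by rewrite inE ne.
have Ms : Mspace K n m (single (a p q)).
  have [apq|apq] := eqVneq (a p q) 0.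
    rewrite (_ : single _ = zero) //; apply: eq_mat => i1 j1.
    have [e|ne] := pselect ((p, q) = (i1, j1)); last by rewrite single_off.
    by case: e => <- <-; rewrite single_diag.
  have [e1 e2] := ha' _ _ apq.
  have em : m = (m - q + q)%N by lia.
  have en : n = (m - q + p)%N by lia.
  by move: (m - q)%N em en => k -> ->; apply: Mspace_single.
have aE : a = mat_lin 1 (single (a p q)) a'.
  apply: eq_mat => i1 j1; rewrite /mat_lin scale1r /a'.
  case: eqP => [[-> ->]|ne]; first by rewrite single_diag addr0.
  by rewrite single_off ?add0r // => e; apply: ne.
rewrite aE (KJ_lin hL) // iotaDZ !scale1r (star_homD gh) scalerDr (IHs a') //.
congr (_ + _).
have [apq|apq] := eqVneq (a p q) 0.
  suff -> : single (a p q) = zero by rewrite phi0 iota0 (star_hom0 gh) scaler0.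
  apply: eq_mat => i1 j1.
  have [e|ne] := pselect ((p, q) = (i1, j1)); last by rewrite single_off.
  by case: e => <- <-; rewrite single_diag.
have [e1 e2] := ha' _ _ apq.
have em : m = (m - q + q)%N by lia.
have en : n = (m - q + p)%N by lia.
have -> : n%:Z - m%:Z = p%:Z - q%:Z by rewrite e1.
suff -> : iota n m (phi n m (single (a p q))) = i p q (a p q).
  exact: (gauge_gen hgamma).
(* At position (n, m), the class of a single entry is a tensored copy of its class at (p, q), and
   [iota] does not see tensoring. *)
rewrite hid //; move: (m - q)%N em en => k -> ->.
rewrite -tens_phi_single // (rep_tens (@full_invariant _ L) (DR_coisometric hiota)) //.
Qed.

End GaugeAction.

(** * Identification of DR(N) with O(N) *)

Section IdealsAsDR.
Variables (R : realType) (L : rt_precategory R) (O : cstar_algebra R).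
Variables (iota : forall n m, L n m -> O).
Hypothesis (hiota : is_DR (fam_full L) iota).
Variables (N : hom_family L) (iN : is_ideal N) (tN : tens_invariant N).
Arguments iota : clear implicits.
Arguments N : clear implicits.

Let rN : is_rtrep N iota.
Proof. by case: (DR_rep hiota) => h1 h2 h3; split=> *; [apply: h1|apply: h2|apply: h3]. Qed.
Let cN : coisometric_on N iota.
Proof. by move=> *; apply: (DR_coisometric hiota). Qed.
Let circN : circle_isometric N iota.
Proof. by move=> z z1 k a _; apply: (DR_circle hiota z1). Qed.

Lemma exists_ideal_DR : exists (E : cstar_algebra R) (kappa : forall n m, L n m -> E),
  is_DR N kappa.
Proof.
have iP := O_of_ideal hiota iN tN.
have [E [j [hj nj jP]]] := ideal_algebra iP.
have j_inj x y : j x = j y -> x = y.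
  move=> e; apply/eqP; rewrite -subr_eq0; apply/eqP/rnorm_eq0.
  by rewrite -nj (star_homB hj) e subrr rnorm0.
(* A right inverse of the embedding on O(N), with value 0 elsewhere. *)
have /boolp.choice[k hk] (x : O) : exists y, O_of iota N x -> j y = x.
  have [Px|nPx] := pselect (O_of iota N x); last by exists 0.
  have [y _ yx] : range j x by rewrite jP.
  by exists y.
pose kappa n m a := k (iota n m a).
have jk n m a : N n m a -> j (kappa n m a) = iota n m a.
  by move=> Na; apply: hk; apply: closed_span_gen; exists n, m, a.
exists E, kappa; split.
- split.
  + move=> n m c a b Na Nb; apply: j_inj; rewrite (star_homDZ hj) !jk ?(rtrepDZ rN) //.
    exact: (ideal_subspace iN n m).2.
  + move=> n m a Na; apply: j_inj; rewrite (star_homS hj) !jk ?(rtrepS rN) //.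
    exact: ideal_star.
  + move=> n m q l a b Na Nb; apply: j_inj; rewrite (star_homM hj) !jk ?(rtrepM rN) //.
    exact: (ideal_compl iN).
- move=> n m a Na; apply: j_inj; rewrite !jk //; [exact: cN|exact: tN].
- by move=> n m a Na; rewrite -nj jk //; apply: (DR_norm hiota).
- apply/seteqP; split => // x _; apply/closureP => e e0.
  have Px : O_of iota N (j x) by rewrite -jP; exists x.
  have Sl : lin_subspace [set y | exists2 u,
      smallest (@lin_subspace R E) (rep_image N kappa) u & j u = y].
    split; first by exists 0; [move=> S [Sl _]; exact: Sl.1|exact: star_hom0].
    move=> c y y' [u hu <-] [u' hu' <-]; exists (c *: u + u').
      by move=> S hS; apply: hS.1.2; [apply: hu|apply: hu'].
    exact: (star_homDZ hj).
  have [|y [u hu uy] hy] := closed_span_approx Sl _ Px e0.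
    move=> _ [n [m [a [Na ->]]]]; exists (kappa n m a); last exact: jk.
    by move=> S [_]; apply; exists n, m, a.
  by exists u => //; rewrite -nj (star_homB hj) uy.
- move=> z z1 q a Na; rewrite !normE -!nj !(star_hom_sum hj); congr (_ %:C).
  have -> : \sum_(n < q) j (\sum_(m < q) z ^ (n%:Z - m%:Z) *: kappa n m (a n m)) =
      \sum_(n < q) \sum_(m < q) z ^ (n%:Z - m%:Z) *: iota n m (a n m).
    apply: eq_bigr => n _; rewrite (star_hom_sum hj); apply: eq_bigr => m _.
    by rewrite (star_homZ hj) jk.
  have -> : \sum_(n < q) j (\sum_(m < q) kappa n m (a n m)) =
      \sum_(n < q) \sum_(m < q) iota n m (a n m).
    by apply: eq_bigr => n _; rewrite (star_hom_sum hj); apply: eq_bigr => m _; rewrite jk.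
  by have := circN z1 q Na; rewrite /rnorm => ->.
Qed.

(** Both [kappa] and [iota] restricted to N are circle isometric with the same limit norms, so the
    power argument bounds their graph in both directions. Contractivity of the graph makes Theta
    isometric, that of the swapped graph gives its range. *)
Lemma ideal_DR_unique (E : cstar_algebra R) (kappa : forall n m, L n m -> E) :
  is_DR N kappa -> exists Theta : E -> O,
    [/\ star_hom Theta, (forall x, `|Theta x| = `|x|), range Theta = O_of iota N
      & (forall n m (a : L n m), N n m a -> Theta (kappa n m a) = iota n m a)].
Proof.
move=> hk; have rk := DR_rep hk; have ck := DR_coisometric hk.
have [Th [h1 h2 h3 h4]] := integration iN tN hk rN cN.
have contr x y : graph N kappa iota x y -> rnorm y <= rnorm x.
  move=> [d]; apply: (@bideg_contractive _ _ _ iN tN _ _ _ _ rk ck rN cN (DR_circle hk) 1).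
  by move=> n m a Na; rewrite mul1r; apply: (rep_le_DR iN tN hk rN cN).
have swap x y : graph N kappa iota x y <-> graph N iota kappa y x.
  split=> -[d [p [hp xE yE]]]; exists d, (fun i => ((p i).2, (p i).1)); split => //= j;
    by have [n [m [a [Na e e1 e2]]]] := hp j; exists n, m, a.
have contr' x y : graph N iota kappa y x -> rnorm x <= rnorm y.
  move=> [d]; apply: (@bideg_contractive _ _ _ iN tN _ _ _ _ rN cN rk ck circN 1).
  move=> n m a Na; rewrite mul1r; apply: (DR_norm_le hiota) => // s.
  rewrite -(rep_tens tN ck s Na); apply: (rep_contractive iN rk); exact: tens_mem.
exists Th; split => //.
- move=> x; rewrite !normE; congr (_ %:C); apply/le_anti; rewrite h4 /=.
  have [u [v [huv ux vy]]] := h2 x.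
  by apply: rlim_norm_le vy ux _ => n; apply: contr'; apply/swap.
- apply/seteqP; split=> [_ [x _ <-]|y hy].
    have [u [v [huv ux vy]]] := h2 x.
    apply: closed_rlim vy; first exact: closed_span_closed.
    by move=> n; apply: graph_span (huv n).
  have [x [v [u [hvu vy ux]]]] := closed_graph_total iN tN rN cN rk ck
    (fun a b => @contr' b a) hy.
  exists x => //; apply: (closed_graph_functional iN tN rk ck rN cN contr (h2 x)).
  by exists u, v; split => // n; apply/swap.
Qed.

End IdealsAsDR.

(** The correspondence rests on the two inverse identities [iota_inv_O_of] and [O_of_iota_inv];
    representations enter through the quotient maps of O by O(N), which realise every admissible N
    as a kernel. *)
Theorem theorem7p6 (R : realType) (T : rt_precategory R) (K J : hom_family T)
  (hK : is_ideal K) (hJ : is_ideal J) (hJK : fam_sub J (J_ideal K))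
  (L : rt_precategory R) (phi : forall n m, mat T -> L n m)
  (hL : is_KJ K J phi)
  (O : cstar_algebra R) (i : forall n m, T n m -> O)
  (hO : is_universal_algebra K J i)
  (iota : forall n m, L n m -> O) (hiota : is_DR (fam_full L) iota)
  (hid : forall n m (a : T n m), K n m a ->
     i n m a = iota n m (phi n m (single a)))
  (gamma : R[i] -> O -> O) (hgamma : is_gauge_action K i gamma) :
  [/\ rep_kernels L = inv_sat_ideals L,
      set_bij (inv_sat_ideals L) (gauge_ideals gamma) (O_of iota),
      (forall N : hom_family L, inv_sat_ideals L N -> iota_inv iota (O_of iota N) = N)
    & (forall P : set O, gauge_ideals gamma P ->
         inv_sat_ideals L (iota_inv iota P) /\ O_of iota (iota_inv iota P) = P)] /\
  (forall N1 N2 : hom_family L, inv_sat_ideals L N1 -> inv_sat_ideals L N2 ->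
     (fam_sub N1 N2 <-> O_of iota N1 `<=` O_of iota N2)) /\
  (* every coisometric representation pi integrates to a unique Psi; its kernel
     contains O(ker pi), with equality when that kernel is gauge invariant *)
  (forall (B : cstar_algebra R) (pi : forall n m, L n m -> B),
     is_rtrep (fam_full L) pi -> coisometric_on (fam_full L) pi ->
     exists Psi : O -> B,
       [/\ integrates (fam_full L) iota pi Psi,
           (forall Psi', integrates (fam_full L) iota pi Psi' -> Psi' = Psi),
           O_of iota (rep_ker (fam_full L) pi) `<=` alg_ker Psi
         & (gauge_invariant gamma (alg_ker Psi) ->
              alg_ker Psi = O_of iota (rep_ker (fam_full L) pi))]) /\
  (* every kernel N is the kernel of some pi with ker Psi = O(N) *)
  (forall N : hom_family L, rep_kernels L N ->
     exists (B : cstar_algebra R) (pi : forall n m, L n m -> B) (Psi : O -> B),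
       [/\ is_rtrep (fam_full L) pi, coisometric_on (fam_full L) pi,
           rep_ker (fam_full L) pi = N, integrates (fam_full L) iota pi Psi
         & alg_ker Psi = O_of iota N]) /\
  (forall (N : hom_family L) (P : set O), inv_sat_ideals L N -> P = O_of iota N ->
     P = closed_span [set x | exists n m (a : L n m), N n m a /\ x = iota n m a] /\
     (exists (E : cstar_algebra R) (kappa : forall n m, L n m -> E),
        is_DR N kappa) /\
     (forall (E : cstar_algebra R) (kappa : forall n m, L n m -> E),
        is_DR N kappa ->
        exists Theta : E -> O,
          [/\ star_hom Theta, (forall x, `|Theta x| = `|x|), range Theta = P
            & (forall n m (a : L n m), N n m a ->
                 Theta (kappa n m a) = iota n m a)])) /\
  lattice_iso (inv_sat_ideals L) (@fam_sub R L)
    (gauge_ideals gamma) (@subset O) (O_of iota).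
Proof.
have full_i : is_ideal (fam_full L) := full_ideal L.
have full_t := @full_invariant _ L.
have gh := gauge_hom hgamma.
have gi := gauge_iota hK hL hiota hid hgamma.
(* The inverse of [gamma z] is found on generators and extended by density; it turns stability of P
   into the equality that gauge invariance demands. *)
have gK z x : circle z -> gamma z (gamma z^-1 x) = x.
  move=> z1; have z1' : circle z^-1 := circle_exprz (-1) z1.
  suff e : gamma z \o gamma z^-1 = id by rewrite -[LHS]/((gamma z \o gamma z^-1) x) e.
  apply: (star_hom_eq (DR_dense hiota)).
  - exact: star_hom_comp (gh _ z1') (gh _ z1).
  - by split.
  move=> y [n [m [a [_ ->]]]] /=.
  rewrite gi // (star_homZ (gh _ z1)) gi // scalerA exprz_inv -exprzDr.
    by rewrite addNr expr0z scale1r.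
  by rewrite unitfE; apply: circle_unit.
have gauge_sub P : gauge_invariant gamma P <->
    forall z, circle z -> forall x, P x -> P (gamma z x).
  split=> [h z z1 x Px|h z z1]; first by rewrite -(h z z1); exists x.
  apply/seteqP; split=> [_ [x Px <-]|x Px]; first exact: h.
  exists (gamma z^-1 x); last exact: gK.
  by apply: h => //; exact: (circle_exprz (-1) z1).
have O_gauge N : inv_sat_ideals L N -> gauge_ideals gamma (O_of iota N).
  move=> [iN tN sN]; split; first exact: O_of_ideal.
  apply/gauge_sub => z z1 x hx; have gz := gh _ z1.
  have Pl := closed_span_lin (rep_image N iota).
  apply: (@closed_span_sub _ _ (rep_image N iota)
    [set y | O_of iota N (gamma z y)] _ _ _ x hx).
  - split; first by rewrite /= (star_hom0 gz); exact: Pl.1.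
    by move=> c y y' hy hy'; rewrite /= (star_homDZ gz); apply: Pl.2.
  - apply: closed_of_approx => y hy; apply: (closed_approx (@closed_span_closed _ _ _)) => e /hy[y' hy' yy'].
    exists (gamma z y') => //; rewrite -(star_homB gz).
    exact: le_lt_trans (star_hom_contractive gz _) yy'.
  - move=> _ [n [m [a [Na ->]]]] /=; rewrite gi //; apply: (lin_subspaceZ Pl).
    by apply: closed_span_gen; exists n, m, a.
have back N : inv_sat_ideals L N -> iota_inv iota (O_of iota N) = N.
  exact: iota_inv_O_of.
have forth P : gauge_ideals gamma P ->
    inv_sat_ideals L (iota_inv iota P) /\ O_of iota (iota_inv iota P) = P.
  move=> [iP /gauge_sub gP]; split; first exact: iota_inv_inv_sat.
  exact: (O_of_iota_inv hiota gh gi iP gP).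
have bij : set_bij (inv_sat_ideals L) (gauge_ideals gamma) (O_of iota).
  split.
  - by move=> N hN; apply: O_gauge.
  - move=> N1 N2; rewrite !inE => h1 h2 e.
    by rewrite -(back _ h1) -(back _ h2) e.
  - by move=> P /forth[h1 h2]; exists (iota_inv iota P).
have order N1 N2 : inv_sat_ideals L N1 -> inv_sat_ideals L N2 ->
    (fam_sub N1 N2 <-> O_of iota N1 `<=` O_of iota N2).
  move=> h1 h2; split; first exact: O_of_mono.
  by move=> h; rewrite -(back _ h1) -(back _ h2); apply: iota_inv_mono.
(* The quotient map restricted along [iota] has kernel [iota_inv iota (O_of iota N)], which is N. *)
have quot N : inv_sat_ideals L N -> exists (B : cstar_algebra R) (Psi : O -> B),
    [/\ star_hom Psi, alg_ker Psi = O_of iota N,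
        is_rtrep (fam_full L) (fun n m a => Psi (iota n m a)),
        coisometric_on (fam_full L) (fun n m a => Psi (iota n m a))
      & rep_ker (fam_full L) (fun n m a => Psi (iota n m a)) = N].
  move=> hN; have [iP _] := O_gauge _ hN.
  have [B [p [hp np _]]] := quotient_algebra iP; exists B, p.
  have kp x : p x = 0 <-> O_of iota N x.
    split=> [px|Px].
      apply: (qnorm_closed (alg_ideal_subspace iP)); first exact: (alg_ideal_closed iP).
      by rewrite -np px rnorm0.
    by apply: rnorm_eq0; rewrite np (qnorm_mem (alg_ideal_subspace iP)).
  have ri := DR_rep hiota.
  split => //.
  - by apply/seteqP; split=> x /kp.
  - split.
    + by move=> n m c a b _ _; rewrite (rtrepDZ ri) // (star_homDZ hp).
    + by move=> n m a _; rewrite -(star_homS hp) (rtrepS ri).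
    + by move=> n m k l a b _ _; rewrite -(star_homM hp) (rtrepM ri).
  - by move=> n m a _; rewrite -(DR_coisometric hiota).
  - rewrite -[RHS](back _ hN); apply: functional_extensionality_dep => n.
    apply: functional_extensionality_dep => m; apply/seteqP; split=> a.
      by case=> _ /kp.
    by move=> /kp.
have kernels : rep_kernels L = inv_sat_ideals L.
  apply/seteqP; split=> [N [B [pi [rp cp ->]]]|N hN]; first exact: kernel_inv_sat.
  by have [B [Psi [_ _ h1 h2 h3]]] := quot N hN; exists B, (fun n m a => Psi (iota n m a)).
have gauge_cap (F : set (set O)) : (forall P, F P -> gauge_ideals gamma P) ->
    gauge_ideals gamma [set x | forall P, F P -> P x].
  move=> hF; split; last first.
    apply/gauge_sub => z z1 x hx P FP; have [_ /gauge_sub gP] := hF _ FP.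
    by apply: gP => //; apply: hx.
  split.
  - split; first by move=> P /hF[iP _]; exact: (alg_ideal_subspace iP).1.
    move=> c x y hx hy P FP; have [iP _] := hF _ FP.
    by apply: (alg_ideal_subspace iP).2; [apply: hx|apply: hy].
  - apply: closed_of_approx => x hx P FP; have [iP _] := hF _ FP.
    by apply: (closed_approx (alg_ideal_closed iP)) => e /hx[y hy xy]; exists y => //; apply: hy.
  - by move=> a b hb P FP; have [iP _] := hF _ FP; apply: (alg_ideal_mull iP); apply: hb.
  - by move=> a b ha P FP; have [iP _] := hF _ FP; apply: (alg_ideal_mulr iP); apply: ha.
have gauge_lattice : is_lattice (gauge_ideals gamma) (@subset O).
  move=> P Q hP hQ; split.
    exists [set x | forall W, [set W | W = P \/ W = Q] W -> W x]; split.
    - by apply: gauge_cap => W [] ->.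
    - by move=> x; apply; left.
    - by move=> x; apply; right.
    - by move=> W hW WP WQ x Wx V [] ->; [apply: WP|apply: WQ].
  (* The join as an intersection of upper bounds: closedness comes for free, unlike for P + Q. *)
  exists [set x | forall W, [set W | [/\ gauge_ideals gamma W, P `<=` W & Q `<=` W]] W ->
    W x]; split.
  - by apply: gauge_cap => W [].
  - by move=> x Px W [_ PW _]; apply: PW.
  - by move=> x Qx W [_ _ QW]; apply: QW.
  - by move=> W hW PW QW x; apply.
split; first by split.
split; first exact: order.
split.
  move=> B pi rp cp.
  have [Psi [hPsi _ hi _]] := integration full_i full_t hiota rp cp.
  have kerE : iota_inv iota (alg_ker Psi) = rep_ker (fam_full L) pi.
    apply: functional_extensionality_dep => n.
    apply: functional_extensionality_dep => m; apply/seteqP; split=> a.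
      by rewrite /iota_inv /alg_ker /= hi.
    by case=> _ pa; rewrite /iota_inv /alg_ker /= hi.
  exists Psi; split => //.
  - move=> Psi' [hPsi' hi']; apply: star_hom_eq (DR_dense hiota) hPsi' hPsi _.
    by move=> _ [n [m [a [_ ->]]]]; rewrite hi // hi'.
  - have iker := alg_ker_ideal hPsi; rewrite -kerE.
    apply: closed_span_sub; [exact: alg_ideal_subspace|exact: alg_ideal_closed|].
    by move=> _ [n [m [a [Na ->]]]].
  (* Gauge invariance is what lets [forth] recover the kernel from its homogeneous part. *)
  - move=> gker; rewrite -kerE; symmetry; apply: (forth _ _).2.
    by split => //; apply: alg_ker_ideal.
split.
  rewrite kernels => N hN; have [B [Psi [h1 h2 h3 h4 h5]]] := quot N hN.
  by exists B, (fun n m a => Psi (iota n m a)), Psi; split.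
split; last exact: order_iso_lattice.
move=> N P [iN tN sN] ->; split => //; split; first exact: (exists_ideal_DR hiota).
by move=> E kappa; apply: ideal_DR_unique.
Qed.
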